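(* Let $x_0\in\mathbb{R}^n$ with $\|x_0\|_2=1$, let $a_1,\dots,a_m\sim\mathcal N(0,I_n)$ be independent, let $y_i=f(\langle a_i,x_0\rangle)\in\mathcal Y$, $i=1,\dots,m$, be the ideal observations and $\tilde y\in\mathcal Y^m$ the actual observations, with adversarial noise parameter $\varepsilon=\big(\frac1m\sum_{i=1}^m|\tilde y_i-y_i|^2\big)^{1/2}$. Let $\mathcal L\colon\mathbb{R}\times\mathcal Y\to\mathbb{R}$ be convex and continuously differentiable in the first variable, with $\mathcal L'=\partial\mathcal L/\partial v$ Lipschitz continuous in the second variable uniformly in the first. Let $\mu,\sigma,\eta$ be the associated model parameters, and let $K\subset\mathbb{R}^n$ be a convex set with $\mu x_0\in K$. Fix $t>0$, and assume that the empirical loss $\bar{\mathcal L}_{\tilde y}$ satisfies restricted strong convexity (RSC) at scale $t$ with respect to $\mu x_0$ and $K$, and that $$m\ge d_t(K-\mu x_0).$$ Then for every prescribed probability of success $p\in(0,1)$ there exists a constant $C>0$, depending only on $p$ and on the loss $\mathcal L$ (through its RSC-constant and the Lipschitz constant of $\mathcal L'$), such that the following holds with probability at least $p$: if $$t>C\cdot t_0:=C\cdot\Big(\frac{\sigma\cdot\sqrt{d_t(K-\mu x_0)}+\eta}{\sqrt m}+\varepsilon\Big),$$ then any minimizer $\hat x$ of $$\min_{x\in\mathbb{R}^n}\ \bar{\mathcal L}_{\tilde y}(x)=\frac1m\sum_{i=1}^m\mathcal L(\langle a_i,x\rangle,\tilde y_i)\quad\text{subject to }x\in K$$ satisfies $\|\hat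 x-\mu x_0\|_2\le t$.
   Context: Observation model: $\mathcal Y\subset\mathbb{R}$ is closed and $f\colon\mathbb{R}\to\mathcal Y$ is a (possibly random) function independent of the $a_i$; the randomness of $f$ is understood measurement-wise, i.e. for each $i$ an independent copy of $f$ is used in $y_i=f(\langle a_i,x_0\rangle)$. The vector $\tilde y=(\tilde y_1,\dots,\tilde y_m)\in\mathcal Y^m$ is arbitrary; its deviation from $y$ may be deterministic or random and may depend on the $a_i$. Lipschitz assumption: there is $C_{\mathcal L'}>0$ with $|\mathcal L'(v,y)-\mathcal L'(v,\tilde y)|\le C_{\mathcal L'}|y-\tilde y|$ for all $v\in\mathbb{R}$, $y,\tilde y\in\mathcal Y$. Model parameters: with $g\sim\mathcal N(0,1)$ (independent of $f$), $\mu\in\mathbb{R}$ is the solution of $0=\mathbb{E}[\mathcal L'(\mu g,f(g))\cdot g]$ (solvability is postulated), $\sigma^2:=\mathbb{E}[\mathcal L'(\mu g,f(g))^2]$ and $\eta^2:=\mathbb{E}[\mathcal L'(\mu g,f(g))^2\cdot g^2]$ (assumed well-defined and finite), $\sigma,\eta\ge0$. Local mean width and effective dimension: for $L\subset\mathbb{R}^n$ and $t>0$, $w_t(L):=\mathbb{E}[\sup_{x\in L\cap tB_2^n}\langle g,x\rangle]$ with $g\sim\mathcal N(0,I_n)$ and $B_2^n$ the Euclidean unit ball, and $d_t(L):=w_t(L)^2/t^2$. RSC: $\bar{\mathcal L}_{\tilde y}$ satisfies RSC at scale $t$ with respect to $\mu x_0$ and $K$ with RSC-constant $C_{\mathrm{RSC}}>0$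 if $$\bar{\mathcal L}_{\tilde y}(x)-\bar{\mathcal L}_{\tilde y}(\mu x_0)-\langle\nabla\bar{\mathcal L}_{\tilde y}(\mu x_0),x-\mu x_0\rangle\ge C_{\mathrm{RSC}}\|x-\mu x_0\|_2^2\quad\text{for all }x\in K\cap(tS^{n-1}+\mu x_0).$$ Since $\bar{\mathcal L}_{\tilde y}$ depends on the random $a_i$ and $\tilde y$, RSC is a property of the realization. The RSC assumption is to be read as part of the implication inside the probability: for fixed $C_{\mathrm{RSC}}$ (on which $C$ may depend), with probability at least $p$ it holds that if RSC at scale $t$ with constant $C_{\mathrm{RSC}}$ is satisfied and $t>C t_0$, then every minimizer satisfies the bound. *)

(* Defs.v *)
From HB Require Import structures.
From mathcomp Require Import all_boot all_order all_algebra.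
From mathcomp Require Import all_classical all_reals all_analysis.

Set Implicit Arguments.
Unset Strict Implicit.
Unset Printing Implicit Defensive.

Import Order.TTheory GRing.Theory Num.Theory.
Import numFieldNormedType.Exports.

Local Open Scope classical_set_scope.
Local Open Scope ring_scope.

Definition dotv (R : realType) (n : nat) (x y : 'rV[R]_n) : R :=
  \sum_(j < n) x 0 j * y 0 j.

(* The norm `|x| of the library on 'rV[R]_n is the maximum norm. *)
Definition enorm (R : realType) (n : nat) (x : 'rV[R]_n) : R :=
  Num.sqrt (dotv x x).

Definition grad (R : realType) (n : nat) (f : 'rV[R]_n -> R) (x : 'rV[R]_n) :
    'rV[R]_n :=
  \row_j 'D_(delta_mx 0 j) f x.

Definition minimizer (R : realType) (n : nat) (f : 'rV[R]_n -> R)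
    (K : set 'rV[R]_n) (x : 'rV[R]_n) : Prop :=
  K x /\ forall z, K z -> f x <= f z.

Section std_normal_vector.
Variable R : realType.

Definition cons_coord (n : nat)
    (z : measurableTypeR R * n.-tuple (measurableTypeR R)) :
    n.+1.-tuple (measurableTypeR R) :=
  [the n.+1.-tuple (measurableTypeR R) of z.1 :: z.2].

Lemma measurable_cons_coord (n : nat) :
  measurable_fun [set: measurableTypeR R * n.-tuple (measurableTypeR R)]
    (@cons_coord n).
Proof. exact: measurable_cons. Qed.

HB.instance Definition _ (n : nat) := isMeasurableFun.Build _ _ _ _ _
  (@measurable_cons_coord n).

(* N(0, I_n), as the n-fold product of N(0, 1). *)
Fixpoint std_normal (n : nat) : probability (n.-tuple (measurableTypeR R)) R :=
  match n with
  | 0 => \d_([tuple] : 0.-tuple (measurableTypeR R))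
  | k.+1 => distribution (normal_prob (0 : R) 1 \x std_normal k)%E (@cons_coord k)
  end.

Lemma std_normal_box (n : nat) (B : 'I_n -> set (measurableTypeR R)) :
  (forall i, measurable (B i)) ->
  std_normal n [set g | forall i, B i (tnth g i)] =
  (\prod_(i < n) normal_prob (0 : R) 1 (B i))%E.
Proof.
elim: n B => [|n IH] B mB.
  by rewrite big_ord0 /= diracE mem_set//; case.
rewrite big_ord_recl -IH; last by move=> i; exact: mB.
rewrite /= /distribution /pushforward.
rewrite [X in _ X = _](_ : _ = B ord0 `*`
    [set g | forall i, B (lift ord0 i) (tnth g i)]).
  rewrite product_measure1E//.
  rewrite (_ : mkset _ = \bigcap_(i in [set: 'I_n])
    ((@tnth _ _)^~ i @^-1` B (lift ord0 i))); last first.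
    by apply/seteqP; split => g /= H i; [move=> _; exact: H|exact: (H i I)].
  apply: fin_bigcap_measurable => // i _.
  rewrite -[X in measurable X]setTI; exact: measurable_tnth.
apply/seteqP; split => -[s g]/=.
  move=> H; split; first by exact: (H ord0).
  by move=> i; move: (H (lift ord0 i)); rewrite tnthS.
move=> [H0 H] i; case: (unliftP ord0 i) => [j ->|->]; first by rewrite tnthS.
exact: H0.
Qed.

End std_normal_vector.

Definition vec (R : realType) (n : nat) (g : n.-tuple (measurableTypeR R)) :
    'rV[R]_n :=
  \row_j (tnth g j : R).

Definition euclidean_ball {R : realType} {n : nat} (t : R) : set 'rV[R]_n :=
  [set x | enorm x <= t].

Definition local_mean_width (R : realType) (n : nat) (t : R)
    (T : set 'rV[R]_n) : R :=
  fine (\int[std_normal R n]_g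
    ereal_sup [set (dotv (vec g) x)%:E | x in T `&` euclidean_ball t])%E.

Definition effective_dim (R : realType) (n : nat) (t : R)
    (T : set 'rV[R]_n) : R :=
  local_mean_width t T ^+ 2 / t ^+ 2.

Definition mutually_independent (R : realType) (d : measure_display)
    (Om : measurableType d) (P : probability Om R) (I : finType)
    (F : I -> set (set Om)) : Prop :=
  forall (J : {set I}) (E : I -> set Om), (forall i, i \in J -> F i (E i)) ->
    P (\bigcap_(i in [set` J]) E i) = (\prod_(i in J) P (E i))%E.

Definition has_law (R : realType) (d d' : measure_display)
    (Om : measurableType d) (T : measurableType d') (P : probability Om R)
    (X : {RV P >-> T}) (nu : probability T R) : Prop :=
  forall B : set T, measurable B -> distribution P X B = nu B.

(* The derivative of the loss in its first variable. *)
Definition dloss (R : realType) (L : R -> R -> R) (v y : R) : R :=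
  ((L ^~ y)^`()%classic) v.

Definition admissible_loss (R : realType) (Y : set R) (L : R -> R -> R) : Prop :=
  forall y, Y y ->
    [/\ convex_function [set: R^o] (L ^~ y),
        forall v, derivable (L ^~ y) v 1
      & continuous (dloss L ^~ y)].

Definition lipschitz_dloss (R : realType) (Y : set R) (L : R -> R -> R)
    (CL : R) : Prop :=
  forall v y y', Y y -> Y y' ->
    `|dloss L v y - dloss L v y'| <= CL * `|y - y'|.

(* A random function f : R -> R is given as f(s) = F s xi, where the seed xi has
   law nu. Under normal_prob 0 1 \x nu, the pair z = (g, xi) consists of a
   standard normal g and an independent seed, so that f(g) = F z.1 z.2. *)
Definition model_parameters (R : realType) (d : measure_display)
    (Xi : measurableType d) (nu : probability Xi R) (F : R -> Xi -> R)
    (L : R -> R -> R) (mu sigma eta : R) : Prop :=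
  let Q := (normal_prob (0 : R) 1 \x nu)%E in
  let dl (z : measurableTypeR R * Xi) := dloss L (mu * z.1) (F z.1 z.2) in
  [/\ Q.-integrable setT (fun z => (dl z * z.1)%:E)
        /\ ('E_Q[fun z => (dl z * z.1)%R] = 0)%E,
      0 <= sigma /\ ('E_Q[fun z => (dl z ^+ 2)%R] = (sigma ^+ 2)%:E)%E
    & 0 <= eta /\ ('E_Q[fun z => (dl z ^+ 2 * z.1 ^+ 2)%R] = (eta ^+ 2)%:E)%E].

Definition empirical_loss (R : realType) (n m : nat) (L : R -> R -> R)
    (a : 'I_m -> 'rV[R]_n) (y : 'I_m -> R) (x : 'rV[R]_n) : R :=
  m%:R^-1 * \sum_(i < m) L (dotv (a i) x) (y i).

Definition RSC (R : realType) (n : nat) (C t : R) (f : 'rV[R]_n -> R)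
    (x1 : 'rV[R]_n) (K : set 'rV[R]_n) : Prop :=
  forall x, K x -> enorm (x - x1) = t ->
    C * enorm (x - x1) ^+ 2 <= f x - f x1 - dotv (grad f x1) (x - x1).

Definition noise_level (R : realType) (m : nat) (y ytil : 'I_m -> R) : R :=
  Num.sqrt (m%:R^-1 * \sum_(i < m) `|ytil i - y i| ^+ 2).

(* Main.v *)
(* With x1 = mu x0, convexity and RSC reduce the claim to bounding the gradient of
   the empirical loss at x1 over the local set T = (K - x1) cap t B.  It splits
   into an adversarial part, controlled by eps times sup_T |A h|_2, and an ideal
   part, controlled by splitting every row a_i along x0: the component along x0
   gives a centered sum of variance m eta^2, and the orthogonal component is,
   given the multipliers, a Gaussian vector of length about sigma sqrt m, hence
   contributes sigma sqrt m w_t.  All bounds hold in mean, and Markov's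
   inequality gives the dependence of C on p.

   The mean of sup_T |A h|_2 is at most a constant times t sqrt m + w_t(T). For
   the l1 norm this follows row by row from an independent copy and a two-point
   contraction. The l2 norm is an average of the l1 norms of H D A h over random
   sign matrices D, where H is a normalized Hadamard matrix (Khintchine), and H D
   A has the law of A. Invariance of the Gaussian measure under isometries comes
   from the Cameron-Martin formula, a suitable isometry being a product of shears.
   Suprema are taken along a dense sequence of T. *)

Require Import Defs.
From HB Require Import structures.
From mathcomp Require Import all_boot all_order all_algebra.
From mathcomp Require Import all_classical all_reals all_analysis.
From mathcomp Require Import measurable_realfun ring lra.

Set Implicit Arguments.
Unset Strict Implicit.
Unset Printing Implicit Defensive.

Import Order.TTheory GRing.Theory Num.Theory.
Import numFieldNormedType.Exports.

Local Open Scope classical_set_scope.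
Local Open Scope ring_scope.

(** Since the constant may depend on [p] in any way, first moments suffice: Markov's inequality is
    applied with failure probability [(1 - p) / 4] to each of four events. The actual observations
    are arbitrary functions of the sample point, possibly not measurable; hence the good event is
    built from the rows and the seeds alone, and everything that involves [ytil] is deterministic on
    it. Measurability of the multiplier is taken from the integrability of its product with [g], so
    the multiplier is recovered only where the projection is nonzero; the exceptional null set is
    the fourth event. Row-by-row contraction needs a sum over rows, hence the l1 norm; bounding the
    l2 norm by it directly would lose a factor [sqrt m]. Flat orthogonal mixing spreads a vector
    over all coordinates and removes this loss. The Hadamard matrices have orders that are powers of
    two, so [m] rows are covered by two blocks of such an order. The sample size enters through
    [w_t <= t sqrt m], which makes the adversarial factor proportional to [t sqrt m]. Conditioning
    on the projections of the rows is done by resampling them in a Tonelli integral. *)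

Section density.
Import HBNNSimple.
Local Open Scope ereal_scope.

(** Monotone convergence along simple functions reduces the formula to indicators, where it is the
    hypothesis on [nu]. For the Gaussian density that hypothesis holds by definition of
    [normal_prob]. *)
Lemma ge0_integral_density d (T : measurableType d) (R : realType)
    (mu nu : {measure set T -> \bar R}) (p : T -> R) (f : T -> \bar R) :
  measurable_fun [set: T] p -> (forall x, 0 <= p x)%R ->
  (forall A, measurable A -> nu A = \int[mu]_(x in A) (p x)%:E) ->
  measurable_fun [set: T] f -> (forall x, 0 <= f x) ->
  \int[nu]_x f x = \int[mu]_x (f x * (p x)%:E).
Proof.
move=> mp p0 nuE mf f0.
pose f_ := nnsfun_approx measurableT mf.
transitivity (limn (fun n => \int[nu]_x (f_ n x)%:E)).
  rewrite -monotone_convergence//.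
  - apply: eq_integral => y _; apply/esym/cvg_lim => //.
    by apply: cvg_nnsfun_approx.
  - by move=> n; exact/measurable_EFinP/measurable_funP.
  - by move=> n y _; rewrite lee_fin.
  - by move=> y _ m n mn; rewrite lee_fin; exact/lefP/nd_nnsfun_approx.
transitivity (limn (fun n => \int[mu]_x ((f_ n x)%:E * (p x)%:E))); last first.
  rewrite -monotone_convergence//; last 3 first.
    - move=> n; apply: emeasurable_funM; first exact/measurable_EFinP/measurable_funP.
      exact/measurable_EFinP.
    - by move=> n x _; rewrite mule_ge0// lee_fin.
    - move=> x _ m n mn; apply: lee_wpmul2r; first by rewrite lee_fin.
      by rewrite lee_fin; exact/lefP/nd_nnsfun_approx.
  apply: eq_integral => x _; apply/cvg_lim => //.
  by apply: cvgeZr => //; exact: cvg_nnsfun_approx.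
apply: congr_lim; apply/funext => n.
have mpre r : measurable (f_ n @^-1` [set r]).
  by rewrite -[X in measurable X]setTI; exact: measurable_funP.
transitivity (\sum_(k \in range (f_ n))
    \int[nu]_x (k * \1_(f_ n @^-1` [set k]) x)%:E).
  rewrite -ge0_integral_fsum//.
  - by apply: eq_integral => x _; rewrite fsumEFin// -fimfunE.
  - by move=> y; exact/measurable_EFinP/measurable_funM.
  - by move=> y x _; rewrite nnfun_muleindic_ge0.
transitivity (\sum_(k \in range (f_ n))
    \int[mu]_x ((k * \1_(f_ n @^-1` [set k]) x)%:E * (p x)%:E)); last first.
  rewrite -ge0_integral_fsum//.
  - apply: eq_integral => x _; rewrite -ge0_mule_fsuml.
      by rewrite fsumEFin// -fimfunE.
    by move=> r; rewrite nnfun_muleindic_ge0.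
  - move=> y; apply: emeasurable_funM; last exact/measurable_EFinP.
    exact/measurable_EFinP/measurable_funM.
  - move=> y x _; rewrite mule_ge0 ?lee_fin//.
    by rewrite -lee_fin nnfun_muleindic_ge0.
apply: eq_fsbigr => r /set_mem [x _ <-].
under [in RHS]eq_integral do rewrite EFinM -muleA.
rewrite integralZl_indic_nnsfun// integral_indic// setIT nuE//.
rewrite ge0_integralZl_EFin//; last 2 first.
- by move=> y _; rewrite -EFinM lee_fin mulr_ge0.
- by apply/measurable_EFinP; apply: measurable_funM => //.
congr (_ * _); rewrite integral_mkcond; apply: eq_integral => y _.
rewrite patchE indicE; case: ifPn => _; by rewrite ?mul1e ?mul0e.
Qed.

End density.

(** * Translations of the one-dimensional Gaussian measure *)

Section gauss1.
Context (R : realType).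
Local Open Scope ereal_scope.
Local Notation mu := (@lebesgue_measure R).

(** Translation maps half-open intervals to half-open intervals of the same length, and these values
    determine Lebesgue measure. *)
Lemma lebesgue_measure_translate (c : R) (A : set R) : measurable A ->
  pushforward mu (fun x => (x + c)%R : measurableTypeR R) A = mu A.
Proof.
move=> mA.
have mt : @measurable_fun _ _ (measurableTypeR R) (measurableTypeR R) setT (fun x => (x + c)%R).
  by apply: measurable_funD => //; exact: measurable_cst.
pose t : {mfun measurableTypeR R >-> measurableTypeR R} :=
  @mfun_Sub _ _ (measurableTypeR R) (measurableTypeR R) _ (mem_set mt).
apply/esym; apply: (@lebesgue_measure_unique R (pushforward mu t)) => //= _ [[a b]] _ <-.
rewrite /pushforward/=.
rewrite (_ : _ @^-1` _ = `](a - c)%R, (b - c)%R]%classic); last first.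
  by apply/seteqP; split => x /=; rewrite !in_itv/= ltrBlDr lerBrDr.
by rewrite !lebesgue_measure_itv/= !lte_fin ltrD2r -!EFinB opprB addrA subrK.
Qed.

Lemma ge0_integral_lebesgue_translate (c : R) (f : R -> \bar R) :
  measurable_fun [set: R] f -> (forall r, 0 <= f r) ->
  \int[mu]_r f r = \int[mu]_r f (r + c)%R.
Proof.
move=> mf f0.
have mt : @measurable_fun _ _ (measurableTypeR R) (measurableTypeR R) setT (fun x => (x + c)%R).
  by apply: measurable_funD => //; exact: measurable_cst.
pose t : {mfun measurableTypeR R >-> measurableTypeR R} :=
  @mfun_Sub _ _ (measurableTypeR R) (measurableTypeR R) _ (mem_set mt).
transitivity (\int[pushforward mu t]_r f r).
  by apply: eq_measure_integral => //= A mA _; exact/esym/lebesgue_measure_translate.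
by rewrite ge0_integral_pushforward//= preimage_setT.
Qed.

Local Notation g1 := (normal_prob (0 : R) 1).

(** Substitute [s + c] and expand the square: the Gaussian density at [s + c] is the density at [s]
    times the exponential weight. *)
Lemma cameron_martin1 (c : R) (f : R -> R) :
  measurable_fun [set: R] f -> (forall r, 0 <= f r)%R ->
  \int[g1]_s (f s)%:E = \int[g1]_s (f (s + c) * expR (- (s * c) - c ^+ 2 / 2))%:E.
Proof.
move=> mf f0.
have mp := measurable_normal_pdf (0 : R) 1.
have p0 := normal_pdf_ge0 (0 : R) 1.
have mfc : measurable_fun [set: R] (fun s => f (s + c)%R).
  by apply: (measurableT_comp mf); apply: measurable_funD => //; exact: measurable_cst.
have mw : measurable_fun [set: R] (fun s => expR (- (s * c) - c ^+ 2 / 2)).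
  apply: measurableT_comp => //; apply: measurable_funB => //.
  by apply: measurableT_comp => //; apply: measurable_funM.
rewrite (@ge0_integral_density _ _ _ mu g1 (normal_pdf 0 1))//; last exact/measurable_EFinP.
rewrite (@ge0_integral_lebesgue_translate c); last 2 first.
  - by apply: emeasurable_funM; exact/measurable_EFinP.
  - by move=> x; rewrite mule_ge0// lee_fin.
have mfw : measurable_fun [set: R]
    (fun s => (f (s + c) * expR (- (s * c) - c ^+ 2 / 2))%:E).
  by apply/measurable_EFinP; exact: measurable_funM.
have fw0 s : (0 <= (f (s + c) * expR (- (s * c) - c ^+ 2 / 2))%:E)%E.
  by rewrite lee_fin mulr_ge0// expR_ge0.
rewrite (@ge0_integral_density _ _ _ mu g1 (normal_pdf 0 1) _ mp p0 (fun _ _ => erefl) mfw fw0).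
apply: eq_integral => s _; rewrite -!EFinM -mulrA; congr (_ * _)%:E.
rewrite !normal_pdfE ?oner_eq0// /normal_fun mulrCA; congr (_ * _)%R.
rewrite -expRD; congr expR; by field.
Qed.

End gauss1.

(** * Vectors *)

Section vectors.
Context (R : realType).

(** A section of [vec]. Gaussian measures live on tuples, which carry the product sigma-algebra,
    while functionals are written on row vectors; [unvec] transports measurability between the
    two. *)
Definition unvec n (x : 'rV[R]_n) : n.-tuple (measurableTypeR R) :=
  [tuple x 0 j | j < n].

Lemma unvecK n : cancel (@unvec n) (@vec R n).
Proof. by move=> x; apply/rowP => j; rewrite mxE tnth_mktuple. Qed.

Lemma vec_cons n (z : measurableTypeR R * n.-tuple (measurableTypeR R)) :
  vec (cons_coord z) = row_mx (\row_(j < 1) (z.1 : R)) (vec z.2) :> 'rV[R]_(1 + n).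
Proof.
apply/rowP => j; rewrite !mxE.
have [k ->|k ->] := split_ordP j.
  rewrite mxE (_ : lshift n k = ord0) //; apply/val_inj => /=.
  by case: k => -[].
rewrite mxE; rewrite (_ : rshift 1 k = lift ord0 k :> 'I_(n.+1)); last exact/val_inj.
by rewrite tnthS.
Qed.

Lemma dotvC n (x y : 'rV[R]_n) : dotv x y = dotv y x.
Proof. by apply: eq_bigr => j _; rewrite mulrC. Qed.

Lemma dotvE n (x y : 'rV[R]_n) : dotv x y = (x *m y^T) 0 0.
Proof. by rewrite mxE; apply: eq_bigr => j _; rewrite mxE. Qed.

Lemma dotvDl n (x y z : 'rV[R]_n) : dotv (x + y) z = dotv x z + dotv y z.
Proof. by rewrite /dotv -big_split/=; apply: eq_bigr => j _; rewrite mxE mulrDl. Qed.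

Lemma dotvZl n c (x z : 'rV[R]_n) : dotv (c *: x) z = c * dotv x z.
Proof. by rewrite /dotv big_distrr/=; apply: eq_bigr => j _; rewrite mxE mulrA. Qed.

Lemma dotvNl n (x z : 'rV[R]_n) : dotv (- x) z = - dotv x z.
Proof. by rewrite -scaleN1r dotvZl mulN1r. Qed.

Lemma dotvBl n (x y z : 'rV[R]_n) : dotv (x - y) z = dotv x z - dotv y z.
Proof. by rewrite dotvDl dotvNl. Qed.

Lemma dotvDr n (x y z : 'rV[R]_n) : dotv z (x + y) = dotv z x + dotv z y.
Proof. by rewrite !(dotvC z) dotvDl. Qed.

Lemma dotvZr n c (x z : 'rV[R]_n) : dotv z (c *: x) = c * dotv z x.
Proof. by rewrite !(dotvC z) dotvZl. Qed.

Lemma dotvNr n (x z : 'rV[R]_n) : dotv z (- x) = - dotv z x.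
Proof. by rewrite !(dotvC z) dotvNl. Qed.

Lemma dotvBr n (x y z : 'rV[R]_n) : dotv z (x - y) = dotv z x - dotv z y.
Proof. by rewrite dotvDr dotvNr. Qed.

Lemma dotv0r n (z : 'rV[R]_n) : dotv z 0 = 0.
Proof. by rewrite -(subrr z) dotvBr subrr. Qed.

Lemma dotv0l n (z : 'rV[R]_n) : dotv 0 z = 0.
Proof. by rewrite dotvC dotv0r. Qed.

Lemma dotv_suml n (I : Type) (r : seq I) (Q : pred I) (F : I -> 'rV[R]_n) z :
  dotv (\sum_(i <- r | Q i) F i) z = \sum_(i <- r | Q i) dotv (F i) z.
Proof.
by apply: (big_morph (fun x => dotv x z)) => [x y|]; [exact: dotvDl|exact: dotv0l].
Qed.

Lemma dotv_ge0 n (x : 'rV[R]_n) : 0 <= dotv x x.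
Proof. by apply: sumr_ge0 => j _; rewrite -expr2 sqr_ge0. Qed.

Lemma dotv_mulmx m n (x : 'rV[R]_m) (W : 'M[R]_(m, n)) (y : 'rV[R]_n) :
  dotv (x *m W) y = dotv x (y *m W^T).
Proof. by rewrite !dotvE trmx_mul trmxK mulmxA. Qed.

Lemma dotv_row_mx m n (x y : 'rV[R]_m) (u v : 'rV[R]_n) :
  dotv (row_mx x u) (row_mx y v) = dotv x y + dotv u v.
Proof. by rewrite !dotvE tr_row_mx mul_row_col mxE. Qed.

Lemma sqr_enorm n (x : 'rV[R]_n) : enorm x ^+ 2 = dotv x x.
Proof. by rewrite sqr_sqrtr// dotv_ge0. Qed.

Lemma enorm_ge0 n (x : 'rV[R]_n) : 0 <= enorm x.
Proof. exact: sqrtr_ge0. Qed.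

(** Cauchy-Schwarz, from the nonnegative square of [dotv y y] times the component of [x] orthogonal
    to [y]. *)
Lemma sqr_dotv_le n (x y : 'rV[R]_n) : dotv x y ^+ 2 <= dotv x x * dotv y y.
Proof.
have [y0|y0] := eqVneq (dotv y y) 0.
  have : dotv x y = 0.
    rewrite /dotv big1// => j _.
    have /eqP := y0; rewrite psumr_eq0; last by move=> i _; rewrite -expr2 sqr_ge0.
    by move=> /allP/(_ j (mem_index_enum _)) /=; rewrite mulf_eq0 orbb => /eqP ->; rewrite mulr0.
  by move=> ->; rewrite expr0n/= mulr_ge0 ?dotv_ge0.
have ygt0 : 0 < dotv y y by rewrite lt_def y0 dotv_ge0.
have := dotv_ge0 (dotv y y *: x - dotv x y *: y).
rewrite !(dotvBl, dotvBr, dotvZl, dotvZr) (dotvC y x) => h.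
have : 0 <= dotv y y * (dotv x x * dotv y y - dotv x y ^+ 2) by nra.
by rewrite pmulr_rge0// subr_ge0.
Qed.

Lemma dotv_le n (x y : 'rV[R]_n) : `|dotv x y| <= enorm x * enorm y.
Proof.
rewrite -sqrtr_sqr /enorm -sqrtrM ?dotv_ge0//.
by apply: ler_wsqrtr; exact: sqr_dotv_le.
Qed.

Lemma enormZ n c (x : 'rV[R]_n) : enorm (c *: x) = `|c| * enorm x.
Proof. by rewrite /enorm dotvZl dotvZr mulrA -expr2 sqrtrM ?sqr_ge0// sqrtr_sqr. Qed.

End vectors.

Section measurable_vec.
Context (R : realType) d (T : measurableType d).

(** Coordinatewise measurability, which through [unvec] is measurability into the product
    sigma-algebra of tuples. *)
Definition mvec n (f : T -> 'rV[R]_n) :=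
  forall j, measurable_fun [set: T] (fun x => f x 0 j).

Lemma mvec_unvec n (f : T -> 'rV[R]_n) : mvec f ->
  measurable_fun [set: T] (fun x => unvec (f x)).
Proof.
move=> mf; apply/measurable_fun_tnthP => i.
apply: eq_measurable_fun (mf i) => x _ /=.
by rewrite tnth_mktuple.
Qed.

Lemma mvec_comp n (F : 'rV[R]_n -> R) (f : T -> 'rV[R]_n) :
  measurable_fun setT (F \o @vec R n) -> mvec f ->
  measurable_fun [set: T] (fun x => F (f x)).
Proof.
move=> mF mf.
apply: eq_measurable_fun (measurableT_comp mF (mvec_unvec mf)) => x _ /=.
by rewrite unvecK.
Qed.

Lemma mvec_add n (f g : T -> 'rV[R]_n) : mvec f -> mvec g ->
  mvec (fun x => f x + g x).
Proof.
move=> mf mg j; apply: eq_measurable_fun (measurable_funD (mf j) (mg j)) => x _.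
by rewrite !mxE.
Qed.

Lemma mvec_opp n (g : T -> 'rV[R]_n) : mvec g -> mvec (fun x => - g x).
Proof.
move=> mg j; apply: eq_measurable_fun (measurableT_comp (@oppr_measurable R setT) (mg j)) => x _ /=.
by rewrite !mxE.
Qed.

Lemma mvec_sub n (f g : T -> 'rV[R]_n) : mvec f -> mvec g ->
  mvec (fun x => f x - g x).
Proof. by move=> mf mg; apply: mvec_add => //; exact: mvec_opp. Qed.

Lemma mvec_mulmx n k (f : T -> 'rV[R]_n) (W : 'M[R]_(n, k)) : mvec f ->
  mvec (fun x => f x *m W).
Proof.
move=> mf j.
have -> : (fun x => (f x *m W) 0 j) = (fun x => \sum_i f x 0 i * W i j).
  by apply/funext => x; rewrite mxE.
by apply: measurable_sum => i; apply: measurable_funM.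
Qed.

Lemma mvec_cst n (c : 'rV[R]_n) : mvec (fun _ => c).
Proof. by move=> j; exact: measurable_cst. Qed.

Lemma mvec_dotv n (f g : T -> 'rV[R]_n) : mvec f -> mvec g ->
  measurable_fun setT (fun x => dotv (f x) (g x)).
Proof. by move=> mf mg; apply: measurable_sum => j; exact: measurable_funM. Qed.

Lemma mvec_vec n (f : T -> n.-tuple (measurableTypeR R)) :
  measurable_fun setT f -> mvec (fun x => vec (f x)).
Proof.
move=> /measurable_fun_tnthP mf j; apply: eq_measurable_fun (mf j) => x _.
by rewrite mxE.
Qed.

End measurable_vec.

(** * Gaussian measures *)

Section gauss.
Context (R : realType).
Local Notation g1 := (normal_prob (0 : R) 1).
Local Notation T1 := (measurableTypeR R).

Lemma std_normalS_integral n (f : 'rV[R]_(1 + n) -> R) :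
  measurable_fun setT (f \o @vec R n.+1) -> (forall x, 0 <= f x)%R ->
  (\int[std_normal R n.+1]_g (f (vec g))%:E =
  \int[g1]_s \int[std_normal R n]_g (f (row_mx (\row_(j < 1) s) (vec g)))%:E)%E.
Proof.
move=> mf f0.
have mf' : measurable_fun setT (fun g => (f (vec g))%:E).
  exact/measurable_EFinP.
rewrite /= ge0_integral_distribution//=; last by move=> y; rewrite lee_fin.
under eq_integral do rewrite vec_cons.
rewrite (fubini_tonelli1 (fun z : T1 * n.-tuple T1 =>
  (f (row_mx (\row_(j < 1) (z.1 : R)) (vec z.2)))%:E))//=.
- apply: eq_measurable_fun (measurableT_comp mf' (@measurable_cons_coord R n)) => z _ /=.
  by rewrite vec_cons.
- by move=> z; rewrite lee_fin. 
Qed.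

(** Induction on the dimension: the weight of a shift is the product of the weights for the first
    coordinate and for the remaining ones, treated by the one-dimensional formula and the induction
    hypothesis. *)
Lemma cameron_martin n (v : 'rV[R]_n) (f : 'rV[R]_n -> R) :
  measurable_fun setT (f \o @vec R n) -> (forall x, 0 <= f x)%R ->
  (\int[std_normal R n]_g (f (vec g))%:E =
  \int[std_normal R n]_g
    (f (vec g + v) * expR (- dotv (vec g) v - dotv v v / 2))%:E)%E.
Proof.
elim: n v f => [|n IH] v f.
  move=> _ _.
  apply: eq_integral => g _; rewrite (_ : v = 0); last by apply/rowP => -[].
  rewrite addr0 /dotv !big_ord0 oppr0 mul0r subr0 expR0 mulr1//.
change ('rV[R]_(1 + n)) in v; change ('rV[R]_(1 + n) -> R) in f => mf f0.
pose v1 : 'rV[R]_1 := lsubmx (v : 'rV_(1 + n)).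
pose v2 : 'rV[R]_n := rsubmx (v : 'rV_(1 + n)).
have vE : v = row_mx v1 v2 by rewrite hsubmxK.
have ms : mvec (fun z : T1 * n.-tuple T1 => row_mx (\row_(j < 1) (z.1 : R)) (vec z.2)).
  have h : mvec (fun z : T1 * n.-tuple T1 => vec (cons_coord z)).
    by apply: mvec_vec; exact: measurable_cons_coord.
  by move=> j; apply: eq_measurable_fun (h j) => z _ /=; rewrite vec_cons.
have mfx x : measurable_fun setT ((fun b => f (row_mx x b)) \o @vec R n).
  apply: mvec_comp (mf) _.
  have -> : (fun b : n.-tuple T1 => row_mx x (vec b)) =
     (fun b => row_mx (\row_(j < 1) (x 0 0)) (vec b)).
    apply/funext => b; congr row_mx; apply/rowP => j.
    by rewrite mxE ord1.
  move=> j; exact: (measurable_fun_pair2 (x 0 0 : T1) (ms j)).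
have mw N (u : 'rV[R]_N) : measurable_fun setT
    (fun x : N.-tuple T1 => expR (- dotv (vec x) u - dotv u u / 2)).
  apply: measurableT_comp => //; apply: measurable_funB => //.
  apply: measurableT_comp => //; apply: mvec_dotv; last exact: mvec_cst.
  exact: (@mvec_vec _ _ _ _ id).
pose w := fun x : 'rV[R]_(1 + n) => expR (- dotv x v - dotv v v / 2).
pose w2 := fun x : 'rV[R]_n => expR (- dotv x v2 - dotv v2 v2 / 2).
pose w1 := fun s : R => expR (- (s * v 0 0) - (v 0 0) ^+ 2 / 2).
have wE s b : w (row_mx (\row_(j < 1) s) b) = (w1 s * w2 b)%R.
  rewrite /w /w1 /w2 -expRD.
  have v1E : v1 0 0 = v 0 0 by rewrite mxE; congr (v _ _); exact/val_inj.
  have -> : dotv v v = v 0 0 ^+ 2 + dotv v2 v2.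
    have -> : dotv v v = dotv v1 v1 + dotv v2 v2 by rewrite -dotv_row_mx -vE.
    by rewrite {1}/dotv big_ord1 v1E expr2.
  have -> : dotv (row_mx (\row_(j < 1) s) b) v = s * v 0 0 + dotv b v2.
    rewrite [v in LHS]vE dotv_row_mx; congr (_ + _).
    by rewrite /dotv big_ord1 v1E mxE.
  by congr expR; field.
rewrite std_normalS_integral//.
transitivity (\int[g1]_s \int[std_normal R n]_g
    (f (row_mx (\row_(j < 1) s) (vec g + v2)) * w2 (vec g))%:E)%E.
  by apply: eq_integral => s _; rewrite (IH v2 (fun b => f (row_mx (\row_(j < 1) s) b)))//.
(* Interchange the integrals so that the first coordinate becomes the inner variable and the
   one-dimensional formula applies to it; they are interchanged back afterwards. *)
rewrite (fubini_tonelli (fun z : T1 * n.-tuple T1 =>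
   (f (row_mx (\row_(j < 1) (z.1 : R)) (vec z.2 + v2)) * w2 (vec z.2))%:E)); last 2 first.
- apply/measurable_EFinP; apply: measurable_funM.
    apply: mvec_comp (mf) _.
    have -> : (fun z : T1 * n.-tuple T1 => row_mx (\row_(j < 1) (z.1 : R)) (vec z.2 + v2)) =
      (fun z => row_mx (\row_(j < 1) (z.1 : R)) (vec z.2) + row_mx 0 v2)%R.
      by apply/funext => z; rewrite add_row_mx addr0.
    by apply: mvec_add => //; exact: mvec_cst.
  exact: (measurableT_comp (mw _ v2) measurable_snd).
- by move=> z; rewrite lee_fin mulr_ge0// expR_ge0.
transitivity (\int[std_normal R n]_g \int[g1]_s
    (f (row_mx (\row_(j < 1) (s + v 0 0)%R) (vec g + v2)) * w2 (vec g) * w1 s)%:E)%E.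
  apply: eq_integral => g _.
  rewrite -(@cameron_martin1 _ (v 0%R 0%R) (fun s => f (row_mx (\row_(j < 1) (s : R)) (vec g + v2)) * w2 (vec g))%R)//.
  - apply: measurable_funM; last exact: measurable_cst.
    apply: mvec_comp (mf) _ => j.
    have := (measurable_fun_pair1 (unvec (vec g + v2)) (ms j)).
    by rewrite /= unvecK.
  - by move=> s; rewrite mulr_ge0// expR_ge0.
rewrite -(fubini_tonelli (fun z : T1 * n.-tuple T1 =>
   (f (row_mx (\row_(j < 1) ((z.1 : R) + v 0 0)%R) (vec z.2 + v2)) * w2 (vec z.2) * w1 z.1)%:E)); last 2 first.
- apply/measurable_EFinP; apply: measurable_funM; first apply: measurable_funM.
  + apply: mvec_comp (mf) _.
    have -> : (fun z : T1 * n.-tuple T1 => row_mx (\row_(j < 1) ((z.1 : R) + v 0 0)%R) (vec z.2 + v2)) =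
      (fun z => row_mx (\row_(j < 1) (z.1 : R)) (vec z.2) + row_mx (\row_(j < 1) v 0%R 0%R) v2)%R.
      apply/funext => z; rewrite add_row_mx; congr row_mx.
      by apply/rowP => j; rewrite !mxE.
    by apply: mvec_add => //; exact: mvec_cst.
  + exact: (measurableT_comp (mw _ v2) measurable_snd).
  + have mw1 : measurable_fun [set: T1] w1.
      apply: measurableT_comp => //; apply: measurable_funB => //.
      by apply: measurableT_comp => //; apply: measurable_funM.
    exact: (measurableT_comp mw1 measurable_fst).
- by move=> z; rewrite lee_fin !mulr_ge0// expR_ge0.
rewrite (@std_normalS_integral n (fun x => f (x + v) * w x)%R); last 2 first.
- apply: measurable_funM; last exact: mw.
  apply: mvec_comp (mf) _; apply: mvec_add; last exact: mvec_cst.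
  exact: (@mvec_vec _ _ _ _ id).
- by move=> x; rewrite mulr_ge0// expR_ge0.
apply: eq_integral => s _; apply: eq_integral => g _.
rewrite wE -mulrA (mulrC (w2 _)); congr (f _ * _)%:E.
rewrite [in RHS]vE add_row_mx; congr row_mx.
apply/rowP => j; rewrite !mxE !ord1; congr (s + v _ _)%R; exact/val_inj.
Qed.

End gauss.

(** * Invariance under isometries *)

Section gauss_rotation.
Context (R : realType).
Local Notation T1 := (measurableTypeR R).
Local Notation gam := (std_normal R).

Lemma integral_cst_prob d (T : measurableType d) (P : probability T R) (r : \bar R) :
  (\int[P]_x r = r)%E.
Proof.
by rewrite (integral_cst P measurableT) [X in (_ * X)%E](probability_setT P) mule1.
Qed.

Lemma mvec_vec_id n : @mvec R _ (n.-tuple T1) n (@vec R n).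
Proof. exact: (@mvec_vec _ _ _ _ id). Qed.

Lemma mvec_fst m d (T : measurableType d) :
  @mvec R _ (m.-tuple T1 * T)%type m (fun z => vec z.1).
Proof. exact: mvec_vec. Qed.

Lemma mvec_snd m d (T : measurableType d) :
  @mvec R _ (T * m.-tuple T1)%type m (fun z => vec z.2).
Proof. exact: mvec_vec. Qed.

Lemma mvec2_comp d (T : measurableType d) m n (F : 'rV[R]_m -> 'rV[R]_n -> R)
    (f : T -> 'rV[R]_m) (g : T -> 'rV[R]_n) :
  measurable_fun [set: m.-tuple T1 * n.-tuple T1] (fun z => F (vec z.1) (vec z.2)) ->
  mvec f -> mvec g -> measurable_fun [set: T] (fun x => F (f x) (g x)).
Proof.
move=> mF mf mg.
have mfg : measurable_fun [set: T] (fun x => (unvec (f x), unvec (g x))).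
  by apply: measurable_fun_pair; exact: mvec_unvec.
by apply: eq_measurable_fun (measurableT_comp mF mfg) => x _ /=; rewrite !unvecK.
Qed.

Section swap.
Variables (m n : nat).
Implicit Type F : 'rV[R]_m -> 'rV[R]_n -> R.

Let I F := (\int[gam m]_s \int[gam n]_z (F (vec s) (vec z))%:E)%E.
Let ok F := measurable_fun [set: m.-tuple T1 * n.-tuple T1]
  (fun z => F (vec z.1) (vec z.2)) /\ forall s z, 0 <= F s z.

(** [F] composed with the shear that moves [s] by [- (z *m W)] at fixed [z], times the
    Cameron-Martin weight of this shift, so that the integral does not change. [shear2] does the
    same with the roles of [s] and [z] exchanged. *)
Let shear1 (W : 'M[R]_(n, m)) F (s : 'rV[R]_m) (z : 'rV[R]_n) :=
  F (s - z *m W) z * expR (dotv s (z *m W) - dotv (z *m W) (z *m W) / 2).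

Let shear2 (W : 'M[R]_(m, n)) F (s : 'rV[R]_m) (z : 'rV[R]_n) :=
  F s (z + s *m W) * expR (- dotv z (s *m W) - dotv (s *m W) (s *m W) / 2).

Let ok_shear1 W F : ok F -> ok (shear1 W F).
Proof.
move=> [mF F0]; split=> [|s z]; last by rewrite mulr_ge0// expR_ge0.
have m1 := @mvec_fst m _ (n.-tuple T1).
have m2 := mvec_mulmx W (@mvec_snd n _ (m.-tuple T1)).
apply: measurable_funM.
  by apply: (mvec2_comp mF); [exact: mvec_sub|exact: mvec_snd].
apply: measurableT_comp => //; apply: measurable_funB; first exact: mvec_dotv.
by apply: measurable_funM => //; exact: mvec_dotv.
Qed.

Let ok_shear2 W F : ok F -> ok (shear2 W F).
Proof.
move=> [mF F0]; split=> [|s z]; last by rewrite mulr_ge0// expR_ge0.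
have m1 := mvec_mulmx W (@mvec_fst m _ (n.-tuple T1)).
have m2 := @mvec_snd n _ (m.-tuple T1).
apply: measurable_funM.
  by apply: (mvec2_comp mF); [exact: mvec_fst|exact: mvec_add].
apply: measurableT_comp => //; apply: measurable_funB.
  by apply: measurableT_comp => //; exact: mvec_dotv.
by apply: measurable_funM => //; exact: mvec_dotv.
Qed.

Let fub F : ok F ->
  I F = (\int[gam n]_z \int[gam m]_s (F (vec s) (vec z))%:E)%E.
Proof.
move=> [mF F0].
rewrite /I (fubini_tonelli (fun z => (F (vec z.1) (vec z.2))%:E))//.
  exact/measurable_EFinP.
by move=> z; rewrite lee_fin.
Qed.

Let I_shear1 W F : ok F -> I F = I (shear1 W F).
Proof.
move=> okF; rewrite (fub okF) (fub (ok_shear1 W okF)).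
have [mF F0] := okF.
apply: eq_integral => z _.
rewrite (cameron_martin (- (vec z *m W)) (measurable_fun_pair1 z mF) (fun s => F0 s _)).
by apply: eq_integral => s _; rewrite !dotvNr opprK dotvNl opprK.
Qed.

Let I_shear2 W F : ok F -> I F = I (shear2 W F).
Proof.
move=> [mF F0]; apply: eq_integral => s _.
rewrite (cameron_martin (vec s *m W) (f := fun z => F (vec s) z))//.
exact: (measurable_fun_pair2 s mF).
Qed.

(* The isometry (s, z) |-> (- z W, z + (s - z W) W^T) of R^m x R^n is a product
   of three shears, and each shear changes the Gaussian measure by the
   Cameron-Martin density. *)
Lemma gauss_swap (W : 'M[R]_(n, m)) F : W^T *m W = 1%:M ->
  measurable_fun [set: m.-tuple T1 * n.-tuple T1] (fun z => F (vec z.1) (vec z.2)) ->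
  (forall s z, 0 <= F s z) ->
  (\int[gam m]_s \int[gam n]_z (F (vec s) (vec z))%:E =
   \int[gam m]_s \int[gam n]_z
     (F (- (vec z *m W)) (vec z + (vec s - vec z *m W) *m W^T))%:E)%E.
Proof.
move=> WW mF F0.
have okF : ok F by [].
have ok1 := ok_shear1 W okF.
have ok2 := ok_shear2 W^T ok1.
transitivity (I (shear1 W (shear2 W^T (shear1 W F)))).
  by rewrite -(I_shear1 W ok2) -(I_shear2 W^T ok1) -(I_shear1 W okF).
apply: eq_integral => s _; apply: eq_integral => z _; congr (_%:E).
rewrite /shear1 /shear2.
move: (vec s) (vec z) => {}s {}z.
set c := z *m W; set s1 := s - c.
have s1W : s1 *m W^T *m W = s1 by rewrite -mulmxA WW mulmx1.
have -> : (z + s1 *m W^T) *m W = s by rewrite mulmxDl s1W /s1 addrC subrK.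
have -> : s1 - s = - c by rewrite /s1 addrAC subrr add0r.
(* The exponents of the three weights cancel because the composite map preserves the sum of the
   squared norms of [s] and [z]. *)
rewrite -!mulrA -!expRD [X in _ * expR X](_ : _ = 0) ?expR0 ?mulr1//.
have -> : dotv z (s1 *m W^T) = dotv c s1 by rewrite /c dotv_mulmx.
have -> : dotv (s1 *m W^T) (s1 *m W^T) = dotv s1 s1.
  by rewrite -dotv_mulmx s1W.
rewrite /s1 !(dotvBl, dotvBr) (dotvC c s); by field.
Qed.

End swap.

(** The swap applied to a function of its first argument alone gives [z *m V] the law of [- s], for
    every admissible [V]. Comparing [V := W] with the identity removes the sign. *)
Lemma ge0_integral_std_normal_coisometry m n (W : 'M[R]_(n, m)) (f : 'rV[R]_m -> R) :
  W^T *m W = 1%:M ->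
  measurable_fun setT (f \o @vec R m) -> (forall x, 0 <= f x) ->
  (\int[gam n]_z (f (vec z *m W))%:E = \int[gam m]_s (f (vec s))%:E)%E.
Proof.
move=> WW mf f0.
have key k (V : 'M[R]_(k, m)) : V^T *m V = 1%:M ->
    (\int[gam k]_z (f (vec z *m V))%:E = \int[gam m]_s (f (- vec s))%:E)%E.
  move=> VV; have := @gauss_swap m k V (fun s _ => f (- s)) VV.
  have -> : (\int[gam m]_s \int[gam k]_z (f (- vec s))%:E =
      \int[gam m]_s (f (- vec s))%:E)%E.
    by apply: eq_integral => s _; rewrite integral_cst_prob.
  move=> ->//; last first.
    by apply: mvec_comp mf _; apply: mvec_opp; exact: mvec_fst.
  rewrite integral_cst_prob.
  by apply: eq_integral => z _; rewrite opprK.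
rewrite (key n W WW) -(key m 1%:M) ?trmx1 ?mulmx1//.
by apply: eq_integral => s _; rewrite mulmx1.
Qed.

(** The swap applied to a function of its second argument alone. The new vector has image [s] under
    [W] and keeps the part of [z] orthogonal to the rows of [W^T]: this is conditioning on
    [z *m W]. *)
Lemma ge0_integral_std_normal_resample m n (W : 'M[R]_(n, m)) (f : 'rV[R]_n -> R) :
  W^T *m W = 1%:M ->
  measurable_fun setT (f \o @vec R n) -> (forall x, 0 <= f x) ->
  (\int[gam n]_z (f (vec z))%:E =
   \int[gam m]_s \int[gam n]_z (f (vec z + (vec s - vec z *m W) *m W^T))%:E)%E.
Proof.
move=> WW mf f0.
rewrite -(@gauss_swap m n W (fun _ z => f z))//.
  by rewrite integral_cst_prob.
exact: (mvec_comp mf (@mvec_snd _ _ _)).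
Qed.

Lemma ge0_integral_std_normalN n (f : 'rV[R]_n -> R) :
  measurable_fun setT (f \o @vec R n) -> (forall x, 0 <= f x) ->
  (\int[gam n]_z (f (- vec z))%:E = \int[gam n]_z (f (vec z))%:E)%E.
Proof.
move=> mf f0.
rewrite -(ge0_integral_std_normal_coisometry (W := - (1%:M)))//; last first.
  have -> : (- 1%:M)^T = - 1%:M :> 'M[R]_n by apply/matrixP => i j; rewrite !mxE eq_sym.
  by rewrite mulmxN mulNmx opprK mulmx1.
by apply: eq_integral => z _; rewrite mulmxN mulmx1.
Qed.

End gauss_rotation.

(** * Suprema of Gaussian processes *)

Section nonneg_integral.
Context (R : realType) d (T : measurableType d) (P : probability T R).
Implicit Types f g : T -> R.

Lemma ge0_le_integral_EFin f g : measurable_fun setT f -> measurable_fun setT g ->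
  (forall x, 0 <= f x) -> (forall x, f x <= g x) ->
  (\int[P]_x (f x)%:E <= \int[P]_x (g x)%:E)%E.
Proof.
move=> mf mg f0 fg; apply: ge0_le_integral => //.
- by move=> x _; rewrite lee_fin.
- exact/measurable_EFinP.
- exact/measurable_EFinP.
- by move=> x _; rewrite lee_fin.
Qed.

Lemma ge0_integralD_EFin f g : measurable_fun setT f -> measurable_fun setT g ->
  (forall x, 0 <= f x) -> (forall x, 0 <= g x) ->
  (\int[P]_x (f x + g x)%:E = \int[P]_x (f x)%:E + \int[P]_x (g x)%:E)%E.
Proof.
move=> mf mg f0 g0; rewrite -ge0_integralD//.
- by move=> x _; rewrite lee_fin.
- exact/measurable_EFinP.
- by move=> x _; rewrite lee_fin.
- exact/measurable_EFinP.
Qed.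

Lemma ge0_integralZl_cst c f : measurable_fun setT f ->
  (forall x, 0 <= f x) -> 0 <= c ->
  (\int[P]_x (c * f x)%:E = c%:E * \int[P]_x (f x)%:E)%E.
Proof.
move=> mf f0 c0; rewrite -ge0_integralZl_EFin//.
- by move=> x _; rewrite lee_fin.
- exact/measurable_EFinP.
Qed.

Lemma integral_EFin_ge0 f : (forall x, 0 <= f x) -> (0 <= \int[P]_x (f x)%:E)%E.
Proof. by move=> f0; apply: integral_ge0 => x _; rewrite lee_fin. Qed.

End nonneg_integral.

Section maxf.
Context (R : realType).
Implicit Types (f g : nat -> R) (N : nat).

(** The index [0] is always included. In the applications it belongs to the zero vector, which makes
    every maximum nonnegative and all integrals Tonelli integrals. *)
Fixpoint maxf f N :=
  if N is N'.+1 then Num.max (maxf f N') (f N) else f 0%N.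

Lemma le_maxf f N k : (k <= N)%N -> f k <= maxf f N.
Proof.
elim: N => [|N IH]; first by rewrite leqn0 => /eqP ->.
rewrite leq_eqVlt => /predU1P[->|kN] /=; first by rewrite le_max lexx orbT.
by rewrite le_max IH.
Qed.

Lemma maxf_attained f N : exists2 k, (k <= N)%N & maxf f N = f k.
Proof.
elim: N => [|N [k kN fk]]; first by exists 0%N.
rewrite /= fk; have [fkN|fkN] := leP (f k) (f N.+1); first by exists N.+1.
by exists k => //; rewrite leqW.
Qed.

Lemma maxf_le f N c : (forall k, (k <= N)%N -> f k <= c) -> maxf f N <= c.
Proof. by move=> fc; have [k kN ->] := maxf_attained f N; exact: fc. Qed.

Lemma maxf_ge0 f N : 0 <= f 0%N -> 0 <= maxf f N.
Proof. by move=> f0; rewrite (le_trans f0)// le_maxf. Qed.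

Lemma maxf_homo f : {homo maxf f : N M / (N <= M)%N >-> N <= M}.
Proof.
move=> N M NM; have [k kN ->] := maxf_attained f N.
by apply: le_maxf; exact: leq_trans NM.
Qed.

Lemma maxfZ f c N : 0 <= c -> maxf (fun k => c * f k) N = c * maxf f N.
Proof.
move=> c0; apply/eqP; rewrite eq_le; apply/andP; split.
  have [k kN ->] := maxf_attained (fun k => c * f k) N.
  by apply: ler_wpM2l => //; exact: le_maxf.
have [k kN ->] := maxf_attained f N.
exact: (le_maxf (fun k => c * f k)).
Qed.

(** At maximizers [k] and [l] the left side is at most [f k + f l + 2 * |x k - x l|]. Depending on
    the sign of [x k - x l], the pair [(k, l)] or [(l, k)] reaches this value on the right. *)
Lemma maxf_contraction f (x : nat -> R) N :
  maxf (fun k => f k + 2 * `|x k|) N + maxf (fun k => f k - 2 * `|x k|) N <=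
  maxf (fun k => f k + 2 * x k) N + maxf (fun k => f k - 2 * x k) N.
Proof.
have [k kN ->] := maxf_attained (fun k => f k + 2 * `|x k|) N.
have [l lN ->] := maxf_attained (fun k => f k - 2 * `|x k|) N.
have := le_maxf (fun k => f k + 2 * x k) kN.
have := le_maxf (fun k => f k + 2 * x k) lN.
have := le_maxf (fun k => f k - 2 * x k) kN.
have := le_maxf (fun k => f k - 2 * x k) lN.
have h : `|x k| <= `|x k - x l| + `|x l| by rewrite -lerBlDr lerB_dist.
move=> /= h1 h2 h3 h4.
by move: h; have [_|_] := ger0P (x k - x l) => h; lra.
Qed.

Lemma measurable_maxf d (T : measurableType d) (f : T -> nat -> R) N :
  (forall k, measurable_fun [set: T] (f ^~ k)) ->
  measurable_fun setT (fun x => maxf (f x) N).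
Proof.
move=> mf; elim: N => [|N IH] /=; first exact: mf.
exact: measurable_maxr.
Qed.

End maxf.

(** * Linearizing the absolute value of one Gaussian row *)

Section one_row.
Context (R : realType).
Local Notation T1 := (measurableTypeR R).
Local Notation gam := (std_normal R).

(** An upper bound for the first absolute moment of a standard normal [g]: [|g|] is at most
    [expR g + expR (- g)], and both exponentials have mean [expR (1 / 2)]. *)
Definition abs_moment_bound : R := 2 * expR (1 / 2).

Lemma norm_le_expR (x : R) : `|x| <= expR x + expR (- x).
Proof.
have := expR_ge1Dx x; have := expR_ge1Dx (- x).
have := expR_gt0 x; have := expR_gt0 (- x).
by have [_|_] := ger0P x; lra.
Qed.

Lemma measurable_dotv_vec n (h : 'rV[R]_n) :
  measurable_fun [set: n.-tuple T1] (fun g => dotv (vec g) h).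
Proof. by apply: mvec_dotv; [exact: mvec_vec_id|exact: mvec_cst]. Qed.

(** The Cameron-Martin formula for the constant function [1] and the shift [- h] says that the
    weight has mean [1]; this is the Laplace transform. *)
Lemma integral_expR_dotv n (h : 'rV[R]_n) :
  (\int[gam n]_g (expR (dotv (vec g) h))%:E = (expR (dotv h h / 2))%:E)%E.
Proof.
have h1 := @cameron_martin R n (- h) (fun=> 1) (measurable_cst _) (fun=> ler01).
have : (\int[gam n]_g (expR (- (dotv h h / 2)) * expR (dotv (vec g) h))%:E = 1)%E.
  rewrite /= integral_cst_prob in h1; rewrite h1; apply: eq_integral => g _.
  by rewrite mul1r -expRD dotvNr opprK dotvNl dotvNr opprK addrC.
rewrite ge0_integralZl_cst//.
- move=> /(congr1 (fun u => (expR (dotv h h / 2))%:E * u)%E).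
  by rewrite muleA -EFinM -expRD subrr expR0 mul1e mule1.
- by apply: measurableT_comp => //; exact: measurable_dotv_vec.
Qed.

Lemma integral_norm_dotv n (h : 'rV[R]_n) :
  (\int[gam n]_g (`|dotv (vec g) h|)%:E <= (abs_moment_bound * enorm h)%:E)%E.
Proof.
have [h0|h0] := eqVneq (enorm h) 0.
  have z g : dotv (vec g) h = 0.
    have := dotv_le (vec g) h; rewrite h0 mulr0 => H.
    by apply/eqP; rewrite -normr_le0.
  under eq_integral do rewrite z normr0.
  by rewrite integral_cst_prob h0 mulr0.
have hgt0 : 0 < enorm h by rewrite lt_def h0 enorm_ge0.
pose u := (enorm h)^-1 *: h.
have uu : dotv u u = 1.
  rewrite /u dotvZl dotvZr -sqr_enorm; by field.
have mu v : measurable_fun [set: n.-tuple T1] (fun g => expR (dotv (vec g) v)).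
  by apply: measurableT_comp => //; exact: measurable_dotv_vec.
apply: (@le_trans _ _ (\int[gam n]_g (enorm h * (expR (dotv (vec g) u) + expR (dotv (vec g) (- u))))%:E)%E).
  apply: ge0_le_integral_EFin => //.
  - by apply: measurableT_comp => //; exact: measurable_dotv_vec.
  - by apply: measurable_funM => //; exact: measurable_funD.
  - move=> g; have -> : dotv (vec g) h = enorm h * dotv (vec g) u.
      by rewrite /u dotvZr mulrA divff// mul1r.
    rewrite normrM (ger0_norm (enorm_ge0 _)) ler_pM2l//.
    by rewrite dotvNr norm_le_expR.
rewrite ge0_integralZl_cst; [|exact: measurable_funD| |exact: ltW]; last first.
  by move=> g; rewrite addr_ge0// expR_ge0.
rewrite ge0_integralD_EFin//; try by move=> g; rewrite expR_ge0.
rewrite !integral_expR_dotv dotvNl dotvNr opprK uu -EFinD -EFinM lee_fin.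
by rewrite /abs_moment_bound; lra.
Qed.

(* Replacing one absolute value by a linear form: compare with an independent
   copy, then use the two-point contraction inequality [maxf_contraction] and
   the symmetry of the Gaussian measure. *)
Lemma integral_max_norm_le n (hs : nat -> 'rV[R]_n) (f : nat -> R) (t : R) N :
  hs 0%N = 0 -> f 0%N = 0 -> (forall k, enorm (hs k) <= t) ->
  (\int[gam n]_g (maxf (fun k => f k + `|dotv (vec g) (hs k)|) N)%:E <=
   (abs_moment_bound * t)%:E +
   \int[gam n]_g (maxf (fun k => f k + 2 * dotv (vec g) (hs k)) N)%:E)%E.
Proof.
move=> hs0 f0 hst.
have md k := measurable_dotv_vec (hs k).
have mn k : measurable_fun [set: n.-tuple T1] (fun g => `|dotv (vec g) (hs k)|).
  exact: measurableT_comp.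
have mm c (y : n.-tuple T1 -> nat -> R) : (forall k, measurable_fun setT (y ^~ k)) ->
    measurable_fun setT (fun g => maxf (fun k => f k + c * y g k) N).
  move=> my; apply: measurable_maxf => k; apply: measurable_funD => //.
  exact: measurable_funM.
have m0 c y : y 0%N = 0 -> 0 <= maxf (fun k => f k + c * y k) N.
  by move=> y0; apply: maxf_ge0; rewrite f0 y0 mulr0 addr0.
have mN c y : maxf (fun k => f k - c * y k) N = maxf (fun k => f k + (- c) * y k) N.
  by congr (maxf _ N); apply/funext => k; rewrite mulNr.
have d0 g : dotv g (hs 0%N) = 0 by rewrite hs0 dotv0r.
have n0 g : `|dotv g (hs 0%N)| = 0 by rewrite d0 normr0.
pose M1 (g : 'rV[R]_n) := 2^-1 * maxf (fun k => f k + 2 * `|dotv g (hs k)|) N.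
pose M2 (g : 'rV[R]_n) := 2^-1 * maxf (fun k => f k - 2 * `|dotv g (hs k)|) N.
pose Pp (g : 'rV[R]_n) := 2^-1 * maxf (fun k => f k + 2 * dotv g (hs k)) N.
pose Pm (g : 'rV[R]_n) := 2^-1 * maxf (fun k => f k - 2 * dotv g (hs k)) N.
have mM1 : measurable_fun setT (fun g : n.-tuple T1 => M1 (vec g)).
  by apply: measurable_funM => //; exact: (mm 2).
have mM2 : measurable_fun setT (fun g : n.-tuple T1 => M2 (vec g)).
  apply: measurable_funM => //; under eq_fun do rewrite mN; exact: (mm (- 2)).
have mPp : measurable_fun setT (fun g : n.-tuple T1 => Pp (vec g)).
  by apply: measurable_funM => //; exact: (mm 2).
have mPm : measurable_fun setT (fun g : n.-tuple T1 => Pm (vec g)).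
  apply: measurable_funM => //; under eq_fun do rewrite mN; exact: (mm (- 2)).
have M10 g : 0 <= M1 g by rewrite mulr_ge0 ?invr_ge0// (m0 2 (fun k => `|dotv g (hs k)|)).
have M20 g : 0 <= M2 g by rewrite mulr_ge0 ?invr_ge0// mN (m0 _ (fun k => `|dotv g (hs k)|)).
have Pp0 g : 0 <= Pp g by rewrite mulr_ge0 ?invr_ge0// (m0 2 (fun k => dotv g (hs k))).
have Pm0 g : 0 <= Pm g by rewrite mulr_ge0 ?invr_ge0// mN (m0 _ (fun k => dotv g (hs k))).
set S0 := fun g : n.-tuple T1 => maxf (fun k => f k + `|dotv (vec g) (hs k)|) N.
have mS0 : measurable_fun setT S0.
  by apply: measurable_maxf => k; apply: measurable_funD.
have S00 g : 0 <= S0 g by apply: maxf_ge0; rewrite f0 n0 addr0.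
(* With an independent copy [b], write [f k + |x|] as half of [f k + 2 |x|], plus half of
   [f k - 2 |x'|], plus [|x'|], where [x] and [x'] are the products of [g] and [b] with [hs k]. Only
   the last term costs [abs_moment_bound * t]. *)
have step1 g : ((S0 g)%:E <= (M1 (vec g))%:E +
    (\int[gam n]_b (M2 (vec b))%:E + (abs_moment_bound * t)%:E))%E.
  have [k kN S0k] := maxf_attained (fun k => f k + `|dotv (vec g) (hs k)|) N.
  rewrite -(integral_cst_prob (gam n) (S0 g)%:E).
  apply: (@le_trans _ _ (\int[gam n]_b (M1 (vec g) + (M2 (vec b) + `|dotv (vec b) (hs k)|))%:E)%E).
    apply: ge0_le_integral_EFin => //.
      by apply: measurable_funD => //; exact: measurable_funD.
    move=> b; rewrite /S0 S0k.
    have h1 := le_maxf (fun k => f k + 2 * `|dotv (vec g) (hs k)|) kN.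
    have h2 := le_maxf (fun k => f k - 2 * `|dotv (vec b) (hs k)|) kN.
    rewrite /M1 /M2; move: h1 h2 => /=; lra.
  rewrite ge0_integralD_EFin//; [|exact: measurable_funD|by move=> b; rewrite addr_ge0].
  rewrite integral_cst_prob leeD2l// ge0_integralD_EFin// leeD2l//.
  apply: (le_trans (integral_norm_dotv _)).
  by rewrite lee_fin ler_wpM2l// mulr_ge0// expR_ge0.
apply: (@le_trans _ _ (\int[gam n]_g ((M1 (vec g))%:E +
    (\int[gam n]_b (M2 (vec b))%:E + (abs_moment_bound * t)%:E)))%E).
  apply: ge0_le_integral => //.
  - by move=> g _; rewrite lee_fin; exact: S00.
  - by apply/measurable_EFinP; exact: mS0.
  - by apply: emeasurable_funD => //; exact/measurable_EFinP.
  - by move=> g _; exact: step1.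
have t0 : 0 <= t by rewrite (le_trans (enorm_ge0 (hs 0%N))).
have b0 : 0 <= abs_moment_bound * t by rewrite !mulr_ge0// expR_ge0.
rewrite ge0_integralD//; [|by move=> g _; rewrite lee_fin|exact/measurable_EFinP|
  by move=> g _; rewrite adde_ge0 ?lee_fin// integral_EFin_ge0].
rewrite integral_cst_prob addeA addeC leeD2l// -ge0_integralD_EFin//.
apply: (@le_trans _ _ (\int[gam n]_g (Pp (vec g) + Pm (vec g))%:E)%E).
  apply: ge0_le_integral_EFin => //.
  - exact: measurable_funD.
  - exact: measurable_funD.
  - by move=> g; rewrite addr_ge0.
  - move=> g; rewrite /M1 /M2 /Pp /Pm -!mulrDr ler_pM2l ?invr_gt0//.
    exact: maxf_contraction.
rewrite ge0_integralD_EFin//.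
(* [Pm g] is [Pp (- g)]. *)
have -> : (\int[gam n]_g (Pm (vec g))%:E = \int[gam n]_g (Pp (vec g))%:E)%E.
  rewrite -[RHS]ge0_integral_std_normalN//.
  apply: eq_integral => g _; congr (2^-1 * maxf _ N)%:E; apply/funext => k.
  by rewrite dotvNl mulrN.
rewrite -ge0_integralD_EFin//; apply: ge0_le_integral_EFin => //.
- exact: measurable_funD.
- exact: (mm 2).
- by move=> g; rewrite addr_ge0.
- by move=> g; rewrite /Pp; lra.
Qed.

End one_row.

(** * Coisometries acting on Gaussian matrices *)

Section linear_coisometry.
Context (R : realType) (m n : nat).
Variables (phi : {linear 'rV[R]_n -> 'rV[R]_m}) (psi : {linear 'rV[R]_m -> 'rV[R]_n}).
Hypothesis adj : forall x y, dotv (phi x) y = dotv x (psi y).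
Hypothesis phiK : forall y, phi (psi y) = y.
Local Notation gam := (std_normal R).

Let W : 'M[R]_(n, m) := lin1_mx phi.

Let trW : W^T = lin1_mx psi.
Proof.
apply/matrixP => i j; rewrite mxE.
have dd k (x : 'rV[R]_k) l : dotv x (delta_mx 0 l) = x 0 l.
  rewrite /dotv (bigD1 l)//= !mxE !eqxx mulr1 big1 ?addr0// => a al.
  by rewrite mxE (negbTE al) andbF mulr0.
have Wd k l (V : 'M[R]_(k, l)) a b : V a b = dotv (delta_mx 0 a *m V) (delta_mx 0 b).
  by rewrite dd -rowE mxE.
by rewrite Wd mul_rV_lin1 adj dotvC -[in X in dotv X _]mul_rV_lin1 -Wd.
Qed.

Let WW : W^T *m W = 1%:M.
Proof.
apply/row_matrixP => i; rewrite !rowE mulmxA mulmx1 trW.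
by rewrite !mul_rV_lin1 phiK.
Qed.

(** An adjoint pair with [phi] a left inverse of [psi] stands for a coisometry. Giving both maps
    avoids writing down the matrix of an operation on vectorized matrices. *)
Lemma ge0_integral_std_normal_phi (f : 'rV[R]_m -> R) :
  measurable_fun setT (f \o @vec R m) -> (forall x, 0 <= f x) ->
  (\int[gam n]_z (f (phi (vec z)))%:E = \int[gam m]_s (f (vec s))%:E)%E.
Proof.
move=> mf f0; rewrite -(ge0_integral_std_normal_coisometry WW)//.
by apply: eq_integral => z _; rewrite mul_rV_lin1.
Qed.

Lemma ge0_integral_std_normal_replace (f : 'rV[R]_n -> R) :
  measurable_fun setT (f \o @vec R n) -> (forall x, 0 <= f x) ->
  (\int[gam n]_z (f (vec z))%:E =
   \int[gam m]_s \int[gam n]_z (f (vec z + psi (vec s - phi (vec z))))%:E)%E.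
Proof.
move=> mf f0; rewrite (ge0_integral_std_normal_resample WW mf f0).
apply: eq_integral => s _; apply: eq_integral => z _.
by rewrite trW !mul_rV_lin1.
Qed.

End linear_coisometry.

Section rows.
Context (R : realType) (M n : nat).
Implicit Types (x : 'rV[R]_(M * n)) (A B : 'M[R]_(M, n)).

Lemma dotv_mxvec A B : dotv (mxvec A) (mxvec B) = \sum_i dotv (row i A) (row i B).
Proof.
rewrite /dotv pair_bigA/=.
rewrite (reindex _ (curry_mxvec_bij M n))/=.
by apply: eq_bigr => -[i j] _ /=; rewrite !mxvecE !mxE.
Qed.

(** A linear combination of the rows and its adjoint. For a unit vector [u], the combination of the
    rows of a Gaussian matrix is standard Gaussian: a basis vector extracts a row, a constant vector
    gives the normalized sum of the rows. *)
Lemma adj_row_comb (u : 'rV[R]_M) x y :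
  dotv ((mulmx u \o vec_mx) x) y = dotv x ((mxvec \o mulmx u^T) y).
Proof.
rewrite /= dotvC [RHS]dotvC (dotvE (mxvec _)) -[x in RHS]vec_mxK mxvec_dotmul.
by rewrite dotvC dotvE.
Qed.

Lemma row_combK (u : 'rV[R]_M) (y : 'rV[R]_n) : dotv u u = 1 ->
  (mulmx u \o vec_mx) ((mxvec \o mulmx u^T) y) = y.
Proof.
move=> uu; rewrite /= mxvecK mulmxA [u *m _]mx11_scalar -dotvE uu.
by rewrite mul1mx.
Qed.

(** The vector of projections of all rows on [x0], with its adjoint; resampling it replaces the
    components of the rows along [x0]. *)
Lemma adj_row_dot (x0 : 'rV[R]_n) x s :
  dotv ((mulmx x0 \o trmx \o vec_mx) x) s =
  dotv x ((mxvec \o mulmxr x0 \o trmx) s).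
Proof.
rewrite /= [RHS]dotvC (dotvE (mxvec _)) -[x in RHS]vec_mxK mxvec_dotmul.
by rewrite dotvC dotvE trmx_mul trmxK mulmxA.
Qed.

Lemma row_dotK (x0 : 'rV[R]_n) (s : 'rV[R]_M) : dotv x0 x0 = 1 ->
  (mulmx x0 \o trmx \o vec_mx) ((mxvec \o mulmxr x0 \o trmx) s) = s.
Proof.
move=> x01; rewrite /= mxvecK trmx_mul trmxK mulmxA [x0 *m _]mx11_scalar -dotvE x01.
by rewrite mul1mx.
Qed.

End rows.

Section row_mixing.
Context (R : realType) (k M n : nat) (V : 'M[R]_(k, M)).

(** Left multiplication by [V] is adjoint to that by [V^T] for the trace pairing. It serves for the
    Hadamard mixing and for the selection of rows. *)
Lemma adj_mix (x : 'rV[R]_(M * n)) (y : 'rV[R]_(k * n)) :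
  dotv ((mxvec \o mulmx V \o vec_mx) x) y =
  dotv x ((mxvec \o mulmx V^T \o vec_mx) y).
Proof.
rewrite /= -[y in LHS]vec_mxK -[x in RHS]vec_mxK !dotv_mxvec.
set A := vec_mx x; set B := vec_mx y.
have tr (p : nat) (C D : 'M[R]_(p, n)) :
    \sum_i dotv (row i C) (row i D) = \tr (C *m D^T).
  apply: eq_bigr => i _; rewrite dotvE mxE [RHS]mxE.
  by apply: eq_bigr => j _; rewrite !mxE.
by rewrite !tr trmx_mul trmxK mulmxA [RHS]mxtrace_mulC mulmxA.
Qed.

Lemma mixK (y : 'rV[R]_(k * n)) : V *m V^T = 1%:M ->
  (mxvec \o mulmx V \o vec_mx) ((mxvec \o mulmx V^T \o vec_mx) y) = y.
Proof. by move=> VV; rewrite /= mxvecK mulmxA VV mul1mx vec_mxK. Qed.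

End row_mixing.

(** * The l1 norm of a Gaussian matrix on a finite set of vectors *)

Section l1_bound.
Context (R : realType).
Local Notation T1 := (measurableTypeR R).
Local Notation gam := (std_normal R).

Lemma integral_iter_le d1 d2 (S : measurableType d1) (T : measurableType d2)
    (P : probability S R) (Q : probability T R) (F1 F2 : S * T -> R) (c : R) :
  measurable_fun setT F1 -> measurable_fun setT F2 ->
  (forall x, 0 <= F1 x) -> (forall x, 0 <= F2 x) -> 0 <= c ->
  (forall z, \int[P]_s (F1 (s, z))%:E <= c%:E + \int[P]_s (F2 (s, z))%:E)%E ->
  (\int[P]_s \int[Q]_z (F1 (s, z))%:E <=
   c%:E + \int[P]_s \int[Q]_z (F2 (s, z))%:E)%E.
Proof.
move=> m1 m2 F10 F20 c0 h.
have e1 : measurable_fun setT (EFin \o F1) by exact/measurable_EFinP.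
have e2 : measurable_fun setT (EFin \o F2) by exact/measurable_EFinP.
rewrite (fubini_tonelli (EFin \o F1))//.
rewrite (fubini_tonelli (EFin \o F2))//.
have g1 : measurable_fun setT (fun z => \int[P]_s (F1 (s, z))%:E)%E.
  exact: (measurable_fun_fubini_tonelli_G (m1 := P) (EFin \o F1)).
have g2 : measurable_fun setT (fun z => \int[P]_s (F2 (s, z))%:E)%E.
  exact: (measurable_fun_fubini_tonelli_G (m1 := P) (EFin \o F2)).
rewrite -[X in (_ <= X + _)%E](integral_cst_prob Q) -ge0_integralD//.
- apply: ge0_le_integral => //.
  + by move=> z _; exact: integral_EFin_ge0.
  + exact: emeasurable_funD.
  + by move=> z _; exact: h.
- by move=> z _; exact: integral_EFin_ge0.
Qed.

Variables (M n : nat) (hs : nat -> 'rV[R]_n) (t : R) (N : nat).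
Hypothesis hs0 : hs 0%N = 0.
Hypothesis hst : forall k, enorm (hs k) <= t.

Let rw (x : 'rV[R]_(M * n)) (j : 'I_M) : 'rV[R]_n := row j (vec_mx x).

Let rw_replace (i : 'I_M) (x : 'rV[R]_(M * n)) (s : 'rV[R]_n) j :
  rw (x + (mxvec \o mulmx (delta_mx 0 i : 'rV[R]_M)^T)
       (s - (mulmx (delta_mx 0 i) \o vec_mx) x)) j =
  if j == i then s else rw x j.
Proof.
rewrite /rw /= linearD/= mxvecK linearD/= -rowE row_mul.
have -> : row j (delta_mx 0 i : 'rV[R]_M)^T = (j == i)%:R%:M.
  by apply/matrixP => a b; rewrite !mxE !ord1 eqxx.
rewrite mul_scalar_mx; have [->|ji] := eqVneq j i.
  by rewrite scale1r addrC subrK.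
by rewrite scale0r addr0.
Qed.

Lemma mvec_row d (T : measurableType d) (f : T -> 'rV[R]_(M * n)) j :
  mvec f -> mvec (fun x => rw (f x) j).
Proof.
move=> mf l; apply: eq_measurable_fun (mf (mxvec_index j l)) => x _.
by rewrite !mxE.
Qed.

(** Hybrid between the sum of absolute values, at [i = 0], and twice the linear sum, at [i = M]: the
    rows before [i] are already linearized. *)
Let phi i k (x : 'rV[R]_(M * n)) (j : 'I_M) : R :=
  if (j < i)%N then 2 * dotv (rw x j) (hs k) else `|dotv (rw x j) (hs k)|.

Let Phi i (x : 'rV[R]_(M * n)) := maxf (fun k => \sum_j phi i k x j) N.

Let phi0 i x j : phi i 0 x j = 0.
Proof. by rewrite /phi hs0 dotv0r mulr0 normr0 if_same. Qed.

Let mPhi i : measurable_fun setT (Phi i \o @vec R (M * n)).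
Proof.
apply: measurable_maxf => k; apply: measurable_sum => j.
have md : measurable_fun setT (fun x : (M * n).-tuple T1 => dotv (rw (vec x) j) (hs k)).
  by apply: mvec_dotv; [apply: mvec_row; exact: mvec_vec_id|exact: mvec_cst].
rewrite /phi; case: (j < i)%N; first exact: measurable_funM.
exact: measurableT_comp.
Qed.

Let Phi_ge0 i x : 0 <= Phi i x.
Proof. by apply: maxf_ge0; rewrite big1// => j _; rewrite phi0. Qed.

Let kap := @abs_moment_bound R.

Let t_ge0 : 0 <= t.
Proof. by rewrite (le_trans (enorm_ge0 (hs 0%N))). Qed.

Let kap_ge0 : 0 <= kap * t.
Proof. by rewrite !mulr_ge0// expR_ge0. Qed.

Let dotv_delta (i : 'I_M) : dotv (delta_mx 0 i) (delta_mx 0 i : 'rV[R]_M) = 1.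
Proof.
rewrite /dotv (bigD1 i)//= !mxE !eqxx mulr1 big1 ?addr0// => a al.
by rewrite mxE (negbTE al) andbF mulr0.
Qed.

(** Row [i] is resampled while all others stay fixed; their contribution plays the role of [f] in
    [integral_max_norm_le]. *)
Let Phi_step (i : 'I_M) :
  (\int[gam (M * n)]_z (Phi i (vec z))%:E <=
   (kap * t)%:E + \int[gam (M * n)]_z (Phi i.+1 (vec z))%:E)%E.
Proof.
pose u : 'rV[R]_M := delta_mx 0 i.
have uu := dotv_delta i.
have repl p := ge0_integral_std_normal_replace (adj_row_comb (n := n) u)
  (fun y => row_combK y uu) (@mPhi p) (@Phi_ge0 p).
rewrite !repl.
have mrep p : measurable_fun setT (fun z : n.-tuple T1 * (M * n).-tuple T1 =>
    Phi p (vec z.2 + (mxvec \o mulmx u^T) (vec z.1 - (mulmx u \o vec_mx) (vec z.2)))).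
  apply: mvec_comp (mPhi p) _.
  apply: mvec_add; first exact: mvec_snd.
  have mm : mvec (fun z : n.-tuple T1 * (M * n).-tuple T1 =>
      (vec z.1 - vec z.2 *m lin1_mx (mulmx u \o vec_mx)) *m lin1_mx (mxvec \o mulmx u^T)).
    by apply: mvec_mulmx; apply: mvec_sub; [exact: mvec_fst|apply: mvec_mulmx; exact: mvec_snd].
  by move=> l; apply: eq_measurable_fun (mm l) => z _; rewrite !mul_rV_lin1.
apply: (@integral_iter_le _ _ _ _ (gam n) (gam (M * n)) (fun z =>
    Phi i (vec z.2 + (mxvec \o mulmx u^T) (vec z.1 - (mulmx u \o vec_mx) (vec z.2))))
  (fun z =>
    Phi i.+1 (vec z.2 + (mxvec \o mulmx u^T) (vec z.1 - (mulmx u \o vec_mx) (vec z.2)))) (kap * t)) => //.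
move=> z /=.
pose f k := \sum_(j | j != i) phi i k (vec z) j.
have E1 s : Phi i (vec z + mxvec (u^T *m (s - u *m vec_mx (vec z)))) =
    maxf (fun k => f k + `|dotv s (hs k)|) N.
  congr (maxf _ N); apply/funext => k; rewrite (bigD1 i)//= addrC; congr (_ + _).
    by apply: eq_bigr => j ji; rewrite /phi (rw_replace i (vec z) s) (negbTE ji).
  by rewrite /phi ltnn (rw_replace i (vec z) s) eqxx.
have E2 s : Phi i.+1 (vec z + mxvec (u^T *m (s - u *m vec_mx (vec z)))) =
    maxf (fun k => f k + 2 * dotv s (hs k)) N.
  congr (maxf _ N); apply/funext => k; rewrite (bigD1 i)//= addrC; congr (_ + _).
    apply: eq_bigr => j ji; rewrite /phi (rw_replace i (vec z) s) (negbTE ji).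
    by rewrite ltnS leq_eqVlt (_ : (j == i :> nat) = false)//; exact: negbTE.
  by rewrite /phi ltnSn (rw_replace i (vec z) s) eqxx.
under eq_integral do rewrite E1.
under [in leRHS]eq_integral do rewrite E2.
apply: integral_max_norm_le => //.
by rewrite /f big1// => j _; rewrite phi0.
Qed.

Lemma integral_max_l1_le : (0 < M)%N ->
  (\int[gam (M * n)]_z
     (maxf (fun k => \sum_(j < M) `|dotv (row j (vec_mx (vec z))) (hs k)|) N)%:E <=
   (M%:R * (kap * t))%:E + (2 * Num.sqrt M%:R)%:E *
   \int[gam n]_g (maxf (fun k => dotv (vec g) (hs k)) N)%:E)%E.
Proof.
move=> M0.
have iter i : (i <= M)%N -> (\int[gam (M * n)]_z (Phi 0 (vec z))%:E <=
    (i%:R * (kap * t))%:E + \int[gam (M * n)]_z (Phi i (vec z))%:E)%E.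
  elim: i => [_|i IH iM]; first by rewrite mul0r add0e.
  apply: (le_trans (IH (ltnW iM))).
  rewrite -natr1 mulrDl mul1r EFinD -addeA leeD2l//.
  exact: (Phi_step (Ordinal iM)).
have -> : (\int[gam (M * n)]_z
     (maxf (fun k => \sum_(j < M) `|dotv (row j (vec_mx (vec z))) (hs k)|) N)%:E =
     \int[gam (M * n)]_z (Phi 0 (vec z))%:E)%E by [].
apply: (le_trans (iter M (leqnn M))); rewrite leeD2l//.
pose c : R := Num.sqrt M%:R.
have c0 : 0 < c by rewrite sqrtr_gt0 ltr0n.
have cc : c * c = M%:R by rewrite -expr2 sqr_sqrtr.
(* A unit vector with [c *: u] constantly [1]: the sum of the [M] rows is [c = sqrt M] times a
   standard Gaussian vector, whence [sqrt M] and not [M] in front of the width. *)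
pose u : 'rV[R]_M := const_mx c^-1.
have uu : dotv u u = 1.
  rewrite /dotv; under eq_bigr do rewrite !mxE.
  rewrite sumr_const card_ord -invfM cc -[LHS]mulr_natr mulVf//.
  by rewrite pnatr_eq0 -lt0n.
pose G (s : 'rV[R]_n) := maxf (fun k => dotv s (hs k)) N.
have mG : measurable_fun setT (G \o @vec R n).
  by apply: measurable_maxf => k; exact: measurable_dotv_vec.
have G0 s : 0 <= G s by apply: maxf_ge0; rewrite hs0 dotv0r.
rewrite -[X in (_ <= _ * X)%E]/(\int[gam n]_g (G (vec g))%:E)%E.
rewrite -ge0_integralZl_cst//.
rewrite -(ge0_integral_std_normal_phi (adj_row_comb (n := n) u)
  (fun y => row_combK y uu) (f := fun s => 2 * c * G s)); last 2 first.
- exact: measurable_funM.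
- by move=> s; rewrite !mulr_ge0// ltW.
rewrite le_eqVlt; apply/orP; left; apply/eqP.
apply: eq_integral => z _; congr (_%:E).
rewrite /Phi /G -maxfZ; last by rewrite mulr_ge0// ltW.
congr (maxf _ N); apply/funext => k /=.
under eq_bigr do rewrite /phi ltn_ord.
rewrite -big_distrr/= -dotv_suml -mulrA; congr (2 * _).
rewrite -dotvZl; congr (dotv _ _).
rewrite scalemxAl (_ : c *: u = const_mx 1); last first.
  by apply/rowP => j; rewrite !mxE divff ?gt_eqF.
apply/rowP => l; rewrite summxE mxE; apply: eq_bigr => j _.
by rewrite !mxE mul1r.
Qed.

End l1_bound.

(** * Khintchine's inequality for the first moment *)

Section khintchine.
Context (R : realType) (M : nat).
Local Notation signs := {ffun 'I_M -> bool}.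
Implicit Types (e : signs) (w : 'I_M -> R) (r : seq 'I_M).

Definition sg e i : R := (-1) ^+ e i.

Let flip i e : signs := [ffun j => if j == i then ~~ e j else e j].

Let flipK i : involutive (flip i).
Proof. by move=> e; apply/ffunP => j; rewrite !ffunE; case: eqP => //; rewrite negbK. Qed.

Let sg_flip i e : sg (flip i e) i = - sg e i.
Proof. by rewrite /sg ffunE eqxx; case: (e i); rewrite ?expr0 ?expr1 ?opprK. Qed.

(** Flipping the sign [i] is a bijection that fixes [g] and negates the factor, so the sum equals
    its opposite. This removes all odd terms below. *)
Let sum_sg i (g : signs -> R) : (forall e, g (flip i e) = g e) ->
  \sum_e sg e i * g e = 0.
Proof.
move=> gf; set S := LHS.
have : S = - S.
  rewrite /S [LHS](reindex_inj (inv_inj (flipK i)))/= -sumrN.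
  by apply: eq_bigr => e _; rewrite gf sg_flip mulNr.
by move=> h; lra.
Qed.

Let X w r e := \sum_(i <- r) sg e i * w i.

Let X_flip w r i e : i \notin r -> X w r (flip i e) = X w r e.
Proof.
move=> ir; rewrite /X big_seq [RHS]big_seq; apply: eq_bigr => j jr.
by rewrite /sg ffunE; case: eqP => // ji; move: ir; rewrite -ji jr.
Qed.

Let sg2 e i : sg e i ^+ 2 = 1.
Proof. by rewrite /sg sqrr_sign. Qed.

Let nsigns : R := #|{: signs}|%:R.

Let sum_signs c : \sum_(e : signs) c = nsigns * c.
Proof. by rewrite sumr_const -mulr_natl. Qed.

(** Second and fourth moments of a Rademacher sum, up to the factor [nsigns], by adding one sign at
    a time; the terms with an odd power of the new sign vanish. *)
Let moments w r : uniq r ->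
  \sum_e X w r e ^+ 2 = nsigns * (\sum_(i <- r) w i ^+ 2) /\
  \sum_e X w r e ^+ 4 <= nsigns * (3 * (\sum_(i <- r) w i ^+ 2) ^+ 2).
Proof.
elim: r => [_|i r IH /= /andP[ir ur]].
  rewrite !big_nil expr0n/= !mulr0; split.
    by rewrite big1// => e _; rewrite /X big_nil expr0n.
  by rewrite big1// => e _; rewrite /X big_nil expr0n.
have [IH2 IH4] := IH ur.
have z p : \sum_e sg e i * X w r e ^+ p = 0.
  by apply: sum_sg => e; rewrite X_flip.
have z1 : \sum_e sg e i * X w r e = 0.
  by have := z 1%N; under eq_bigr do rewrite expr1.
rewrite big_cons; set S := \sum_(j <- r) _ in IH2 IH4 *.
have E2 e : X w (i :: r) e ^+ 2 =
    w i ^+ 2 + (2 * w i * (sg e i * X w r e) + X w r e ^+ 2).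
  have := sg2 e i; rewrite /X big_cons; move: (sg e i) (\sum_(_ <- _) _) => s x s2.
  transitivity (s ^+ 2 * w i ^+ 2 + (2 * w i * (s * x) + x ^+ 2)); first by ring.
  by rewrite s2 mul1r.
have E4 e : X w (i :: r) e ^+ 4 = w i ^+ 4 + (4 * w i ^+ 3 * (sg e i * X w r e) +
    (6 * w i ^+ 2 * X w r e ^+ 2 + (4 * w i * (sg e i * X w r e ^+ 3) + X w r e ^+ 4))).
  have := sg2 e i; rewrite /X big_cons; move: (sg e i) (\sum_(_ <- _) _) => s x s2.
  transitivity ((s ^+ 2) ^+ 2 * w i ^+ 4 + (4 * w i ^+ 3 * (s ^+ 2 * (s * x)) +
    (6 * w i ^+ 2 * (s ^+ 2 * x ^+ 2) + (4 * w i * (s * x ^+ 3) + x ^+ 4)))); first by ring.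
  by rewrite s2 expr1n !mul1r.
split.
  under eq_bigr do rewrite E2.
  by rewrite !big_split/= sum_signs -!big_distrr/= z1 IH2 mulr0 add0r mulrDr.
under eq_bigr do rewrite E4.
rewrite !big_split/= sum_signs -!big_distrr/= z z1 IH2 !mulr0 !add0r.
(* The new term contributes [w i ^+ 4] once while the bound allows three times as much; the slack is
   [2 * w i ^+ 4] per sign pattern. *)
have -> : nsigns * (3 * (w i ^+ 2 + S) ^+ 2) =
  nsigns * w i ^+ 4 + (6 * w i ^+ 2 * (nsigns * S) + nsigns * (3 * S ^+ 2)) +
  2 * (nsigns * w i ^+ 4) by ring.
have n0 : 0 <= nsigns * w i ^+ 4.
  by rewrite mulr_ge0 ?ler0n// exprn_even_ge0.
by rewrite -[leLHS]addr0; apply: lerD; [rewrite lerD2l lerD2l|rewrite mulr_ge0].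
Qed.

(** An even polynomial below the absolute value. With [s = |x| / a], the difference is [a] times
    [s - s^2 + 4/27 s^4], and [4 / 27] is the coefficient for which [1 - s + 4/27 s^3] has a double
    root, at [s = 3/2]. *)
Let norm_ge (a x : R) : 0 < a -> x ^+ 2 / a - 4 / 27 * (x ^+ 4 / a ^+ 3) <= `|x|.
Proof.
move=> a0; pose s := `|x| / a.
have s0 : 0 <= s by rewrite divr_ge0// ltW.
have xs : `|x| = s * a by rewrite /s divfK// gt_eqF.
have x2 : x ^+ 2 = s ^+ 2 * a ^+ 2 by rewrite -exprMn -xs real_normK ?num_real.
have x4 : x ^+ 4 = s ^+ 4 * a ^+ 4.
  by rewrite -[4%N]/(2 * 2)%N exprM x2 exprMn -!exprM.
rewrite xs x2 x4.
have -> : s ^+ 2 * a ^+ 2 / a - 4 / 27 * (s ^+ 4 * a ^+ 4 / a ^+ 3) =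
  (s ^+ 2 - 4 / 27 * s ^+ 4) * a by field; rewrite gt_eqF.
rewrite ler_pM2r// -subr_ge0.
have -> : s - (s ^+ 2 - 4 / 27 * s ^+ 4) = s * ((1 - 2 / 3 * s) ^+ 2 * (1 + s / 3)) by field.
by rewrite mulr_ge0 // mulr_ge0 ?sqr_ge0 // addr_ge0 // divr_ge0.
Qed.

(** Average [norm_ge] over the signs with [a] the l2 norm of [w]: the second moment is [a ^+ 2], the
    fourth at most [3 * a ^+ 4], and [1 - 3 * 4/27 = 5/9]. *)
Lemma khintchine w :
  nsigns * (5 / 9 * Num.sqrt (\sum_i w i ^+ 2)) <= \sum_e `|\sum_i sg e i * w i|.
Proof.
set a := Num.sqrt _.
have a2 : a ^+ 2 = \sum_i w i ^+ 2.
  by rewrite sqr_sqrtr// sumr_ge0// => i _; rewrite sqr_ge0.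
have [a0|a0] := eqVneq a 0.
  by rewrite a0 !mulr0 sumr_ge0.
have agt0 : 0 < a by rewrite lt_def a0 sqrtr_ge0.
have [m2 m4] := @moments w (index_enum 'I_M) (index_enum_uniq _).
apply: (@le_trans _ _ (\sum_e (X w (index_enum 'I_M) e ^+ 2 / a -
    4 / 27 * (X w (index_enum 'I_M) e ^+ 4 / a ^+ 3)))); last first.
  by apply: ler_sum => e _; exact: norm_ge.
rewrite big_split/= sumrN -!big_distrr/= -!big_distrl/= m2.
rewrite -a2 in m2 m4 *.
have h : (\sum_e X w (index_enum 'I_M) e ^+ 4) / a ^+ 3 <= nsigns * (3 * a).
  rewrite ler_pdivrMr ?exprn_gt0//; apply: (le_trans m4).
  by rewrite le_eqVlt; apply/orP; left; apply/eqP; ring.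
have -> : nsigns * a ^+ 2 / a = nsigns * a by field.
lra.
Qed.

End khintchine.

(** * From the l1 norm to the l2 norm *)

Section l2_bound.
Context (R : realType).
Local Notation T1 := (measurableTypeR R).
Local Notation gam := (std_normal R).

(** Sylvester's doubling, rescaled by [sqrt (1/2)] at each step so that the matrix stays orthogonal.
    Its entries have equal modulus, and this flatness is what spreads a vector evenly. *)
Lemma hadamard k : exists H : 'M[R]_(2 ^ k),
  H *m H^T = 1%:M /\ forall i j, H i j ^+ 2 = (2 ^ k)%:R^-1.
Proof.
elim: k => [|k [H [HH Hij]]].
  by exists 1%:M; rewrite trmx1 mulmx1; split => // i j; rewrite !ord1 !mxE eqxx expr1n invr1.
have e : (2 ^ k.+1 = 2 ^ k + 2 ^ k)%N by rewrite expnS mul2n addnn.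
rewrite e.
pose c : R := Num.sqrt 2^-1.
have cc : c ^+ 2 = 2^-1 by rewrite sqr_sqrtr.
exists (block_mx (c *: H) (c *: H) (c *: H) (- (c *: H))); split.
  rewrite tr_block_mx mulmx_block.
  have -> : (- (c *: H))^T = - (c *: H^T) by apply/matrixP => i j; rewrite !mxE.
  have -> : (c *: H)^T = c *: H^T by apply/matrixP => i j; rewrite !mxE.
  rewrite !mulmxN !mulNmx opprK -!scalemxAl -!scalemxAr HH scalerA -expr2 cc.
  rewrite subrr -scalerDl (_ : 2^-1 + 2^-1 = 1 :> R) ?scale1r; last by field.
  by rewrite scalar_mx_block.
have h : c ^+ 2 * (2 ^ k)%:R^-1 = (2 ^ k + 2 ^ k)%:R^-1 :> R.
  by rewrite cc -invfM addnn -mul2n natrM.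
move=> i j; rewrite -h.
have [a ->|a ->] := split_ordP i; have [b ->|b ->] := split_ordP j.
all: rewrite ?(block_mxEul, block_mxEur, block_mxEdl, block_mxEdr) !mxE ?sqrrN.
all: by rewrite exprMn Hij.
Qed.

Lemma integral_max_l2_le k n (hs : nat -> 'rV[R]_n) (t : R) (N : nat) (M := (2 ^ k)%N) :
  hs 0%N = 0 -> (forall l, enorm (hs l) <= t) ->
  (\int[gam (M * n)]_z (maxf (fun l => enorm (hs l *m (vec_mx (vec z))^T)) N)%:E <=
   (9 / 5 * Num.sqrt M%:R * (@abs_moment_bound R * t))%:E + (18 / 5)%:E *
   \int[gam n]_g (maxf (fun l => dotv (vec g) (hs l)) N)%:E)%E.
Proof.
move=> hs0 hst.
have M0 : (0 < M)%N by rewrite expn_gt0.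
have [H [HH Hij]] := hadamard k.
pose V (e : {ffun 'I_M -> bool}) := H *m diag_mx (\row_i sg R e i).
have VV e : V e *m (V e)^T = 1%:M.
  rewrite trmx_mul tr_diag_mx mulmxA -[H *m _ *m _]mulmxA.
  have -> : diag_mx (\row_i sg R e i) *m diag_mx (\row_i sg R e i) = 1%:M.
    rewrite mulmx_diag -diag_const_mx; congr diag_mx; apply/rowP => i.
    by rewrite !mxE -expr2 /sg sqrr_sign.
  by rewrite mulmx1 HH.
pose G (x : 'rV[R]_(M * n)) :=
  maxf (fun l => \sum_(j < M) `|dotv (row j (vec_mx x)) (hs l)|) N.
have mG : measurable_fun setT (G \o @vec R (M * n)).
  apply: measurable_maxf => l; apply: measurable_sum => j.
  apply: measurableT_comp => //; apply: mvec_dotv; last exact: mvec_cst.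
  by apply: mvec_row; exact: mvec_vec_id.
have G0 x : 0 <= G x by apply: maxf_ge0; rewrite sumr_ge0.
pose c : R := Num.sqrt M%:R.
have c0 : 0 < c by rewrite sqrtr_gt0 ltr0n.
have cc : c ^+ 2 = M%:R by rewrite sqr_sqrtr.
pose nn : R := #|{: {ffun 'I_M -> bool}}|%:R.
have nn0 : 0 < nn.
  by rewrite ltr0n; apply/card_gt0P; exists [ffun=> true].
(* Each of the [M] coordinates of the mixed vector is a Rademacher sum with weights of l2 norm
   [enorm v / c]. By Khintchine the mean l1 norm is at least [5/9 * M / c * enorm v], and
   [M / c = c]. *)
have l2l1 (v : 'rV[R]_M) : enorm v <= 9 / 5 / c / nn *
    \sum_e \sum_j `|(v *m (V e)^T) 0 j|.
  rewrite exchange_big/=.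
  have : \sum_(j < M) nn * (5 / 9 * (c^-1 * enorm v)) <=
      \sum_(j < M) \sum_e `|(v *m (V e)^T) 0 j|.
    apply: ler_sum => j _.
    have := khintchine (fun i => H j i * v 0 i).
    have -> : \sum_i (H j i * v 0 i) ^+ 2 = (c^-1 * enorm v) ^+ 2.
      rewrite exprMn sqr_enorm exprVn cc /dotv big_distrr/=.
      by apply: eq_bigr => i _; rewrite exprMn Hij -expr2.
    rewrite sqrtr_sqr ger0_norm; last by rewrite mulr_ge0 ?enorm_ge0// invr_ge0 ltW.
    move=> /le_trans; apply; rewrite le_eqVlt; apply/orP; left; apply/eqP.
    apply: eq_bigr => e _; congr (`|_|); rewrite [RHS]mxE; apply: eq_bigr => i _.
    rewrite /V mxE mul_mx_diag !mxE; ring.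
  have -> x : \sum_(j < M) x = x * c ^+ 2 :> R.
    by rewrite sumr_const card_ord cc mulr_natr.
  move=> h.
  rewrite -ler_pdivrMl ?mulr_gt0 ?invr_gt0//.
  apply: le_trans h; rewrite le_eqVlt; apply/orP; left; apply/eqP.
  by field; rewrite !gt_eqF.
have mixG e : (\int[gam (M * n)]_z (G (mxvec (V e *m vec_mx (vec z))))%:E =
    \int[gam (M * n)]_z (G (vec z))%:E)%E.
  by rewrite -(ge0_integral_std_normal_phi (adj_mix (n := n) (V e))
    (fun y => mixK y (VV e)) mG).
have mmixG e : measurable_fun setT
    (fun z : (M * n).-tuple T1 => G (mxvec (V e *m vec_mx (vec z)))).
  apply: mvec_comp mG _ => j.
  have mm : mvec (fun z : (M * n).-tuple T1 =>
      vec z *m lin1_mx (mxvec \o mulmx (V e) \o vec_mx)).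
    by apply: mvec_mulmx; exact: mvec_vec_id.
  by apply: eq_measurable_fun (mm j) => z _; rewrite mul_rV_lin1.
have menorm : measurable_fun setT (fun z : (M * n).-tuple T1 =>
    maxf (fun l => enorm (hs l *m (vec_mx (vec z))^T)) N).
  apply: measurable_maxf => l.
  apply: (@measurableT_comp _ _ _ _ _ _ (@Num.sqrt R)).
    exact: continuous_measurable_fun (@sqrt_continuous R).
  have mm : mvec (fun z : (M * n).-tuple T1 => hs l *m (vec_mx (vec z))^T).
    move=> j.
    have -> : (fun z : (M * n).-tuple T1 => (hs l *m (vec_mx (vec z))^T) 0 j) =
       (fun z => dotv (hs l) (row j (vec_mx (vec z)))).
      by apply/funext => z; rewrite mxE; apply: eq_bigr => i _; rewrite !mxE.
    apply: mvec_dotv; first exact: mvec_cst.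
    by apply: mvec_row; exact: mvec_vec_id.
  exact: mvec_dotv.
apply: (@le_trans _ _ (\int[gam (M * n)]_z (9 / 5 / c / nn *
    \sum_e G (mxvec (V e *m vec_mx (vec z))))%:E)%E).
  apply: ge0_le_integral_EFin => //.
  - by apply: measurable_funM => //; exact: measurable_sum.
  - by move=> z; apply: maxf_ge0; exact: enorm_ge0.
  - move=> z; apply: maxf_le => l lN; apply: (le_trans (l2l1 _)).
    apply: ler_wpM2l; first by rewrite !divr_ge0// ltW.
    apply: ler_sum => e _; rewrite /G mxvecK.
    apply: le_trans (le_maxf _ lN); rewrite le_eqVlt; apply/orP; left; apply/eqP.
    apply: eq_bigr => j _; congr (`|_|).
    rewrite -mulmxA -trmx_mul mxE; apply: eq_bigr => i _.
    by rewrite !mxE mulrC.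
rewrite ge0_integralZl_cst; first last.
- by rewrite !divr_ge0// ltW.
- by move=> z; rewrite sumr_ge0.
- exact: measurable_sum.
under eq_integral do rewrite -sumEFin.
rewrite ge0_integral_sum//; last 2 first.
- by move=> e; exact/measurable_EFinP.
- by move=> e z _; rewrite lee_fin.
rewrite (eq_bigr (fun=> 1%:E * \int[gam (M * n)]_z (G (vec z))%:E)%E); last first.
  by move=> e _; rewrite mul1e; exact: mixG.
rewrite -ge0_sume_distrl//.
rewrite sumEFin sumr_const muleA -EFinM.
have W0 : (0 <= \int[gam n]_g (maxf (fun l => dotv (vec g) (hs l)) N)%:E)%E.
  by apply: integral_EFin_ge0 => g; apply: maxf_ge0; rewrite hs0 dotv0r.
have t0 : 0 <= t by rewrite (le_trans (enorm_ge0 (hs 0%N))).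
have k0 : 0 <= @abs_moment_bound R * t by rewrite !mulr_ge0// expR_ge0.
have -> : 9 / 5 / c / nn * #|{: {ffun 'I_M -> bool}}|%:R = 9 / 5 / c.
  by rewrite -/nn divfK// gt_eqF.
have c'0 : 0 <= 9 / 5 / c by rewrite divr_ge0// ltW.
apply: (le_trans (lee_wpmul2l _ (integral_max_l1_le N hs0 hst M0))).
  by rewrite lee_fin.
rewrite ge0_muleDr; last 2 first.
- by rewrite lee_fin mulr_ge0.
- by rewrite mule_ge0// lee_fin mulr_ge0// ltW.
rewrite muleA -!EFinM -/c le_eqVlt; apply/orP; left; apply/eqP.
congr (_%:E + _%:E * _)%E.
- by rewrite -cc; field; rewrite gt_eqF.
- by field; rewrite gt_eqF.
Qed.

End l2_bound.

(** * Arbitrary numbers of rows *)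

Section general_row_number.
Context (R : realType).
Local Notation T1 := (measurableTypeR R).
Local Notation gam := (std_normal R).

Lemma measurable_enorm_rows m n (h : 'rV[R]_n) d (T : measurableType d)
    (f : T -> 'rV[R]_(m * n)) : mvec f ->
  measurable_fun setT (fun x => enorm (h *m (vec_mx (f x))^T)).
Proof.
move=> mf.
apply: (@measurableT_comp _ _ _ _ _ _ (@Num.sqrt R)).
  exact: continuous_measurable_fun (@sqrt_continuous R).
have mm : mvec (fun x => h *m (vec_mx (f x))^T).
  move=> j.
  have -> : (fun x => (h *m (vec_mx (f x))^T) 0 j) = (fun x => dotv h (row j (vec_mx (f x)))).
    by apply/funext => z; rewrite mxE; apply: eq_bigr => i _; rewrite !mxE.
  by apply: mvec_dotv; [exact: mvec_cst|exact: mvec_row].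
exact: mvec_dotv.
Qed.

Section selection.
Context (m M : nat) (s : 'I_M -> 'I_m) (s_inj : injective s).

Definition sel_mx : 'M[R]_(M, m) := \matrix_(i, j) (j == s i)%:R.

Lemma mul_sel_mx (v : 'rV[R]_m) i : (v *m sel_mx^T) 0 i = v 0 (s i).
Proof.
rewrite mxE (bigD1 (s i))//= !mxE eqxx mulr1 big1 ?addr0// => j ji.
by rewrite !mxE (negbTE ji) mulr0.
Qed.

Lemma sel_mx_unitary : sel_mx *m sel_mx^T = 1%:M.
Proof.
apply/row_matrixP => i; apply/rowP => j; rewrite row_mul mul_sel_mx !mxE.
by rewrite (inj_eq s_inj) eq_sym.
Qed.

Lemma sqr_enorm_sel (v : 'rV[R]_m) :
  enorm (v *m sel_mx^T) ^+ 2 = \sum_(j in [set s i | i : 'I_M]%SET) v 0 j ^+ 2.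
Proof.
rewrite sqr_enorm big_imset/=; last by move=> i j _ _; exact: s_inj.
by apply: eq_bigr => i _; rewrite mul_sel_mx expr2.
Qed.

End selection.

Lemma enorm_le_two_blocks m M (s1 s2 : 'I_M -> 'I_m) (v : 'rV[R]_m) :
  injective s1 -> injective s2 ->
  (forall j, j \in [set s1 i | i : 'I_M]%SET \/ j \in [set s2 i | i : 'I_M]%SET) ->
  enorm v <= enorm (v *m (sel_mx s1)^T) + enorm (v *m (sel_mx s2)^T).
Proof.
move=> s1i s2i cov.
set A := enorm _; set B := enorm (_ *m (sel_mx s1)^T); set C := enorm (_ *m (sel_mx s2)^T).
have [A0 B0 C0] : [/\ 0 <= A, 0 <= B & 0 <= C] by split; exact: enorm_ge0.
have : A ^+ 2 <= B ^+ 2 + C ^+ 2.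
  rewrite /B /C !sqr_enorm_sel// sqr_enorm /dotv.
  rewrite [X in _ <= X + _]big_mkcond [X in _ <= _ + X]big_mkcond -big_split/=.
  apply: ler_sum => j _; rewrite -expr2; have h := sqr_ge0 (v 0 j).
  by have [jI|jI] := cov j; rewrite jI; case: ifP => _; rewrite ?addr0 ?add0r// lerDl.
by nra.
Qed.

Lemma integral_max_rows_le m n (hs : nat -> 'rV[R]_n) (t : R) (N : nat) : (0 < m)%N ->
  hs 0%N = 0 -> (forall l, enorm (hs l) <= t) ->
  (\int[gam (m * n)]_z (maxf (fun l => enorm (hs l *m (vec_mx (vec z))^T)) N)%:E <=
   (18 / 5 * Num.sqrt m%:R * (@abs_moment_bound R * t))%:E + (36 / 5)%:E *
   \int[gam n]_g (maxf (fun l => dotv (vec g) (hs l)) N)%:E)%E.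
Proof.
move=> m0 hs0 hst.
(* The largest power of two below or equal to [m] satisfies [M <= m <= 2 M], so the first [M] and
   the last [M] rows cover all rows. Two blocks double the constants. *)
pose k := trunc_log 2 m; pose M := (2 ^ k)%N.
have [Mm mM] : (M <= m)%N /\ (m <= M + M)%N.
  have /andP[h1 h2] := trunc_log_bounds (isT : (1 < 2)%N) m0.
  by split => //; rewrite addnn -mul2n -expnS ltnW.
have s2P (i : 'I_M) : (i + (m - M) < m)%N by rewrite -[ltnRHS](subnKC Mm) ltn_add2r.
pose s1 := widen_ord Mm; pose s2 i := Ordinal (s2P i).
have s1i : injective s1 by move=> i j /(congr1 val) /= h; exact/val_inj.
have s2i : injective s2.
  by move=> i j /(congr1 val) /= /eqP; rewrite eqn_add2r => /eqP h; exact/val_inj.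
have cov j : j \in [set s1 i | i : 'I_M]%SET \/ j \in [set s2 i | i : 'I_M]%SET.
  have [jM|Mj] := ltnP j M.
    by left; apply/imsetP; exists (Ordinal jM) => //; exact/val_inj.
  right; have jM : (j - (m - M) < M)%N.
    rewrite ltn_subLR; last by rewrite leq_subLR (leq_trans mM)// leq_add2l.
    by rewrite subnK.
  apply/imsetP; exists (Ordinal jM) => //; apply/val_inj => /=.
  by rewrite subnK// leq_subLR (leq_trans mM)// leq_add2l.
pose G (x : 'rV[R]_(M * n)) := maxf (fun l => enorm (hs l *m (vec_mx x)^T)) N.
have mG : measurable_fun setT (G \o @vec R (M * n)).
  by apply: measurable_maxf => l; apply: measurable_enorm_rows; exact: mvec_vec_id.
have G0 x : 0 <= G x by apply: maxf_ge0; exact: enorm_ge0.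
have mGs (s : 'I_M -> 'I_m) : measurable_fun setT
    (fun z : (m * n).-tuple T1 => G (mxvec (sel_mx s *m vec_mx (vec z)))).
  apply: mvec_comp mG _ => j.
  have mm : mvec (fun z : (m * n).-tuple T1 =>
      vec z *m lin1_mx (mxvec \o mulmx (sel_mx s) \o vec_mx)).
    by apply: mvec_mulmx; exact: mvec_vec_id.
  by apply: eq_measurable_fun (mm j) => z _; rewrite mul_rV_lin1.
have IG (s : 'I_M -> 'I_m) : injective s ->
    (\int[gam (m * n)]_z (G (mxvec (sel_mx s *m vec_mx (vec z))))%:E =
     \int[gam (M * n)]_z (G (vec z))%:E)%E.
  move=> si; by rewrite -(ge0_integral_std_normal_phi (adj_mix (n := n) (sel_mx s))
    (fun y => mixK y (sel_mx_unitary si)) mG).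
apply: (@le_trans _ _ (\int[gam (m * n)]_z (G (mxvec (sel_mx s1 *m vec_mx (vec z))) +
    G (mxvec (sel_mx s2 *m vec_mx (vec z))))%:E)%E).
  apply: ge0_le_integral_EFin => //.
  - by apply: measurable_maxf => l; apply: measurable_enorm_rows; exact: mvec_vec_id.
  - exact: measurable_funD.
  - by move=> z; apply: maxf_ge0; exact: enorm_ge0.
  - move=> z; apply: maxf_le => l lN.
    apply: (le_trans (enorm_le_two_blocks _ s1i s2i cov)).
    rewrite /G !mxvecK.
    have h := fun s : 'I_M -> 'I_m =>
      le_maxf (fun l => enorm (hs l *m (sel_mx s *m vec_mx (vec z))^T)) lN.
    have := lerD (h s1) (h s2); by rewrite /= !trmx_mul !mulmxA.
rewrite ge0_integralD_EFin// !IG//.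
have h := integral_max_l2_le k N hs0 hst.
apply: (le_trans (leeD h h)).
set W := (\int[gam n]_g _)%E.
have W0 : (0 <= W)%E.
  by apply: integral_EFin_ge0 => g; apply: maxf_ge0; rewrite hs0 dotv0r.
have t0 : 0 <= t by rewrite (le_trans (enorm_ge0 (hs 0%N))).
have k0 : 0 <= @abs_moment_bound R * t by rewrite !mulr_ge0// expR_ge0.
rewrite addeACA -EFinD -ge0_muleDl ?lee_fin// -EFinD.
apply: leeD; last by rewrite (_ : 18 / 5 + 18 / 5 = 36 / 5)//; field.
rewrite lee_fin -mulrDl ler_wpM2r// -mulrDl.
rewrite (_ : 9 / 5 + 9 / 5 = 18 / 5 :> R); last by field.
by rewrite ler_wpM2l// ler_wsqrtr// ler_nat.
Qed.

End general_row_number.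

(** * Laws of the observations *)

Section pi_systems.
Context d (T : measurableType d).

(** A pi-system that generates the product sigma-algebra; laws and independence of tuples are
    checked on it. *)
Definition boxes k : set (set (k.-tuple T)) :=
  [set [set g | forall i, B i (tnth g i)] | B in
    [set B : 'I_k -> set T | forall i, measurable (B i)]].

Lemma measurable_box k (B : 'I_k -> set T) : (forall i, measurable (B i)) ->
  measurable [set g : k.-tuple T | forall i, B i (tnth g i)].
Proof.
move=> mB.
rewrite (_ : mkset _ = \bigcap_(i in [set: 'I_k]) ((@tnth _ _)^~ i @^-1` B i)); last first.
  by apply/seteqP; split => g /= H i; [move=> _; exact: H|exact: (H i I)].
apply: fin_bigcap_measurable => // i _.
by rewrite -[X in measurable X]setTI; exact: measurable_tnth.
Qed.

Lemma measurable_boxes k : @measurable _ (k.-tuple T) = <<s @boxes k >>.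
Proof.
apply/seteqP; split; last first.
  apply: smallest_sub; first exact: sigma_algebra_measurable.
  by move=> _ [B mB <-]; exact: measurable_box.
apply: smallest_sub; first exact: smallest_sigma_algebra.
rewrite -bigcup_seq/= => _ [i _ [B mB <-]].
apply: sub_sigma_algebra; exists (fun j => if j == i then B else setT).
  by move=> j; case: ifP.
apply/seteqP; split => g /=; first by move=> /(_ i); rewrite eqxx.
by move=> [_ gB] j; case: eqVneq => // ->.
Qed.

Lemma setI_closed_boxes k : setI_closed (@boxes k).
Proof.
move=> _ _ [A mA <-] [B mB <-]; exists (fun i => A i `&` B i).
  by move=> i; exact: measurableI.
by apply/seteqP; split => g /=; [move=> H; split => i; have [] := H i|move=> [HA HB] i; split].
Qed.

Lemma boxesT k : @boxes k setT.
Proof. by exists (fun=> setT) => //; apply/seteqP; split. Qed.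

End pi_systems.

Section rectangles.
Context d1 d2 (T1 : measurableType d1) (T2 : measurableType d2).

Definition rects : set (set (T1 * T2)) :=
  [set A `*` B | A in measurable & B in measurable].

Lemma measurable_rects : @measurable _ (T1 * T2)%type = <<s rects >>.
Proof. exact: measurable_prod_measurableType. Qed.

Lemma setI_closed_rects : setI_closed rects.
Proof.
move=> _ _ [A mA [B mB <-]] [C mC [D mD <-]].
exists (A `&` C); first exact: measurableI.
by exists (B `&` D); [exact: measurableI|rewrite setXI].
Qed.

Lemma rectsT : rects setT.
Proof. by exists setT => //; exists setT => //; rewrite setXTT. Qed.

End rectangles.

Section independence.
Context (R : realType) d (Om : measurableType d) (P : probability Om R).

Lemma measurable_preimage d1 (T1 : measurableType d1) (Z : {mfun Om >-> T1}) A :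
  measurable A -> measurable (Z @^-1` A).
Proof. by move=> mA; rewrite -[X in measurable X]setTI; exact: measurable_funP. Qed.

(** For fixed [E] both sides are finite measures in [A]: the image of [P] restricted to [E], and
    [mu1] scaled by the probability of [E]. They agree on a generating pi-system, hence
    everywhere. *)
Lemma indep_step d1 (T1 : measurableType d1) (Z : {mfun Om >-> T1})
    (mu1 : probability T1 R) (G : set (set T1)) (E : set Om) :
  @measurable _ T1 = <<s G >> -> setI_closed G -> G setT -> measurable E ->
  (forall A, G A -> P (Z @^-1` A `&` E) = mu1 A * P E)%E ->
  forall A, measurable A -> (P (Z @^-1` A `&` E) = mu1 A * P E)%E.
Proof.
move=> mG GI GT mE GE A mA.
have PE0 : 0 <= fine (P E) by rewrite fine_ge0.
have PEf : P E \is a fin_num by exact: fin_num_measure.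
pose m2 := mscale (NngNum PE0) mu1.
pose m1 := pushforward (mrestr P mE) Z.
have m12 : forall A, measurable A -> m1 A = m2 A.
  apply: (measure_unique G (fun=> setT)) => //.
  - by rewrite bigcup_const//; exists 0%N.
  - move=> B GB; rewrite /= /m1 /m2 /pushforward /mrestr /mscale/= fineK// muleC.
    exact: GE.
  - move=> _; rewrite /= /m1 /pushforward /mrestr preimage_setT setTI.
    by rewrite -ge0_fin_numE.
have := m12 A mA; rewrite /m1 /m2 /pushforward /mrestr /mscale/= fineK//.
by rewrite muleC.
Qed.

Lemma ge0_integral_indep d1 d2 (T1 : measurableType d1) (T2 : measurableType d2)
    (Z : {mfun Om >-> T1}) (X : {mfun Om >-> T2})
    (mu1 : probability T1 R) (mu2 : probability T2 R) (F : T1 * T2 -> \bar R) :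
  (forall A B, measurable A -> measurable B ->
    P (Z @^-1` A `&` X @^-1` B) = mu1 A * mu2 B)%E ->
  measurable_fun setT F -> (forall x, 0 <= F x)%E ->
  (\int[P]_w F (Z w, X w) = \int[mu1 \x mu2]_x F x)%E.
Proof.
move=> ind mF F0.
have mZX : measurable_fun setT (fun w => (Z w, X w)).
  by apply: measurable_fun_pair; exact: measurable_funP.
pose ZX : {mfun Om >-> (T1 * T2)%type} := mfun_Sub (mem_set mZX).
transitivity (\int[distribution P ZX]_x F x)%E.
  by rewrite ge0_integral_distribution.
apply: eq_measure_integral => A mA _; apply/esym.
by apply: product_measure_unique => // B C mB mC; rewrite -ind.
Qed.

Lemma law_of_pair d1 d2 (T1 : measurableType d1) (T2 : measurableType d2)
    (ZX : {mfun Om >-> (T1 * T2)%type})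
    (mu1 : probability T1 R) (mu2 : probability T2 R) :
  (forall A B, measurable A -> measurable B ->
    P (ZX @^-1` (A `*` B)) = mu1 A * mu2 B)%E ->
  forall E, measurable E -> P (ZX @^-1` E) = (mu1 \x mu2)%E E.
Proof.
move=> ind E mE.
by apply/esym; apply: (product_measure_unique (m' := distribution P ZX)).
Qed.

End independence.

Section model.
Context (R : realType) d (Om : measurableType d) (P : probability Om R).
Context dX (Xi : measurableType dX) (nu : probability Xi R) (n m : nat).
Local Notation T1 := (measurableTypeR R).
Local Notation gam := (std_normal R).
Variables (a : 'I_m -> {RV P >-> n.-tuple T1}) (xi : 'I_m -> {RV P >-> Xi}).
Hypothesis law_a : forall i, has_law (a i) (gam n).
Hypothesis law_xi : forall i, has_law (xi i) nu.
Hypothesis indep : mutually_independent P (fun k : 'I_m + 'I_m =>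
    match k with
    | inl i => g_sigma_algebra_preimage (a i)
    | inr i => g_sigma_algebra_preimage (xi i)
    end).

Lemma indep_events (J : {set 'I_m}) (A : 'I_m -> set (n.-tuple T1)) (B : 'I_m -> set Xi) :
  (forall i, measurable (A i)) -> (forall i, measurable (B i)) ->
  (P [set w | forall i, i \in J -> A i (a i w) /\ B i (xi i w)] =
   (\prod_(i in J) gam n (A i)) * (\prod_(i in J) nu (B i)))%E.
Proof.
move=> mA mB.
pose JJ : {set 'I_m + 'I_m} := [set k | match k with inl i => i \in J | inr i => i \in J end]%SET.
pose E (k : 'I_m + 'I_m) : set Om :=
  match k with inl i => a i @^-1` A i | inr i => xi i @^-1` B i end.
have := indep (J := JJ) (E := E).
have -> : \bigcap_(k in [set` JJ]) E k =
    [set w | forall i, i \in J -> A i (a i w) /\ B i (xi i w)].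
  apply/seteqP; split => w /= H.
    by move=> i iJ; split; [apply: (H (inl i))|apply: (H (inr i))]; rewrite /= inE.
  by move=> [i|i] /=; rewrite inE => /H[].
move=> ->; last first.
  by move=> [i|i] _; [exists (A i)|exists (B i)]; rewrite ?setTI//.
rewrite (eq_bigl (fun k => match k with inl i => i \in J | inr i => i \in J end)); last first.
  by move=> k; rewrite inE.
rewrite big_sumType/=; congr (_ * _)%E; apply: eq_bigr => i _.
  exact: law_a.
exact: law_xi.
Qed.

Definition all_rows (w : Om) : (m * n).-tuple T1 :=
  unvec (mxvec (\matrix_(i < m, j < n) (tnth (a i w) j : R))).

Definition all_seeds (w : Om) : m.-tuple Xi := [tuple xi i w | i < m].

Lemma measurable_all_rows : measurable_fun setT all_rows.
Proof.
apply: mvec_unvec => k; case/mxvec_indexP: k => i j.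
apply: eq_measurable_fun (_ : measurable_fun setT (fun w => tnth (a i w) j)) => [w _|].
  by rewrite mxvecE mxE.
by apply: (measurableT_comp (measurable_tnth j)); exact: measurable_funP.
Qed.

Lemma measurable_all_seeds : measurable_fun setT all_seeds.
Proof.
apply/measurable_fun_tnthP => i.
apply: eq_measurable_fun (_ : measurable_fun setT (xi i)) => [w _|].
  by rewrite /= tnth_mktuple.
exact: measurable_funP.
Qed.

HB.instance Definition _ := isMeasurableFun.Build _ _ _ _ _ measurable_all_rows.
HB.instance Definition _ := isMeasurableFun.Build _ _ _ _ _ measurable_all_seeds.

Lemma row_all_rows w i : row i (vec_mx (vec (all_rows w))) = vec (a i w) :> 'rV[R]_n.
Proof. by rewrite unvecK mxvecK; apply/rowP => j; rewrite !mxE. Qed.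

Lemma tnth_all_seeds w i : tnth (all_seeds w) i = xi i w.
Proof. by rewrite tnth_mktuple. Qed.

(** On boxes this is the mutual independence of all rows and seeds together with the product form of
    the Gaussian measure. The event on the rows is then made arbitrary, and after it the event on
    the seeds. *)
Lemma indep_rows_seeds (A : set ((m * n).-tuple T1)) (B : set (m.-tuple Xi)) :
  measurable A -> measurable B ->
  (P (all_rows @^-1` A `&` all_seeds @^-1` B) =
   gam (m * n) A * distribution P all_seeds B)%E.
Proof.
have box A' B' : (forall k, measurable (A' k)) -> (forall i, measurable (B' i)) ->
  (P (all_rows @^-1` [set g | forall k, A' k (tnth g k)] `&`
      all_seeds @^-1` [set g | forall i, B' i (tnth g i)]) =
   gam (m * n) [set g | forall k, A' k (tnth g k)] * \prod_(i < m) nu (B' i))%E.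
  move=> mA' mB'.
  pose A2 i : set (n.-tuple T1) := [set g | forall j, A' (mxvec_index i j) (tnth g j)].
  have mA2 i : measurable (A2 i) by exact: (@measurable_box _ _ n (fun j => A' (mxvec_index i j))).
  have := @indep_events [set: 'I_m]%SET A2 B' mA2 mB'.
  rewrite (_ : mkset _ = all_rows @^-1` [set g | forall k, A' k (tnth g k)] `&`
      all_seeds @^-1` [set g | forall i, B' i (tnth g i)]); last first.
    apply/seteqP; split => w /=.
      move=> H; split.
        move=> k; case/mxvec_indexP: k => i j.
        have [/(_ j) h _] := H i (finset.in_setT _); move: h.
        by rewrite tnth_mktuple mxvecE mxE.
      by move=> i; rewrite tnth_all_seeds; have [_] := H i (finset.in_setT _).
    move=> [H1 H2] i _; split; last by have := H2 i; rewrite tnth_all_seeds.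
    by move=> j; have := H1 (mxvec_index i j); rewrite tnth_mktuple mxvecE mxE.
  move=> ->; congr (_ * _)%E; last by apply: eq_bigl => i; rewrite finset.in_setT.
  have prodE (F : 'I_(m * n) -> \bar R) :
      (\prod_(k < m * n) F k = \prod_(i < m) \prod_(j < n) F (mxvec_index i j))%E.
    by rewrite pair_bigA (reindex _ (curry_mxvec_bij m n)); apply: eq_bigr => -[i j].
  rewrite std_normal_box// prodE.
  apply: eq_big => [i|i _]; first by rewrite finset.in_setT.
  by apply: (@std_normal_box R n (fun j => A' (mxvec_index i j))) => j; exact: mA'.
have seeds B' : (forall i, measurable (B' i)) ->
    (P (all_seeds @^-1` [set g | forall i, B' i (tnth g i)]) = \prod_(i < m) nu (B' i))%E.
  move=> mB'; have := box (fun=> setT) B' (fun=> measurableT) mB'.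
  rewrite (_ : mkset _ = setT); last by apply/seteqP; split.
  by rewrite preimage_setT setTI probability_setT mul1e.
have mboxs B' : (forall i, measurable (B' i)) ->
    measurable (all_seeds @^-1` [set g | forall i, B' i (tnth g i)]).
  by move=> mB'; apply: measurable_preimage; exact: measurable_box.
have step1 A' B' : measurable A' -> (forall i, measurable (B' i)) ->
  (P (all_rows @^-1` A' `&` all_seeds @^-1` [set g | forall i, B' i (tnth g i)]) =
   gam (m * n) A' * P (all_seeds @^-1` [set g | forall i, B' i (tnth g i)]))%E.
  move=> mA' mB'.
  apply: (indep_step (@measurable_boxes _ _ _) (@setI_closed_boxes _ _ _) (@boxesT _ _ _)) => //.
    exact: mboxs.
  by move=> _ [C mC <-]; rewrite box// seeds.
move=> mA mB; rewrite setIC [RHS]muleC.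
have -> : gam (m * n) A = P (all_rows @^-1` A).
  have := step1 A (fun=> setT) mA (fun=> measurableT).
  rewrite (_ : mkset _ = setT); last by apply/seteqP; split.
  by rewrite preimage_setT setIT probability_setT mule1.
apply: (indep_step (mu1 := distribution P all_seeds) (@measurable_boxes _ _ _)
  (@setI_closed_boxes _ _ _) (@boxesT _ _ _)) => //.
  exact: measurable_preimage.
move=> _ [C mC <-]; rewrite setIC step1// muleC.
congr (_ * _)%E.
have := step1 A (fun=> setT) mA (fun=> measurableT).
rewrite (_ : mkset _ = setT); last by apply/seteqP; split.
by rewrite preimage_setT setIT probability_setT mule1.
Qed.

End model.

(** * Moments and tail bounds *)

Section moments.
Context (R : realType) d (Om : measurableType d) (P : probability Om R).

(** Jensen's inequality by tangents: [sqrt x <= x / (2 b) + b / 2] for each [b > 0], with the best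
    choice [b = sqrt c]. *)
Lemma integral_sqrt_le (f : Om -> R) (c : R) : 0 <= c ->
  measurable_fun setT f -> (forall x, 0 <= f x) ->
  (\int[P]_x (f x)%:E <= c%:E)%E ->
  (\int[P]_x (Num.sqrt (f x))%:E <= (Num.sqrt c)%:E)%E.
Proof.
move=> c0 mf f0 fc.
have msf : measurable_fun setT (fun x => Num.sqrt (f x)).
  apply: measurableT_comp mf.
  exact: continuous_measurable_fun (@sqrt_continuous R).
have key b : 0 < b ->
    (\int[P]_x (Num.sqrt (f x))%:E <= (c / (2 * b) + b / 2)%:E)%E.
  move=> b0; apply: (@le_trans _ _ (\int[P]_x ((2 * b)^-1 * f x + b / 2)%:E)%E).
    apply: ge0_le_integral_EFin => //.
      by apply: measurable_funD => //; exact: measurable_funM.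
    move=> x; have s2 : Num.sqrt (f x) ^+ 2 = f x by rewrite sqr_sqrtr.
    have := sqr_ge0 (Num.sqrt (f x) - b); rewrite sqrrB s2 => h.
    rewrite -subr_ge0.
    have -> : (2 * b)^-1 * f x + b / 2 - Num.sqrt (f x) =
      (f x - Num.sqrt (f x) * b *+ 2 + b ^+ 2) / (2 * b) by field; rewrite gt_eqF.
    by rewrite divr_ge0// mulr_ge0// ltW.
  rewrite ge0_integralD_EFin//; last 3 first.
  - exact: measurable_funM.
  - by move=> x; rewrite mulr_ge0// invr_ge0 mulr_ge0// ltW.
  - by move=> x; rewrite divr_ge0// ltW.
  rewrite integral_cst_prob EFinD leeD2r// ge0_integralZl_cst//; last first.
    by rewrite invr_ge0 mulr_ge0// ltW.
  by rewrite [c / _]mulrC EFinM lee_wpmul2l// lee_fin invr_ge0 mulr_ge0// ltW.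
(* For [c = 0] the optimal tangent degenerates, and [b] tends to [0] instead. *)
have [cz|cn0] := eqVneq c 0.
  rewrite cz sqrtr0; apply/lee_addgt0Pr => e e0; rewrite add0e.
  apply: (le_trans (key e e0)); rewrite lee_fin cz mul0r add0r.
  by lra.
have cgt0 : 0 < c by rewrite lt_def cn0.
have sgt0 : 0 < Num.sqrt c by rewrite sqrtr_gt0.
apply: (le_trans (key _ sgt0)); rewrite lee_fin -{1}(sqr_sqrtr c0).
by rewrite le_eqVlt; apply/orP; left; apply/eqP; field; rewrite gt_eqF.
Qed.

Lemma markov_le (f : Om -> R) (c del : R) : 0 <= c -> 0 < del ->
  measurable_fun setT f -> (forall x, 0 <= f x) ->
  (\int[P]_x (f x)%:E <= c%:E)%E ->
  (P [set x | (c / del < f x)%R] <= del%:E)%E.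
Proof.
move=> c0 d0 mf f0 fc.
have mA r : measurable [set x | r < f x].
  rewrite (_ : mkset _ = f @^-1` `]r, +oo[%classic); last first.
    by apply/seteqP; split => x /=; rewrite in_itv/= andbT.
  by rewrite -[X in measurable X]setTI; exact: mf.
have key r : 0 < r -> (r%:E * P [set x | (r < f x)%R] <= c%:E)%E.
  move=> r0; apply: le_trans fc.
  rewrite -[in leLHS](setIT [set x | r < f x]) -integral_indic// -ge0_integralZl_cst//; last exact: ltW.
  apply: ge0_le_integral_EFin => //.
  - exact: measurable_funM.
  - by move=> x; rewrite mulr_ge0// ltW.
  - move=> x; rewrite indicE; have [|_] := boolP (x \in _); last by rewrite mulr0.
    by rewrite inE/= mulr1 => /ltW.
(* The threshold is now [0], and the event is a countable union of null events. This case serves for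
   the null event of vanishing projections and when a mean bound is zero. *)
have [cz|cn0] := eqVneq c 0.
  rewrite cz mul0r.
  have -> : [set x | 0 < f x] = \bigcup_k [set x | k.+1%:R^-1 < f x].
    apply/seteqP; split => x /=.
      move=> fx; have [k hk] := ltr_add_invr fx; exists k => //=.
      by rewrite add0r in hk.
    by move=> [k _] /=; apply: lt_trans; rewrite invr_gt0.
  apply: (@le_trans _ _ 0%E); last by rewrite lee_fin ltW.
  have zk k : P [set x | k.+1%:R^-1 < f x] = 0%E.
    have := key k.+1%:R^-1; rewrite invr_gt0 ltr0n => /(_ isT).
    rewrite cz => h; apply/eqP; rewrite eq_le measure_ge0 andbT.
    by move: h; rewrite pmule_rle0// lte_fin invr_gt0.
  suff : P (\bigcup_k [set x | k.+1%:R^-1 < f x]) = 0%E by move=> ->; rewrite lexx.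
  apply: measure_negligible; first exact: bigcupT_measurable.
  apply: negligible_bigcup => k; apply/negligibleP; [exact: mA|exact: zk].
have cgt0 : 0 < c by rewrite lt_def cn0.
have r0 : 0 < c / del by rewrite divr_gt0.
have := key _ r0; rewrite -lee_pdivlMl// => /le_trans; apply.
rewrite -EFinM lee_fin le_eqVlt; apply/orP; left; apply/eqP; field.
by rewrite !gt_eqF.
Qed.

(** The bad events increase with [N], so continuity from below turns Markov's inequality for finite
    maxima into one for the whole sequence. *)
Lemma markov_seq_le (f : nat -> Om -> R) (c del : R) : 0 <= c -> 0 < del ->
  (forall N, measurable_fun setT (f N)) -> (forall N x, 0 <= f N x) ->
  (forall N M x, (N <= M)%N -> f N x <= f M x) ->
  (forall N, \int[P]_x (f N x)%:E <= c%:E)%E ->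
  measurable (\bigcup_N [set x | c / del < f N x]) /\
  (P (\bigcup_N [set x | (c / del < f N x)%R]) <= del%:E)%E.
Proof.
move=> c0 d0 mf f0 ndf fc.
have mA N : measurable [set x | c / del < f N x].
  rewrite (_ : mkset _ = f N @^-1` `](c / del), +oo[%classic); last first.
    by apply/seteqP; split => x /=; rewrite in_itv/= andbT.
  by rewrite -[X in measurable X]setTI; exact: mf.
have mU := bigcupT_measurable _ mA.
split => //.
have nd : nondecreasing_seq (fun N => [set x | c / del < f N x]).
  by move=> N M NM; apply/subsetPset => x /= /lt_le_trans; apply; exact: ndf.
have cv := @nondecreasing_cvg_mu _ _ _ P _ mA mU nd.
rewrite -(cvg_lim _ cv)//; apply: lime_le; first by apply/cvg_ex; eexists; exact: cv.
by apply: nearW => N /=; exact: markov_le.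
Qed.

Lemma second_moment_sum_le m (V : 'I_m -> Om -> R) (c : R) :
  (forall i, measurable_fun setT (V i)) ->
  (forall i, \int[P]_x (V i x ^+ 2)%:E <= c%:E)%E ->
  (forall i j, i != j -> \int[P]_x (V i x * V j x)%:E = 0)%E ->
  (\int[P]_x ((\sum_i V i x) ^+ 2)%:E <= (m%:R * c)%:E)%E.
Proof.
move=> mV V2 Vij.
have mV2 i : measurable_fun setT (fun x => V i x ^+ 2) by exact: measurable_funX.
have iVV i j : P.-integrable setT (fun x => (V i x * V j x)%:E).
  apply/integrableP; split; first by apply/measurable_EFinP; exact: measurable_funM.
  apply: (@le_lt_trans _ _ (\int[P]_x (V i x ^+ 2 + V j x ^+ 2)%:E)%E).
    under eq_integral do rewrite abse_EFin.
    apply: ge0_le_integral_EFin => //.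
    - by apply: measurableT_comp => //; exact: measurable_funM.
    - exact: measurable_funD.
    - by move=> x; rewrite -[V i x ^+ 2]real_normK ?num_real// -[V j x ^+ 2]real_normK ?num_real// normrM; nra.
  rewrite ge0_integralD_EFin//; last 2 first.
  - by move=> x; exact: sqr_ge0.
  - by move=> x; exact: sqr_ge0.
  by apply: lte_add_pinfty; exact: le_lt_trans (V2 _) (ltry _).
have -> : (\int[P]_x ((\sum_i V i x) ^+ 2)%:E = \sum_i \sum_j \int[P]_x (V i x * V j x)%:E)%E.
  under [LHS]eq_integral => x _.
    rewrite expr2 big_distrlr/= -sumEFin.
    under eq_bigr do rewrite -sumEFin.
    over.
  rewrite integral_sum//; last by move=> i; apply: integrable_sum.
  by apply: eq_bigr => i _; rewrite integral_sum.
apply: (@le_trans _ _ (\sum_(i < m) c%:E)%E); last first.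
  by rewrite sumEFin sumr_const card_ord mulr_natl.
apply: lee_sum => i _.
rewrite (bigD1 i)//= big1 ?adde0; last by move=> j ji; rewrite Vij// eq_sym.
by under eq_integral do rewrite -expr2.
Qed.

End moments.

Section gaussian_marginals.
Context (R : realType).
Local Notation T1 := (measurableTypeR R).
Local Notation gam := (std_normal R).
Local Notation g1 := (normal_prob (0 : R) 1).

Lemma std_normal1_integral (f : R -> R) :
  measurable_fun setT f -> (forall x, 0 <= f x) ->
  (\int[gam 1]_s (f (vec s 0 0))%:E = \int[g1]_s (f s)%:E)%E.
Proof.
move=> mf f0.
have m0 : measurable_fun setT (fun s : 1.-tuple T1 => vec s 0 0).
  exact: (@mvec_vec_id R 1 (0 : 'I_1)).
rewrite (@std_normalS_integral R 0 (fun x => f (x 0 0)))//; last exact: (measurableT_comp mf m0).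
apply: eq_integral => s _; rewrite -[RHS](integral_cst_prob (gam 0)).
apply: eq_integral => g _; congr (f _)%:E.
transitivity ((\row_(j < 1) s) 0 0); last by rewrite mxE.
have e : lshift 0 (0 : 'I_1) = (0 : 'I_(1 + 0)) by exact/val_inj.
by rewrite -[RHS](row_mxEl _ (vec g)) e.
Qed.

Lemma integral_dotv n (x0 : 'rV[R]_n) (f : R -> R) : dotv x0 x0 = 1 ->
  measurable_fun setT f -> (forall x, 0 <= f x) ->
  (\int[gam n]_g (f (dotv (vec g) x0))%:E = \int[g1]_s (f s)%:E)%E.
Proof.
move=> x01 mf f0; rewrite -std_normal1_integral//.
rewrite -(ge0_integral_std_normal_coisometry (W := x0^T) (f := fun x => f (x 0 0)))//.
- by apply: eq_integral => g _; rewrite dotvE.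
- by rewrite trmxK [_ *m _]mx11_scalar -dotvE x01.
- exact: (measurableT_comp mf (@mvec_vec_id R 1 (0 : 'I_1))).
Qed.

Lemma law_dotv n (x0 : 'rV[R]_n) (A : set T1) : dotv x0 x0 = 1 -> measurable A ->
  gam n [set g | A (dotv (vec g) x0)] = g1 A.
Proof.
move=> x01 mA.
have mB : measurable [set g : n.-tuple T1 | A (dotv (vec g) x0)].
  rewrite (_ : mkset _ = (fun g => dotv (vec g) x0) @^-1` A)//.
  by rewrite -[X in measurable X]setTI; exact: measurable_dotv_vec.
have := @integral_dotv n x0 (\1_A) x01.
have -> : (\int[g1]_s (\1_A s)%:E)%E = g1 A by rewrite integral_indic// setIT.
move=> <-//.
have -> : gam n [set g | A (dotv (vec g) x0)] =
    (\int[gam n]_g (\1_[set g | A (dotv (vec g) x0)] g)%:E)%E.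
  by rewrite integral_indic// setIT.
by [].
Qed.

End gaussian_marginals.

Section gaussian_sums.
Context (R : realType) (m n : nat).
Local Notation T1 := (measurableTypeR R).
Local Notation gam := (std_normal R).
Variables (hs : nat -> 'rV[R]_n) (N : nat).
Hypothesis hs0 : hs 0%N = 0.
Let G (g : 'rV[R]_n) := maxf (fun l => dotv g (hs l)) N.

Let mG : measurable_fun setT (G \o @vec R n).
Proof. by apply: measurable_maxf => l; exact: measurable_dotv_vec. Qed.

Let G0 g : 0 <= G g.
Proof. by apply: maxf_ge0; rewrite hs0 dotv0r. Qed.

(** [q *m A] has the law of [enorm q] times a standard Gaussian vector, and [G] is positively
    homogeneous. *)
Lemma integral_max_comb (q : 'rV[R]_m) :
  (\int[gam (m * n)]_z (G (q *m vec_mx (vec z)))%:E =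
   (enorm q)%:E * \int[gam n]_g (G (vec g))%:E)%E.
Proof.
have GZ c g : 0 <= c -> G (c *: g) = c * G g.
  move=> c0; rewrite /G -maxfZ//; congr (maxf _ N); apply/funext => l.
  by rewrite dotvZl.
rewrite -ge0_integralZl_cst//; last exact: enorm_ge0.
have [q0|q0] := eqVneq (enorm q) 0.
  have -> : q = 0.
    apply/rowP => j; rewrite mxE.
    have := sqr_enorm q; rewrite q0 expr0n/= => /esym/eqP.
    rewrite psumr_eq0; last by move=> i _; rewrite -expr2 sqr_ge0.
    by move=> /allP/(_ j (mem_index_enum _)) /=; rewrite mulf_eq0 orbb => /eqP.
  have e0 : enorm (0 : 'rV[R]_m) = 0 by rewrite /enorm dotv0r sqrtr0.
  under eq_integral do rewrite mul0mx -(scale0r (0 : 'rV[R]_n)) GZ// mul0r.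
  by under [RHS]eq_integral do rewrite e0 mul0r; rewrite !integral_cst_prob.
have qgt0 : 0 < enorm q by rewrite lt_def q0 enorm_ge0.
pose u := (enorm q)^-1 *: q.
have uu : dotv u u = 1 by rewrite /u dotvZl dotvZr -sqr_enorm; field.
rewrite -(ge0_integral_std_normal_phi (adj_row_comb (n := n) u)
  (fun y => row_combK y uu) (f := fun g => enorm q * G g)).
- apply: eq_integral => z _; rewrite -GZ ?enorm_ge0//= /u -scalemxAl scalerA.
  by rewrite divff// scale1r.
- exact: measurable_funM.
- by move=> g; rewrite mulr_ge0// enorm_ge0.
Qed.

End gaussian_sums.

(** * The multiplier process orthogonal to the signal *)

Section multiplier.
Context (R : realType) (m n : nat).
Local Notation T1 := (measurableTypeR R).
Local Notation gam := (std_normal R).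
Variables (hs : nat -> 'rV[R]_n) (N : nat).
Hypothesis hs0 : hs 0%N = 0.
Let G (g : 'rV[R]_n) := maxf (fun l => dotv g (hs l)) N.

Let mG : measurable_fun setT (G \o @vec R n).
Proof. by apply: measurable_maxf => l; exact: measurable_dotv_vec. Qed.

Let G0 g : 0 <= G g.
Proof. by apply: maxf_ge0; rewrite hs0 dotv0r. Qed.

Variable x0 : 'rV[R]_n.
Hypothesis x01 : dotv x0 x0 = 1.

Definition ortho (h : 'rV[R]_n) := h - dotv h x0 *: x0.

Lemma dotv_ortho h : dotv x0 (ortho h) = 0.
Proof. by rewrite /ortho dotvBr dotvZr x01 mulr1 dotvC subrr. Qed.

(* Jensen's inequality in the direction of [x0], by symmetry of the Gaussian. *)
Lemma integral_max_ortho_le :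
  (\int[gam n]_g (maxf (fun l => dotv (vec g) (ortho (hs l))) N)%:E <=
   \int[gam n]_g (G (vec g))%:E)%E.
Proof.
(* The reflection in the hyperplane orthogonal to [x0], with matrix [W]. The product of [g] with
   [ortho h] is the mean of the products of [g] and [r g] with [h]. *)
pose r (g : 'rV[R]_n) := g - (dotv g x0 *+ 2) *: x0.
have rE g h : dotv (r g) h = dotv g h - dotv g x0 *+ 2 * dotv x0 h.
  by rewrite /r dotvBl dotvZl.
pose W : 'M[R]_n := 1%:M - 2 *: (x0^T *m x0).
have WE g : g *m W = r g.
  rewrite /W mulmxBr mulmx1 -scalemxAr mulmxA [g *m _]mx11_scalar -dotvE mul_scalar_mx.
  by rewrite scalerA mulr_natl.
have WT : W^T = W.
  by rewrite /W linearB/= trmx1 linearZ/= trmx_mul trmxK.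
have WW : W^T *m W = 1%:M.
  rewrite WT; apply/row_matrixP => i; rewrite !rowE mulmxA !WE mulmx1.
  set g := delta_mx _ _.
  have e : dotv (r g) x0 = - dotv g x0 by rewrite rE x01; ring.
  have -> : r (r g) = r g - (dotv (r g) x0 *+ 2) *: x0 by [].
  by rewrite e mulNrn scaleNr opprK /r subrK.
have mr : measurable_fun setT (fun g : n.-tuple T1 => G (r (vec g))).
  apply: mvec_comp mG _ => j.
  by apply: eq_measurable_fun (mvec_mulmx W (@mvec_vec_id R n) j) => g _; rewrite WE.
apply: (@le_trans _ _ (\int[gam n]_g (2^-1 * (G (vec g) + G (r (vec g))))%:E)%E).
  apply: ge0_le_integral_EFin => //.
  - by apply: measurable_maxf => l; exact: measurable_dotv_vec.
  - by apply: measurable_funM => //; exact: measurable_funD.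
  - by move=> g; apply: maxf_ge0; rewrite hs0 /ortho dotv0l scale0r subr0 dotv0r.
  - move=> g; apply: maxf_le => l lN.
    have h1 := le_maxf (fun l => dotv (vec g) (hs l)) lN.
    have h2 := le_maxf (fun l => dotv (r (vec g)) (hs l)) lN.
    rewrite /= rE in h2; rewrite /ortho dotvBr dotvZr (dotvC (hs l)).
    rewrite /G; move: h1 h2; rewrite /=; lra.
rewrite ge0_integralZl_cst//; last 2 first.
- exact: measurable_funD.
- by move=> g; rewrite addr_ge0.
rewrite ge0_integralD_EFin//.
have -> : (\int[gam n]_g (G (r (vec g)))%:E = \int[gam n]_g (G (vec g))%:E)%E.
  rewrite -[RHS](ge0_integral_std_normal_coisometry WW)//.
  by apply: eq_integral => g _; rewrite WE.
rewrite -ge0_integralD_EFin// -ge0_integralZl_cst//; last 2 first.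
- exact: measurable_funD.
- by move=> g; rewrite addr_ge0.
apply: ge0_le_integral_EFin => //.
- by apply: measurable_funM => //; exact: measurable_funD.
- by move=> g; rewrite mulr_ge0 ?addr_ge0.
- by move=> g; lra.
Qed.

(* Given the projections of the rows on [x0], the orthogonal parts of the rows
   are still independent Gaussian vectors. *)
Lemma integral_multiplier_le (q : 'I_m -> R -> R) (w : R) :
  (forall i, measurable_fun setT (q i)) ->
  (\int[gam n]_g (G (vec g))%:E <= w%:E)%E ->
  (\int[gam (m * n)]_z (maxf (fun l => \sum_i
      q i (dotv (row i (vec_mx (vec z))) x0) *
      dotv (row i (vec_mx (vec z))) (ortho (hs l))) N)%:E <=
   \int[gam (m * n)]_z (Num.sqrt (\sum_i
      q i (dotv (row i (vec_mx (vec z))) x0) ^+ 2) * w)%:E)%E.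
Proof.
move=> mq Gw.
pose Q (s : 'rV[R]_m) : 'rV[R]_m := \row_i q i (s 0 i).
pose phi := mulmx x0 \o trmx \o vec_mx : 'rV[R]_(m * n) -> 'rV[R]_m.
pose psi := mxvec \o mulmxr x0 \o trmx : 'rV[R]_m -> 'rV[R]_(m * n).
have phiE z i : phi z 0 i = dotv (row i (vec_mx z)) x0.
  by rewrite /phi /= mxE dotvC; apply: eq_bigr => j _; rewrite !mxE.
pose F (z : 'rV[R]_(m * n)) := maxf (fun l =>
  dotv (Q (phi z) *m vec_mx z) (ortho (hs l))) N.
have FE z : maxf (fun l => \sum_i q i (dotv (row i (vec_mx z)) x0) *
      dotv (row i (vec_mx z)) (ortho (hs l))) N = F z.
  congr (maxf _ N); apply/funext => l.
  rewrite dotv_mulmx /dotv; apply: eq_bigr => i _.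
  have -> : Q (phi z) 0 i = q i (dotv (row i (vec_mx z)) x0) by rewrite mxE phiE.
  rewrite -/(dotv _ _); congr (_ * _).
  by rewrite [RHS]mxE; apply: eq_bigr => j _; rewrite !mxE mulrC.
have mrow i : mvec (fun z : (m * n).-tuple T1 => row i (vec_mx (vec z))).
  by apply: mvec_row; exact: mvec_vec_id.
have mF : measurable_fun setT (F \o @vec R (m * n)).
  apply: eq_measurable_fun (_ : measurable_fun setT (fun z : (m * n).-tuple T1 =>
    maxf (fun l => \sum_i q i (dotv (row i (vec_mx (vec z))) x0) *
      dotv (row i (vec_mx (vec z))) (ortho (hs l))) N)) => [z _|]; first by rewrite FE.
  apply: measurable_maxf => l; apply: measurable_sum => i; apply: measurable_funM.
    apply: measurableT_comp (mq i) _; apply: mvec_dotv => //; exact: mvec_cst.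
  by apply: mvec_dotv => //; exact: mvec_cst.
have F0 z : 0 <= F z.
  by apply: maxf_ge0; rewrite hs0 /ortho dotv0l scale0r subr0 dotv0r.
under eq_integral do rewrite FE.
have := ge0_integral_std_normal_replace (adj_row_dot (M := m) x0)
  (fun s => row_dotK s x01) mF F0.
move=> ->.
pose E (s : 'rV[R]_m) := enorm (Q s) * w.
have w0 : 0 <= w.
  by rewrite -lee_fin; apply: le_trans Gw; exact: integral_EFin_ge0.
have mQ : mvec (fun s : m.-tuple T1 => Q (vec s)).
  move=> i; apply: eq_measurable_fun (_ : measurable_fun setT
    (fun s : m.-tuple T1 => q i (vec s 0 i))) => [s _|]; first by rewrite !mxE.
  exact: (measurableT_comp (mq i) (@mvec_vec_id R m i)).
have mEn : measurable_fun setT (fun s : m.-tuple T1 => enorm (Q (vec s))).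
  apply: (@measurableT_comp _ _ _ _ _ _ (@Num.sqrt R)).
    exact: continuous_measurable_fun (@sqrt_continuous R).
  exact: mvec_dotv.
have mE : measurable_fun setT (E \o @vec R m) by exact: measurable_funM.
have E0 s : 0 <= E s by rewrite mulr_ge0// enorm_ge0.
have -> : (\int[gam (m * n)]_z (Num.sqrt (\sum_i
      q i (dotv (row i (vec_mx (vec z))) x0) ^+ 2) * w)%:E =
    \int[gam m]_s (E (vec s))%:E)%E.
  rewrite -(ge0_integral_std_normal_phi (adj_row_dot (M := m) x0)
    (fun s => row_dotK s x01) mE E0).
  apply: eq_integral => z _; congr (_ * _)%:E; congr Num.sqrt.
  by apply: eq_bigr => i _; rewrite mxE -phiE expr2.
pose I0 := (\int[gam n]_g (maxf (fun l => dotv (vec g) (ortho (hs l))) N)%:E)%E.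
have I0w : (I0 <= w%:E)%E by apply: le_trans Gw; exact: integral_max_ortho_le.
have I00 : (0 <= I0)%E.
  apply: integral_EFin_ge0 => g; apply: maxf_ge0.
  by rewrite hs0 /ortho dotv0l scale0r subr0 dotv0r.
have I0E : I0 = (fine I0)%:E.
  by rewrite fineK// ge0_fin_numE//; exact: le_lt_trans I0w (ltry _).
(* For fixed [s] the multipliers [Q (vec s)] are constants. Resampling changes each row by a
   multiple of [x0], which is invisible to [ortho], so a fixed combination of Gaussian rows
   remains. *)
have inner s : (\int[gam (m * n)]_z (F (vec z + psi (vec s - phi (vec z))))%:E =
    (enorm (Q (vec s)) * fine I0)%:E)%E.
  rewrite EFinM -I0E.
  have o0 : ortho (hs 0%N) = 0 by rewrite hs0 /ortho dotv0l scale0r subr0.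
  rewrite -(@integral_max_comb R m n (fun l => ortho (hs l)) N o0).
  apply: eq_integral => z _; congr (maxf _ N)%:E; apply/funext => l.
  have -> : phi (vec z + psi (vec s - phi (vec z))) = vec s.
    have pK y : phi (psi y) = y by exact: row_dotK.
    have -> u v : phi (u + v) = phi u + phi v by rewrite /phi linearD.
    by rewrite pK addrC subrK.
  rewrite /psi /= linearD/= mxvecK mulmxDr mulmxA dotvDl.
  rewrite [Q (vec s) *m _^T]mx11_scalar mul_scalar_mx dotvZl dotv_ortho//.
  by rewrite mulr0 addr0.
rewrite (eq_integral (fun s => (enorm (Q (vec s)) * fine I0)%:E)); last first.
  by move=> s _; rewrite -inner.
apply: ge0_le_integral_EFin => //.
- exact: measurable_funM.
- by move=> s; rewrite mulr_ge0 ?enorm_ge0// fine_ge0.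
- by move=> s; rewrite /E ler_wpM2l ?enorm_ge0// -lee_fin -I0E.
Qed.

End multiplier.

Section centered_product.
Context (R : realType) d (U : measurableType d) (Q : probability U R) (v : U -> R).
Hypothesis iv : Q.-integrable setT (EFin \o v).
Hypothesis v0 : (\int[Q]_u (v u)%:E = 0)%E.

Let W (z : U * U) := (v z.1 * v z.2)%:E.

Let mv : measurable_fun setT v.
Proof. by apply/measurable_EFinP; exact: measurable_int iv. Qed.

Lemma integrable_prod_self : (Q \x Q)%E.-integrable setT W.
Proof.
have mW : measurable_fun setT W.
  apply/measurable_EFinP; apply: measurable_funM.
    exact: (measurableT_comp mv measurable_fst).
  exact: (measurableT_comp mv measurable_snd).
apply: (proj2 (@integrable12ltyP _ _ U U R Q Q W mW)).
have mn : measurable_fun setT (fun x => (`|v x|)%:E).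
  by apply/measurable_EFinP; exact: measurableT_comp.
rewrite /W/=; under eq_integral => x _.
  under eq_integral do rewrite normrM EFinM.
  rewrite ge0_integralZl//.
  over.
rewrite ge0_integralZr//; last exact: integral_ge0.
have /integrableP[_ h] := iv.
by apply: lte_mul_pinfty => //; [exact: integral_ge0|rewrite ge0_fin_numE ?integral_ge0].
Qed.

Lemma integral_prod_self : (\int[Q \x Q]_z (v z.1 * v z.2)%:E = 0)%E.
Proof.
rewrite -(integral12_prod_meas1 integrable_prod_self) /fubini_F /W/=.
rewrite (eq_integral (fun=> 0%E)) ?integral0// => x _.
under eq_integral do rewrite EFinM.
by rewrite integralZl// v0 mule0.
Qed.

(** The pair has law [Q \x Q], under which Fubini's theorem factors the integral into a product of
    two vanishing means. *)
Lemma integral_indep_product dO (Om : measurableType dO) (P : probability Om R)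
    (X Y : {mfun Om >-> U}) :
  (forall A B, measurable A -> measurable B ->
    P (X @^-1` A `&` Y @^-1` B) = Q A * Q B)%E ->
  (\int[P]_w (v (X w) * v (Y w))%:E = 0)%E.
Proof.
move=> ind.
have iW := integrable_prod_self.
have mW : measurable_fun setT W by exact: measurable_int iW.
have mXY : measurable_fun setT (fun w => (X w, Y w)).
  by apply: measurable_fun_pair; exact: measurable_funP.
pose XY : {mfun Om >-> (U * U)%type} := mfun_Sub (mem_set mXY).
have lawXY E : measurable E -> distribution P XY E = (Q \x Q)%E E.
  by move=> mE; exact: (@law_of_pair _ _ _ P _ _ _ _ XY).
rewrite -integral_prod_self.
transitivity (\int[distribution P XY]_z W z)%E; last first.
  by apply: eq_measure_integral => A mA _; exact: lawXY.
rewrite integral_distribution//.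
apply/integrableP; split; first exact: (measurableT_comp mW mXY).
have /integrableP[_ h] := iW.
apply: le_lt_trans h.
have -> : (\int[P]_x `|(W \o XY) x| = \int[distribution P XY]_z `|W z|)%E.
  by rewrite ge0_integral_distribution//; exact: measurableT_comp.
rewrite le_eqVlt; apply/orP; left; apply/eqP.
by apply: eq_measure_integral => A mA _; exact: lawXY.
Qed.

End centered_product.

(** * Mean bounds under the observation model *)

Section model_bounds.
Context (R : realType) d (Om : measurableType d) (P : probability Om R).
Context dX (Xi : measurableType dX) (nu : probability Xi R) (n m : nat).
Local Notation T1 := (measurableTypeR R).
Local Notation gam := (std_normal R).
Local Notation g1 := (normal_prob (0 : R) 1).
Local Notation Q := (g1 \x nu)%E.
Variables (a : 'I_m -> {RV P >-> n.-tuple T1}) (xi : 'I_m -> {RV P >-> Xi}).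
Hypothesis law_a : forall i, has_law (a i) (gam n).
Hypothesis law_xi : forall i, has_law (xi i) nu.
Hypothesis indep : mutually_independent P (fun k : 'I_m + 'I_m =>
    match k with
    | inl i => g_sigma_algebra_preimage (a i)
    | inr i => g_sigma_algebra_preimage (xi i)
    end).
Variable x0 : 'rV[R]_n.
Hypothesis x01 : dotv x0 x0 = 1.

(** The pair has the law [Q] of [(g, xi)] used for the model parameters, and the ideal observation
    and its multiplier are functions of it. *)
Definition proj_seed i (w : Om) : T1 * Xi := (dotv (vec (a i w)) x0, xi i w).

Lemma measurable_proj_seed i : measurable_fun setT (proj_seed i).
Proof.
apply: measurable_fun_pair; last exact: measurable_funP.
apply: mvec_dotv; last exact: mvec_cst.
by apply: mvec_vec; exact: measurable_funP.
Qed.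

HB.instance Definition _ i := isMeasurableFun.Build _ _ _ _ _ (measurable_proj_seed i).

Lemma indep_proj_seed (J : {set 'I_m}) (A : 'I_m -> set T1) (B : 'I_m -> set Xi) :
  (forall i, measurable (A i)) -> (forall i, measurable (B i)) ->
  (P [set w | forall i, i \in J -> (A i `*` B i) (proj_seed i w)] =
   \prod_(i in J) (g1 (A i) * nu (B i)))%E.
Proof.
move=> mA mB; rewrite big_split/=.
pose A' i : set (n.-tuple T1) := [set g | A i (dotv (vec g) x0)].
have mA' i : measurable (A' i).
  rewrite (_ : A' i = (fun g => dotv (vec g) x0) @^-1` A i)//.
  by rewrite -[X in measurable X]setTI; exact: (measurable_dotv_vec x0 measurableT (mA i)).
have -> : (\prod_(i in J) g1 (A i) = \prod_(i in J) gam n (A' i))%E.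
  by apply: eq_bigr => i _; rewrite /A' law_dotv.
by rewrite -(indep_events law_a law_xi indep).
Qed.

Lemma law_proj_seed i E : measurable E -> P (proj_seed i @^-1` E) = Q E.
Proof.
move=> mE; apply: (@law_of_pair _ _ _ P _ _ _ _ (proj_seed i)) => // A B mA mB.
have := @indep_proj_seed [set i]%SET (fun=> A) (fun=> B) (fun=> mA) (fun=> mB).
rewrite big_set1 => <-; congr (P _).
apply/seteqP; split => w /=; first by move=> H j; rewrite inE => /eqP ->.
by move=> /(_ i); rewrite inE => /(_ (eqxx _)).
Qed.

Lemma law_proj_seed2 i j E F : i != j -> measurable E -> measurable F ->
  (P (proj_seed i @^-1` E `&` proj_seed j @^-1` F) = Q E * Q F)%E.
Proof.
move=> ij.
have rr A B A' B' : measurable A -> measurable B -> measurable A' -> measurable B' ->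
    (P (proj_seed i @^-1` (A `*` B) `&` proj_seed j @^-1` (A' `*` B')) =
     Q (A `*` B) * Q (A' `*` B'))%E.
  move=> mA mB mA' mB'.
  have := @indep_proj_seed [set i; j]%SET (fun k => if k == i then A else A')
    (fun k => if k == i then B else B').
  rewrite big_setU1 ?inE//= big_set1 eqxx eq_sym (negbTE ij) => H.
  rewrite !product_measure1E// -H; last 2 first.
  - by move=> k; case: ifP.
  - by move=> k; case: ifP.
  congr (P _); apply/seteqP; split => w /=.
    move=> [H1 H2] k; rewrite !inE => /orP[] /eqP ->; first by rewrite eqxx.
    by rewrite eq_sym (negbTE ij).
  move=> H'; split; first by have := H' i; rewrite !inE eqxx => /(_ isT).
  by have := H' j; rewrite !inE eqxx orbT eq_sym (negbTE ij) => /(_ isT).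
have step1 E' A' B' : measurable E' -> measurable A' -> measurable B' ->
    (P (proj_seed i @^-1` E' `&` proj_seed j @^-1` (A' `*` B')) =
     Q E' * P (proj_seed j @^-1` (A' `*` B')))%E.
  move=> mE' mA' mB'.
  have mAB' : measurable (A' `*` B') by exact: measurableX.
  apply: (@indep_step _ _ _ P _ _ (proj_seed i) _ _ _ (measurable_rects _ _)
    (@setI_closed_rects _ _ _ _) (rectsT _ _)) => //.
    exact: (measurable_preimage (proj_seed j)).
  by move=> _ [A mA [B mB <-]]; rewrite rr// law_proj_seed.
move=> mE mF; rewrite setIC -(law_proj_seed i mE) [RHS]muleC.
apply: (@indep_step _ _ _ P _ _ (proj_seed j) _ _ _ (measurable_rects _ _)
    (@setI_closed_rects _ _ _ _) (rectsT _ _)) => //.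
  exact: (measurable_preimage (proj_seed i)).
move=> _ [A mA [B mB <-]]; rewrite setIC step1// muleC.
by rewrite !law_proj_seed//; exact: measurableX.
Qed.

Lemma ge0_integral_proj_seed i (f : T1 * Xi -> R) :
  measurable_fun setT f -> (forall x, 0 <= f x) ->
  (\int[P]_w (f (proj_seed i w))%:E = \int[Q]_u (f u)%:E)%E.
Proof.
move=> mf f0.
transitivity (\int[distribution P (proj_seed i)]_u (f u)%:E)%E.
  rewrite ge0_integral_distribution//; exact/measurable_EFinP.
by apply: eq_measure_integral => A mA _; exact: law_proj_seed.
Qed.

Lemma integral_proj_seed2 i j (v : T1 * Xi -> R) : i != j ->
  Q.-integrable setT (EFin \o v) -> (\int[Q]_u (v u)%:E = 0)%E ->
  (\int[P]_w (v (proj_seed i w) * v (proj_seed j w))%:E = 0)%E.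
Proof.
move=> ij iv v0; apply: (integral_indep_product iv v0 (X := proj_seed i) (Y := proj_seed j)).
by move=> A B mA mB; exact: law_proj_seed2.
Qed.

Lemma centered_sum_le (v : T1 * Xi -> R) (c : R) :
  Q.-integrable setT (EFin \o v) -> (\int[Q]_u (v u)%:E = 0)%E ->
  (\int[Q]_u (v u ^+ 2)%:E <= c%:E)%E ->
  (\int[P]_w ((\sum_i v (proj_seed i w)) ^+ 2)%:E <= (m%:R * c)%:E)%E.
Proof.
move=> iv v0 v2.
have mv : measurable_fun setT v by apply/measurable_EFinP; exact: measurable_int iv.
apply: second_moment_sum_le.
- move=> i; exact: (measurableT_comp mv (measurable_proj_seed i)).
- move=> i; rewrite (ge0_integral_proj_seed i (f := fun u => v u ^+ 2))//.
    exact: measurable_funX.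
  by move=> u; exact: sqr_ge0.
- by move=> i j ij; exact: integral_proj_seed2.
Qed.

(** With the seeds integrated last, the multipliers are deterministic functions of the projections
    and [integral_multiplier_le] applies. The mean of the random length is at most the root of its
    second moment, [sqrt m * sigma]. *)
Lemma multiplier_mean_le (hs : nat -> 'rV[R]_n) N (h : T1 * Xi -> R) (sigma w : R) :
  hs 0%N = 0 -> measurable_fun setT h -> 0 <= sigma -> 0 <= w ->
  (\int[Q]_u (h u ^+ 2)%:E <= (sigma ^+ 2)%:E)%E ->
  (\int[gam n]_g (maxf (fun l => dotv (vec g) (hs l)) N)%:E <= w%:E)%E ->
  (\int[P]_o (maxf (fun l => \sum_i h (proj_seed i o) *
      dotv (vec (a i o)) (ortho x0 (hs l))) N)%:E <=
   (Num.sqrt m%:R * sigma * w)%:E)%E.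
Proof.
move=> hs0 mh s0 w0 h2 hw.
have o0 : ortho x0 (hs 0%N) = 0 by rewrite hs0 /ortho dotv0l scale0r subr0.
pose rw (z : 'rV[R]_(m * n)) i := row i (vec_mx z).
pose F (z : (m * n).-tuple T1 * m.-tuple Xi) := maxf (fun l => \sum_i
  h (dotv (rw (vec z.1) i) x0, tnth z.2 i) * dotv (rw (vec z.1) i) (ortho x0 (hs l))) N.
pose H (z : (m * n).-tuple T1 * m.-tuple Xi) := Num.sqrt (\sum_i
  h (dotv (rw (vec z.1) i) x0, tnth z.2 i) ^+ 2) * w.
have mrw i : mvec (fun z : (m * n).-tuple T1 * m.-tuple Xi => rw (vec z.1) i).
  by apply: mvec_row; exact: mvec_fst.
have mhz i : measurable_fun setT (fun z : (m * n).-tuple T1 * m.-tuple Xi =>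
    h (dotv (rw (vec z.1) i) x0, tnth z.2 i)).
  apply: (measurableT_comp mh); apply: measurable_fun_pair.
    by apply: mvec_dotv => //; exact: mvec_cst.
  exact: (measurableT_comp (measurable_tnth i) measurable_snd).
have mF : measurable_fun setT F.
  apply: measurable_maxf => l; apply: measurable_sum => i; apply: measurable_funM => //.
  by apply: mvec_dotv => //; exact: mvec_cst.
have F0 z : 0 <= F z.
  by apply: maxf_ge0; rewrite big1// => i _; rewrite o0 dotv0r mulr0.
have mH : measurable_fun setT H.
  apply: measurable_funM => //; apply: (@measurableT_comp _ _ _ _ _ _ (@Num.sqrt R)).
    exact: continuous_measurable_fun (@sqrt_continuous R).
  by apply: measurable_sum => i; exact: measurable_funX.
have H0 z : 0 <= H z by rewrite mulr_ge0// sqrtr_ge0.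
have law := ge0_integral_indep (indep_rows_seeds law_a law_xi indep).
have eF : (\int[P]_o (F (all_rows a o, all_seeds xi o))%:E =
    \int[gam (m * n) \x distribution P (all_seeds xi)]_z (F z)%:E)%E.
  by apply: (law (EFin \o F)); [exact/measurable_EFinP|move=> z; rewrite lee_fin].
have eH : (\int[P]_o (H (all_rows a o, all_seeds xi o))%:E =
    \int[gam (m * n) \x distribution P (all_seeds xi)]_z (H z)%:E)%E.
  by apply: (law (EFin \o H)); [exact/measurable_EFinP|move=> z; rewrite lee_fin].
have FE o : maxf (fun l => \sum_i h (proj_seed i o) *
      dotv (vec (a i o)) (ortho x0 (hs l))) N = F (all_rows a o, all_seeds xi o).
  congr (maxf _ N); apply/funext => l; apply: eq_bigr => i _.
  by rewrite /rw row_all_rows tnth_all_seeds.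
under eq_integral do rewrite FE.
apply: (@le_trans _ _ (\int[P]_o (H (all_rows a o, all_seeds xi o))%:E)%E).
  have eF' : measurable_fun setT (EFin \o F) by exact/measurable_EFinP.
  have eH' : measurable_fun setT (EFin \o H) by exact/measurable_EFinP.
  rewrite eF eH (fubini_tonelli2 (EFin \o F))//.
  rewrite (fubini_tonelli2 (EFin \o H))//.
  apply: ge0_le_integral => //.
  - by move=> x _; apply: integral_ge0 => z _; rewrite lee_fin.
  - exact: measurable_fun_fubini_tonelli_G.
  - exact: measurable_fun_fubini_tonelli_G.
  move=> x _; rewrite /fubini_G /=.
  apply: (integral_multiplier_le hs0 x01 (q := fun i s => h (s, tnth x i))) => // i.
  exact: (measurable_fun_pair1 (tnth x i) mh).
have HE o : H (all_rows a o, all_seeds xi o) =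
    w * Num.sqrt (\sum_i h (proj_seed i o) ^+ 2).
  rewrite /H mulrC; congr (_ * Num.sqrt _); apply: eq_bigr => i _.
  by rewrite /rw row_all_rows tnth_all_seeds.
under eq_integral do rewrite HE.
have mhU i : measurable_fun setT (fun o => h (proj_seed i o) ^+ 2).
  by apply: measurable_funX; exact: (measurableT_comp mh (measurable_proj_seed i)).
have mS : measurable_fun setT (fun o => \sum_i h (proj_seed i o) ^+ 2).
  exact: measurable_sum.
have S0 o : 0 <= \sum_i h (proj_seed i o) ^+ 2 by rewrite sumr_ge0// => i _; exact: sqr_ge0.
rewrite ge0_integralZl_cst//; last first.
  by apply: (measurableT_comp _ mS); exact: continuous_measurable_fun (@sqrt_continuous R).
rewrite [_ * w]mulrC EFinM lee_wpmul2l ?lee_fin//.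
have -> : Num.sqrt m%:R * sigma = Num.sqrt (m%:R * sigma ^+ 2).
  by rewrite sqrtrM// sqrtr_sqr ger0_norm.
apply: integral_sqrt_le => //; first by rewrite mulr_ge0// sqr_ge0.
under eq_integral do rewrite -sumEFin.
rewrite ge0_integral_sum//; last 2 first.
- by move=> i; exact/measurable_EFinP.
- by move=> i o _; rewrite lee_fin sqr_ge0.
apply: (@le_trans _ _ (\sum_(i < m) (sigma ^+ 2)%:E)%E); last first.
  by rewrite sumEFin sumr_const card_ord mulr_natl.
apply: lee_sum => i _.
rewrite (ge0_integral_proj_seed i (f := fun u => h u ^+ 2))//; first exact: measurable_funX.
by move=> u; exact: sqr_ge0.
Qed.

End model_bounds.

(** * Empirical losses *)

Lemma enormB_le (R : realType) n (x y : 'rV[R]_n) : enorm (x - y) <= enorm x + enorm y.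
Proof.
rewrite -(ler_pXn2r (_ : 0 < 2)%N) ?nnegrE ?addr_ge0 ?enorm_ge0// sqrrD !sqr_enorm.
rewrite dotvBl !dotvBr (dotvC y x).
have := dotv_le x y; rewrite ler_norml => /andP[h1 h2].
by rewrite -mulr_natr; lra.
Qed.

Section dense_sequence.
Context (R : realType) (n : nat).

Lemma rat_approx (x : 'rV[R]_n) (e : R) : 0 < e ->
  exists q : 'rV[rat]_n, enorm (x - map_mx ratr q) < e.
Proof.
(* Dividing by [n.+1] gives [n * d ^+ 2 < e ^+ 2] and also covers dimension [0]. *)
move=> e0; pose d := e / n.+1%:R.
have d0 : 0 < d by rewrite divr_gt0.
have ex j : exists q : rat, `|x 0 j - ratr q| < d.
  have [q] := @rat_in_itvoo R (x 0 j - d) (x 0 j + d) ltac:(lra).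
  by rewrite in_itv/= => /andP[h1 h2]; exists q; rewrite ltr_norml; lra.
have [q qP] : exists q : 'rV[rat]_n, forall j, `|x 0 j - ratr (q 0 j)| < d.
  by exists (\row_j sval (cid (ex j))) => j; rewrite mxE; exact: svalP (cid (ex j)).
exists q; rewrite -(ltr_pXn2r (_ : 0 < 2)%N) ?nnegrE ?enorm_ge0 ?ltW// sqr_enorm.
apply: (@le_lt_trans _ _ (\sum_(j < n) d ^+ 2)).
  apply: ler_sum => j _; rewrite !mxE -expr2 -real_normK ?num_real//.
  by rewrite ler_pXn2r ?nnegrE// ?ltW//; exact: qP.
rewrite sumr_const card_ord -[_ *+ n]mulr_natl /d exprMn mulrCA.
rewrite -[ltRHS]mulr1 ltr_pM2l ?exprn_gt0// exprVn -ltr_pdivlMr ?invr_gt0 ?exprn_gt0//.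
rewrite invrK mul1r -natrX ltr_nat (leq_trans (ltnSn n))//.
exact: (@leq_pexp2l n.+1 1 2).
Qed.

(** Rational points may all lie outside [T]. For each rational vector and each radius [1 / (j + 1)],
    a point of [T] within that distance is chosen if there is one, and [0] otherwise; index [0] is
    reserved for the zero vector. *)
Lemma dense_sequence (T : set 'rV[R]_n) : T 0 ->
  exists hs : nat -> 'rV[R]_n, [/\ hs 0%N = 0, forall k, T (hs k) &
    forall h, T h -> forall e, 0 < e -> exists k, enorm (h - hs k) < e].
Proof.
move=> T0.
pose S (c : 'rV[rat]_n * nat) : set 'rV[R]_n :=
  [set x | T x /\ enorm (x - map_mx ratr c.1) < c.2.+1%:R^-1].
pose pt c := xget 0 (S c).
have ptT c : T (pt c).
  rewrite /pt; have [[x Sx]|nS] := pselect (exists x, S c x).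
    by have [] := xgetPex 0 (ex_intro _ x Sx).
  by rewrite xgetPN// => x Sx; apply: nS; exists x.
pose hs k := if k is k'.+1 then if unpickle k' is Some c then pt c else 0 else 0.
exists hs; split => //.
  by case=> [|k]//=; case: unpickle => //= c.
move=> h Th e e0.
have e2 : 0 < e / 2 by rewrite divr_gt0.
have [j] := ltr_add_invr e2; rewrite add0r => hj.
have [q hq] := @rat_approx h j.+1%:R^-1 ltac:(by rewrite invr_gt0).
exists (pickle (q, j)).+1; rewrite /hs pickleK.
have Sh : S (q, j) h by [].
have [_ /= hp] := xgetPex 0 (ex_intro (S (q, j)) h Sh).
rewrite -/(pt (q, j)) in hp.
rewrite (_ : h - pt (q, j) = (h - map_mx ratr q) - (pt (q, j) - map_mx ratr q)); last first.
  by rewrite opprB addrA subrK.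
apply: (le_lt_trans (enormB_le _ _)); rewrite [ltRHS](splitr e).
by apply: ltrD; [exact: lt_trans hq hj|exact: lt_trans hp hj].
Qed.

End dense_sequence.

Section deterministic.
Context (R : realType) (n m : nat).
Implicit Types (x v : 'rV[R]_n).

(** The difference quotient along [v] is that of [s |-> g (dotv b x + s * dotv b v)] at [0], so the
    chain rule in one variable suffices. *)
Lemma derive_along_line (g : R -> R) (b x v : 'rV[R]_n) :
  derivable g (dotv b x) 1 ->
  derivable (fun z => g (dotv b z)) x v /\
  'D_v (fun z => g (dotv b z)) x = (g^`()%classic) (dotv b x) * dotv b v.
Proof.
move=> dg.
have eqfun : (fun h : R => h^-1 *: (((fun z => g (dotv b z)) \o shift x) (h *: v) - g (dotv b x))) =
  (fun h : R => h^-1 *: (((fun s => g (dotv b x + s * dotv b v)) \o shift 0) (h *: 1) -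
     (fun s => g (dotv b x + s * dotv b v)) 0)).
  apply/funext => h /=; rewrite mul0r !addr0 /shift/= dotvDr dotvZr [h *: 1]mulr1.
  by rewrite (addrC (h * _)).
have dlin : is_derive (0 : R) 1 (fun s : R => dotv b x + s * dotv b v) (dotv b v).
  have -> : (fun s : R => dotv b x + s * dotv b v) = cst (dotv b x) + dotv b v *: id.
    by apply/funext => s /=; rewrite fctE/= mulrC.
  have h1 : is_derive (0 : R) (1 : R) (cst (dotv b x) : R -> R) 0 := is_derive_cst _ _ _.
  have h2 : is_derive (0 : R) (1 : R) (id : R -> R) 1 := is_derive_id _ _.
  have := is_deriveD h1 (is_deriveZ (dotv b v) h2).
  by rewrite add0r [_ *: 1]mulr1.
have dgi : is_derive (dotv b x + 0 * dotv b v) 1 g (g^`()%classic (dotv b x)).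
  by rewrite mul0r addr0 derive1E; exact: derivableP.
have [h1 h2] := @is_derive1_comp R g (fun s : R => dotv b x + s * dotv b v) 0 _ _ dgi dlin.
split; first by rewrite /derivable eqfun.
by rewrite /derive eqfun -h2.
Qed.

Variables (L : R -> R -> R) (Y : set R) (A : 'I_m -> 'rV[R]_n) (yt : 'I_m -> R).
Hypothesis admL : admissible_loss Y L.
Hypothesis ytY : forall i, Y (yt i).

Lemma derive_empirical_loss x v :
  'D_v (empirical_loss L A yt) x =
  m%:R^-1 * \sum_i dloss L (dotv (A i) x) (yt i) * dotv (A i) v.
Proof.
have -> : empirical_loss L A yt =
    m%:R^-1 *: (\sum_(i < m) (fun z => L (dotv (A i) z) (yt i))).
  apply/funext => z; rewrite /empirical_loss /GRing.scale/= -[RHS]/(_ * _).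
  by congr (_ * _); rewrite fct_sumE.
have h i : is_derive x v (fun z => L (dotv (A i) z) (yt i))
    (dloss L (dotv (A i) x) (yt i) * dotv (A i) v).
  have [_ dL _] := admL (ytY i).
  have [h1 h2] := @derive_along_line (L ^~ (yt i)) (A i) x v (dL _).
  exact: DeriveDef.
have := is_deriveZ m%:R^-1 (is_derive_sum h).
by move=> hd; rewrite derive_val.
Qed.

Lemma dotv_grad_empirical_loss x v :
  dotv (grad (empirical_loss L A yt) x) v =
  m%:R^-1 * \sum_i dloss L (dotv (A i) x) (yt i) * dotv (A i) v.
Proof.
rewrite /dotv; under eq_bigr do rewrite mxE derive_empirical_loss.
under eq_bigr do rewrite -mulrA big_distrl/=.
rewrite -big_distrr/= exchange_big/=; congr (_ * _); apply: eq_bigr => i _.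
rewrite big_distrr/=; apply: eq_bigr => j _; rewrite -mulrA; congr (_ * (_ * _)).
rewrite /dotv (bigD1 j)//= !mxE !eqxx mulr1 big1 ?addr0// => k kj.
by rewrite mxE (negbTE kj) andbF mulr0.
Qed.

Lemma convex_empirical_loss x z (s : R) : 0 <= s -> s <= 1 ->
  empirical_loss L A yt (s *: x + (1 - s) *: z) <=
  s * empirical_loss L A yt x + (1 - s) * empirical_loss L A yt z.
Proof.
move=> s0 s1; rewrite /empirical_loss.
rewrite !(mulrCA _ (m%:R^-1)) -mulrDr; apply: ler_wpM2l; first by rewrite invr_ge0.
rewrite !big_distrr/= -big_split/=; apply: ler_sum => i _.
have [cL _ _] := admL (ytY i).
have := cL (Itv01 s0 s1) (dotv (A i) x) (dotv (A i) z) (in_setT _) (in_setT _).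
by rewrite dotvDr !dotvZr.
Qed.

(* If some minimizer were farther than [t] from [x1], the segment from [x1] to it
   would cross the sphere of radius [t] at a point where the loss is at most its
   value at [x1]; there RSC gives a lower bound on the gradient term. *)
Lemma rsc_minimizer (K : set 'rV[R]_n) (c t : R) x1 xhat :
  convex_set K -> K x1 -> 0 < t ->
  RSC c t (empirical_loss L A yt) x1 K ->
  minimizer (empirical_loss L A yt) K xhat -> t < enorm (xhat - x1) ->
  exists h, [/\ K (x1 + h), enorm h = t &
    c * t ^+ 2 <= - dotv (grad (empirical_loss L A yt) x1) h].
Proof.
move=> cK Kx1 t0 rsc [Kx xmin] tx.
set D := enorm (xhat - x1) in tx *.
have D0 : 0 < D by exact: lt_trans tx.
pose s := t / D.
have s0 : 0 <= s by rewrite divr_ge0// ltW.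
have s1 : s <= 1 by rewrite ler_pdivrMr// mul1r ltW.
pose h := s *: (xhat - x1).
have xE : x1 + h = s *: xhat + (1 - s) *: x1.
  by rewrite /h scalerBr scalerBl scale1r addrC -addrA; congr (_ + _); rewrite addrC.
have Kh : K (x1 + h).
  rewrite xE; have := cK xhat x1 (Itv01 s0 s1).
  by rewrite !inE => /(_ Kx Kx1).
have nh : enorm h = t.
  by rewrite /h enormZ ger0_norm// -/D /s divfK// gt_eqF.
exists h; split => //.
have := rsc _ Kh; rewrite addrAC subrr add0r => /(_ nh); rewrite nh.
move=> /le_trans; apply.
have := convex_empirical_loss xhat x1 s0 s1; rewrite -xE => cx.
have := xmin _ Kx1 => mx.
have : empirical_loss L A yt (x1 + h) <= empirical_loss L A yt x1.
  apply: (le_trans cx); nra.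
lra.
Qed.

End deterministic.

(** * The local mean width *)

Section width.
Context (R : realType).
Local Notation T1 := (measurableTypeR R).
Local Notation gam := (std_normal R).

(** Read off the definition of the integral as a supremum over simple functions. It allows
    comparisons with the supremum in the mean width, which runs over an arbitrary set of vectors. *)
Lemma le_integral_nonmeasurable d (T : measurableType d) (mu : {measure set T -> \bar R})
    (f g : T -> \bar R) : (forall x, 0 <= f x)%E -> (forall x, f x <= g x)%E ->
  (\int[mu]_x f x <= \int[mu]_x g x)%E.
Proof.
move=> f0 fg; have g0 x : (0 <= g x)%E by exact: le_trans (fg x).
rewrite !ge0_integralTE//; apply: le_ereal_sup => _ [h hf <-].
by exists h => // x; exact: le_trans (fg x).
Qed.

Section local_mean_width.
Context (n : nat) (t : R) (K : set 'rV[R]_n).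
Hypothesis t0 : 0 <= t.
Hypothesis K0 : K 0.

Let S (g : n.-tuple T1) : \bar R :=
  ereal_sup [set (dotv (vec g) x)%:E | x in K `&` euclidean_ball t].

Let S0 g : (0 <= S g)%E.
Proof.
apply: ereal_sup_ubound; exists 0; last by rewrite dotv0r.
by split => //; rewrite /euclidean_ball/= /enorm dotv0r sqrtr0.
Qed.

Let S_le g : (S g <= (t * \sum_(j < n) `|dotv (vec g) (delta_mx 0 j)|)%:E)%E.
Proof.
have dd j : dotv (vec g) (delta_mx 0 j) = vec g 0 j.
  rewrite /dotv (bigD1 j)//= !mxE !eqxx mulr1 big1 ?addr0// => k kj.
  by rewrite !mxE (negbTE kj) andbF mulr0.
apply: ge_ereal_sup => _ [x [_ xt] <-]; rewrite lee_fin.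
apply: (le_trans (ler_norm _)); apply: (le_trans (dotv_le _ _)).
rewrite mulrC ler_pM ?enorm_ge0//.
rewrite -(ler_pXn2r (_ : 0 < 2)%N) ?nnegrE ?enorm_ge0 ?sumr_ge0// sqr_enorm.
have -> : \sum_(j < n) `|dotv (vec g) (delta_mx 0 j)| = \sum_(j < n) `|vec g 0 j|.
  by apply: eq_bigr => j _; rewrite dd.
rewrite [leRHS]expr2 big_distrl/=; apply: ler_sum => j _.
rewrite -expr2 -real_normK ?num_real// expr2 ler_wpM2l//.
by rewrite (bigD1 j)//= lerDl sumr_ge0.
Qed.

(** The supremum is dominated by [t] times the sum of the absolute coordinates, so the integral is
    finite and [fine] loses nothing. *)
Lemma local_mean_widthE : (local_mean_width t K)%:E = (\int[gam n]_g S g)%E.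
Proof.
rewrite /local_mean_width fineK// ge0_fin_numE; last by apply: integral_ge0 => g _; exact: S0.
apply: le_lt_trans (le_integral_nonmeasurable (gam n) S0 S_le) _.
have md j : measurable_fun setT (fun g : n.-tuple T1 => `|dotv (vec g) (delta_mx 0 j)|).
  by apply: measurableT_comp => //; exact: measurable_dotv_vec.
rewrite ge0_integralZl_cst//; last 2 first.
- exact: measurable_sum.
- by move=> g; rewrite sumr_ge0.
under eq_integral do rewrite -sumEFin.
rewrite ge0_integral_sum//; last by move=> j; exact/measurable_EFinP.
apply: lte_mul_pinfty; rewrite ?lee_fin//.
apply: lte_sum_pinfty => j _.
exact: le_lt_trans (integral_norm_dotv _) (ltry _).
Qed.

Lemma local_mean_width_ge0 : 0 <= local_mean_width t K.
Proof. by rewrite -lee_fin local_mean_widthE; apply: integral_ge0 => g _; exact: S0. Qed.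

Lemma integral_max_le_width (hs : nat -> 'rV[R]_n) N :
  hs 0%N = 0 -> (forall k, K (hs k)) -> (forall k, enorm (hs k) <= t) ->
  (\int[gam n]_g (maxf (fun l => dotv (vec g) (hs l)) N)%:E <=
   (local_mean_width t K)%:E)%E.
Proof.
move=> hs0 hK ht; rewrite local_mean_widthE; apply: le_integral_nonmeasurable => g.
  by rewrite lee_fin; apply: maxf_ge0; rewrite hs0 dotv0r.
have [k kN ->] := maxf_attained (fun l => dotv (vec g) (hs l)) N.
apply: ereal_sup_ubound; exists (hs k) => //; split; [exact: hK|exact: ht].
Qed.

End local_mean_width.
End width.

Section rows_on_Om.
Context (R : realType) d (Om : measurableType d) (P : probability Om R).
Context dX (Xi : measurableType dX) (nu : probability Xi R) (n m : nat).
Local Notation T1 := (measurableTypeR R).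
Local Notation gam := (std_normal R).
Variables (a : 'I_m -> {RV P >-> n.-tuple T1}) (xi : 'I_m -> {RV P >-> Xi}).
Hypothesis law_a : forall i, has_law (a i) (gam n).
Hypothesis law_xi : forall i, has_law (xi i) nu.
Hypothesis indep : mutually_independent P (fun k : 'I_m + 'I_m =>
    match k with
    | inl i => g_sigma_algebra_preimage (a i)
    | inr i => g_sigma_algebra_preimage (xi i)
    end).

Lemma ge0_integral_all_rows (f : 'rV[R]_(m * n) -> R) :
  measurable_fun setT (f \o @vec R (m * n)) -> (forall x, 0 <= f x) ->
  (\int[P]_o (f (vec (all_rows a o)))%:E = \int[gam (m * n)]_z (f (vec z))%:E)%E.
Proof.
move=> mf f0.
have mF : measurable_fun setT (fun z : (m * n).-tuple T1 * m.-tuple Xi => (f (vec z.1))%:E).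
  by apply/measurable_EFinP; exact: (mvec_comp mf (@mvec_fst _ _ _ _)).
rewrite (ge0_integral_indep (indep_rows_seeds law_a law_xi indep) mF); last first.
  by move=> z; rewrite lee_fin.
rewrite fubini_tonelli1//; last by move=> z; rewrite lee_fin.
apply: eq_integral => z _.
transitivity (\int[distribution P (all_seeds xi)]_x (f (vec z))%:E)%E; first by [].
exact: integral_cst_prob.
Qed.

Definition row_dots (h : 'rV[R]_n) (o : Om) : 'rV[R]_m := \row_i dotv (vec (a i o)) h.

Lemma measurable_enorm_row_dots h : measurable_fun setT (fun o => enorm (row_dots h o)).
Proof.
apply: (@measurableT_comp _ _ _ _ _ _ (@Num.sqrt R)).
  exact: continuous_measurable_fun (@sqrt_continuous R).
have mr : mvec (row_dots h).
  move=> i; apply: eq_measurable_fun (_ : measurable_fun setT (fun o => dotv (vec (a i o)) h)) => [u _|].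
    by rewrite mxE.
  apply: mvec_dotv; last exact: mvec_cst.
  by apply: mvec_vec; exact: measurable_funP.
exact: mvec_dotv.
Qed.

Lemma integral_max_row_dots_le (hs : nat -> 'rV[R]_n) (t w : R) (N : nat) : (0 < m)%N ->
  hs 0%N = 0 -> (forall l, enorm (hs l) <= t) ->
  (\int[gam n]_g (maxf (fun l => dotv (vec g) (hs l)) N)%:E <= w%:E)%E ->
  (\int[P]_o (maxf (fun l => enorm (row_dots (hs l) o)) N)%:E <=
   (18 / 5 * Num.sqrt m%:R * (@abs_moment_bound R * t) + 36 / 5 * w)%:E)%E.
Proof.
move=> m0 hs0 hst hw.
pose f (x : 'rV[R]_(m * n)) := maxf (fun l => enorm (hs l *m (vec_mx x)^T)) N.
have fE o : maxf (fun l => enorm (row_dots (hs l) o)) N = f (vec (all_rows a o)).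
  congr (maxf _ N); apply/funext => l; congr enorm; apply/rowP => i.
  rewrite mxE -row_all_rows dotvC mxE; apply: eq_bigr => j _.
  by rewrite !mxE.
under eq_integral do rewrite fE.
rewrite ge0_integral_all_rows; last 2 first.
- by apply: measurable_maxf => l; apply: measurable_enorm_rows; exact: mvec_vec_id.
- by move=> x; apply: maxf_ge0; exact: enorm_ge0.
apply: (le_trans (integral_max_rows_le N m0 hs0 hst)).
by rewrite EFinD leeD2l// [X in (_ <= X)%E]EFinM lee_wpmul2l// lee_fin divr_ge0.
Qed.

End rows_on_Om.

(** * A measurable version of the multiplier *)

Section score.
Context (R : realType) d (Xi : measurableType d) (nu : probability Xi R).
Context (F : R -> Xi -> R) (L : R -> R -> R) (mu sigma eta : R).
Hypothesis params : model_parameters nu F L mu sigma eta.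
Local Notation T1 := (measurableTypeR R).
Local Notation Q := (normal_prob (0 : R) 1 \x nu)%E.

Let dl (z : T1 * Xi) : R := dloss L (mu * z.1) (F z.1 z.2).

Definition score_fst (z : T1 * Xi) : R := dl z * z.1.

(* Equal to [dl z] when [z.1 != 0] and to [0] otherwise; unlike for [dl] itself,
   measurability is immediate from that of [score_fst]. *)
Definition score (z : T1 * Xi) : R := score_fst z * z.1 * (z.1 ^+ 2) `^ (- 1).

Lemma scoreE z : score z = if z.1 == 0 then 0 else dl z.
Proof.
rewrite /score /score_fst; have [->|z0] := eqVneq; first by rewrite !mulr0 mul0r.
by rewrite powR_inv1 ?sqr_ge0//; field.
Qed.

Lemma score_fst_integrable : Q.-integrable setT (EFin \o score_fst).
Proof. by have [[h _] _ _] := params. Qed.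

Lemma integral_score_fst : (\int[Q]_z (score_fst z)%:E = 0)%E.
Proof. by have [[_ h] _ _] := params; move: h; rewrite unlock. Qed.

Lemma measurable_score_fst : measurable_fun setT score_fst.
Proof. by apply/measurable_EFinP; exact: measurable_int score_fst_integrable. Qed.

Lemma measurable_score : measurable_fun setT score.
Proof.
have m1 : measurable_fun setT (fun z : T1 * Xi => z.1 : R) by exact: measurable_fst.
apply: measurable_funM.
  by apply: measurable_funM => //; exact: measurable_score_fst.
apply: (measurableT_comp (measurable_powR _)).
exact: measurable_funX.
Qed.

Lemma integral_sqr_score_fst : (\int[Q]_z (score_fst z ^+ 2)%:E = (eta ^+ 2)%:E)%E.
Proof.
have [_ _ [_ <-]] := params; rewrite unlock; apply: eq_integral => z _.
by rewrite /score_fst exprMn.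
Qed.

(** Pointwise, [score] is either [dl] or [0]. The inequality is enough and compares the integrals
    directly, without measurability of [dl]. *)
Lemma integral_sqr_score_le : (\int[Q]_z (score z ^+ 2)%:E <= (sigma ^+ 2)%:E)%E.
Proof.
have [_ [_ <-] _] := params; rewrite unlock; apply: le_integral_nonmeasurable => z.
  by rewrite lee_fin sqr_ge0.
by rewrite lee_fin scoreE; case: eqP => // _; rewrite expr0n/= sqr_ge0.
Qed.

End score.

(** * The good event and the recovery bound *)

Lemma normal_prob_set1 (R : realType) (x : R) : normal_prob (0 : R) 1 [set x] = 0%E.
Proof. by rewrite /normal_prob integral_set1. Qed.

Theorem theorem2p3 (R : realType) (p CRSC CL : R) :
  0 < p < 1 -> 0 < CRSC -> 0 < CL ->
  exists C : R, 0 < C /\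
  forall (n m : nat) (dOm dXi : measure_display)
    (Om : measurableType dOm) (P : probability Om R)
    (Xi : measurableType dXi) (nu : probability Xi R)
    (Y : set R) (F : R -> Xi -> R) (L : R -> R -> R) (mu sigma eta : R)
    (x0 : 'rV[R]_n)
    (a : 'I_m -> {RV P >-> n.-tuple (measurableTypeR R)})
    (xi : 'I_m -> {RV P >-> Xi})
    (ytil : Om -> 'I_m -> R)
    (K : set 'rV[R]_n) (t : R),
  let A (w : Om) (i : 'I_m) : 'rV[R]_n := vec (a i w) in
  let y (w : Om) (i : 'I_m) : R := F (dotv (A w i) x0) (xi i w) in
  let KT : set 'rV[R]_n := [set x - mu *: x0 | x in K] in
  let loss (w : Om) := empirical_loss L (A w) (ytil w) in
  let t0 (w : Om) : R :=
    (sigma * Num.sqrt (effective_dim t KT) + eta) / Num.sqrt m%:R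
      + noise_level (y w) (ytil w) in
  (0 < m)%N ->
  enorm x0 = 1 ->
  closed Y ->
  measurable_fun [set: measurableTypeR R * Xi]
    (fun z => F z.1 z.2 : measurableTypeR R) ->
  (forall s e, Y (F s e)) ->
  (forall w i, Y (ytil w i)) ->
  (forall i, has_law (a i) (std_normal R n)) ->
  (forall i, has_law (xi i) nu) ->
  mutually_independent P (fun k : 'I_m + 'I_m =>
    match k with
    | inl i => g_sigma_algebra_preimage (a i)
    | inr i => g_sigma_algebra_preimage (xi i)
    end) ->
  admissible_loss Y L ->
  lipschitz_dloss Y L CL ->
  model_parameters nu F L mu sigma eta ->
  convex_set K ->
  K (mu *: x0) ->
  0 < t ->
  effective_dim t KT <= m%:R ->
  exists G : set Om, [/\ measurable G, (p%:E <= P G)%E &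
    forall w, G w ->
      RSC CRSC t (loss w) (mu *: x0) K ->
      C * t0 w < t ->
      forall xhat, minimizer (loss w) K xhat ->
        enorm (xhat - mu *: x0) <= t].
Proof.
move=> /andP[p0 p1] CR0 CL0.
(* Four bad events share the failure probability [1 - p]. *)
pose del : R := (1 - p) / 4.
have del0 : 0 < del by rewrite divr_gt0// subr_gt0.
have del1 : del < 1 by rewrite /del; lra.
(* Once the width is at most [t * sqrt m], the mean of the largest [|A h|] over the local set is at
   most [D * t * sqrt m]. *)
pose D : R := 18 / 5 * @abs_moment_bound R + 36 / 5.
have D0 : 0 < D by rewrite addr_gt0// mulr_gt0// mulr_gt0// expR_gt0.
(* The summand [1] pays for the ideal part, [CL * D] for the adversarial part and [1 / del] for
   Markov's inequality. Division by [CRSC] below reflects the lower bound from RSC. *)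
pose C1 := (1 + CL * D) / del.
have C10 : 0 < C1 by rewrite divr_gt0// addr_gt0// mulr_gt0.
exists (C1 / CRSC); split; first by rewrite divr_gt0.
move=> n m dOm dXi Om P Xi nu Y F L mu sigma eta x0 a xi ytil K t A y KT loss t0.
move=> m0 nx0 _ _ FY ytY law_a law_xi ind admL lipL params cK Kx0 tpos dm.
have [_ [s0 _] [eta0 _]] := params.
have x01 : dotv x0 x0 = 1 by rewrite -sqr_enorm nx0 expr1n.
have KT0 : KT 0 by exists (mu *: x0); rewrite ?subrr.
pose wd := local_mean_width t KT.
have wd0 : 0 <= wd by apply: local_mean_width_ge0 => //; exact: ltW.
have sqd : Num.sqrt (effective_dim t KT) = wd / t.
  by rewrite /effective_dim -/wd -expr_div_n sqrtr_sqr ger0_norm// divr_ge0// ltW.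
pose rm : R := Num.sqrt m%:R.
have rm0 : 0 < rm by rewrite sqrtr_gt0 ltr0n.
have rm2 : rm ^+ 2 = m%:R by rewrite sqr_sqrtr.
(* The sample size condition enters here. *)
have wdt : wd <= t * rm.
  have : wd / t <= rm by rewrite -sqd; exact: ler_wsqrtr.
  by rewrite ler_pdivrMr// mulrC.
have T0 : (KT `&` euclidean_ball t) 0.
  by split => //; rewrite /euclidean_ball/= /enorm dotv0r sqrtr0 ltW.
have [hs [hs0 hsT dense]] := dense_sequence T0.
have hsK k : KT (hs k) by have [] := hsT k.
have hst k : enorm (hs k) <= t by have [] := hsT k.
have W N := integral_max_le_width (ltW tpos) KT0 N hs0 hsK hst.
pose U i w := proj_seed a xi x0 i w.
pose q := score F L mu.
pose v := score_fst F L mu.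
have mv := measurable_score_fst params.
have mq := measurable_score params.
have mU i : measurable_fun setT (U i) by exact: measurable_proj_seed.
(* [f1] and [f2] control the ideal part, orthogonal to [x0] and along it; [f3] controls the size of
   [A h] against the noise. *)
pose f1 N o := maxf (fun l => \sum_i - q (U i o) * dotv (A o i) (ortho x0 (hs l))) N.
pose f2 (o : Om) : R := (\sum_i v (U i o)) ^+ 2.
pose f3 N o := maxf (fun l => enorm (row_dots a (hs l) o)) N.
have mA i h : measurable_fun setT (fun o => dotv (A o i) h).
  apply: mvec_dotv; last exact: mvec_cst.
  by apply: mvec_vec; exact: measurable_funP.
have I1 N : (\int[P]_o (f1 N o)%:E <= (rm * sigma * wd)%:E)%E.
  apply: (multiplier_mean_le law_a law_xi ind x01 (h := fun u => - q u)) => //.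
    exact: (measurableT_comp (@oppr_measurable R setT) mq).
  under eq_integral do rewrite sqrrN.
  exact: (integral_sqr_score_le params).
have I2 : (\int[P]_o (f2 o)%:E <= (m%:R * eta ^+ 2)%:E)%E.
  apply: (centered_sum_le law_a law_xi ind x01 (v := v)).
  - exact: score_fst_integrable params.
  - exact: integral_score_fst params.
  - by rewrite (integral_sqr_score_fst params).
have I3 N : (\int[P]_o (f3 N o)%:E <= (D * t * rm)%:E)%E.
  apply: (le_trans (integral_max_row_dots_le law_a law_xi ind m0 hs0 hst (W N))).
  rewrite lee_fin -/rm /D.
  have : 36 / 5 * wd <= 36 / 5 * (t * rm) by rewrite ler_wpM2l// divr_ge0.
  by rewrite -/wd; lra.
(* Off [S i] the function [score] is the true multiplier. The projection is standard normal, so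
   [S i] is null; the union is treated like the other bad events, with mean [0]. *)
pose S i := U i @^-1` ([set 0] `*` setT).
have mS i : measurable (S i).
  by rewrite -[X in measurable X]setTI; apply: mU => //; exact: measurableX.
have PS i : P (S i) = 0%E.
  rewrite (law_proj_seed law_a law_xi ind x01); last exact: measurableX.
  by rewrite product_measure1E// [X in (X * _)%E]normal_prob_set1 mul0e.
pose f0 (o : Om) : R := \sum_i \1_(S i) o.
have mf0 : measurable_fun setT f0 by apply: measurable_sum => i; exact: measurable_indic.
have I0 : (\int[P]_o (f0 o)%:E <= 0%:E)%E.
  under eq_integral do rewrite -sumEFin.
  rewrite ge0_integral_sum//; last first.
    by move=> i; apply/measurable_EFinP; exact: measurable_indic.
  by rewrite big1// => i _; rewrite integral_indic// setIT; exact: PS.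
have f00 o : 0 <= f0 o by rewrite sumr_ge0.
have mf1 N : measurable_fun setT (f1 N).
  apply: measurable_maxf => l; apply: measurable_sum => i; apply: measurable_funM => //.
  exact: (measurableT_comp (@oppr_measurable R setT) (measurableT_comp mq (mU i))).
have f10 N o : 0 <= f1 N o.
  apply: maxf_ge0; rewrite big1// => i _.
  by rewrite hs0 /ortho dotv0l scale0r subr0 dotv0r mulr0.
have mf2 : measurable_fun setT f2.
  apply: measurable_funX; apply: measurable_sum => i.
  exact: (measurableT_comp mv (mU i)).
have f20 o : 0 <= f2 o by exact: sqr_ge0.
have mf3 N : measurable_fun setT (f3 N).
  by apply: measurable_maxf => l; exact: measurable_enorm_row_dots.
have f30 N o : 0 <= f3 N o by apply: maxf_ge0; exact: enorm_ge0.
have c1 : 0 <= rm * sigma * wd by rewrite !mulr_ge0// ltW.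
have c2 : 0 <= m%:R * eta ^+ 2 by rewrite mulr_ge0// sqr_ge0.
have c3 : 0 <= D * t * rm by rewrite !mulr_ge0// ltW.
have [mB0 PB0] := markov_seq_le (lexx 0) del0 (fun=> mf0) (fun=> f00)
  (fun _ _ _ _ => lexx _) (fun=> I0).
have [mB1 PB1] := markov_seq_le c1 del0 mf1 f10 (fun N M o => @maxf_homo _ _ N M) I1.
have [mB2 PB2] := markov_seq_le c2 del0 (fun=> mf2) (fun=> f20)
  (fun _ _ _ _ => lexx _) (fun=> I2).
have [mB3 PB3] := markov_seq_le c3 del0 mf3 f30 (fun N M o => @maxf_homo _ _ N M) I3.
set B0 := \bigcup_N _ in mB0 PB0; set B1 := \bigcup_N _ in mB1 PB1.
set B2 := \bigcup_N _ in mB2 PB2; set B3 := \bigcup_N _ in mB3 PB3.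
have mB : measurable (B0 `|` B1 `|` (B2 `|` B3)) by do !apply: measurableU => //.
(* The event depends on rows and seeds only, not on [ytil], hence it is measurable whatever the
   actual observations are. *)
exists (~` (B0 `|` B1 `|` (B2 `|` B3))); split; first exact: measurableC.
  rewrite probability_setC// leeBrDr ?fin_num_measure// -leeBrDl//.
  rewrite -EFinB; apply: (le_trans (measureU2 _ _ _)) => //; try exact: measurableU.
  apply: (@le_trans _ _ ((del%:E + del%:E) + (del%:E + del%:E))%E).
    by apply: leeD; apply: (le_trans (measureU2 _ _ _)) => //; exact: leeD.
  by rewrite -!EFinD lee_fin /del; lra.
move=> w Gw rsc t0t xhat xmin; rewrite leNgt; apply/negP => tx.
have nB0 : f0 w <= 0.
  rewrite leNgt; apply/negP => h; apply: Gw; left; left; exists 0%N => //=.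
  by rewrite mul0r.
have nB1 N : f1 N w <= rm * sigma * wd / del.
  by rewrite leNgt; apply/negP => h; apply: Gw; left; right; exists N.
have nB2 : f2 w <= m%:R * eta ^+ 2 / del.
  by rewrite leNgt; apply/negP => h; apply: Gw; right; left; exists 0%N.
have nB3 N : f3 N w <= D * t * rm / del.
  by rewrite leNgt; apply/negP => h; apply: Gw; right; right; exists N.
have [h [Kh nh hgrad]] := rsc_minimizer admL (ytY w) cK Kx0 tpos rsc xmin tx.
set g := grad _ _ in hgrad.
pose T0w := t0 w.
have hT : (KT `&` euclidean_ball t) h.
  split; first by exists (mu *: x0 + h) => //; rewrite addrC addKr.
  by rewrite /euclidean_ball/= nh.
(* At a fixed sample point [g] is a fixed vector, so the bound passes from the dense sequence to [h]
   by Cauchy-Schwarz. The [+ 1] below keeps the denominator positive. *)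
suff key l : - dotv g (hs l) <= t * C1 * T0w.
  have : - dotv g h <= t * C1 * T0w.
    apply/ler_addgt0Pr => e e0.
    have ng : 0 < enorm g + 1 by rewrite ltr_wpDl ?enorm_ge0.
    have [k hk] := dense h hT (e / (enorm g + 1)) (divr_gt0 e0 ng).
    have := key k; have := dotv_le g (h - hs k); rewrite dotvBr => h1 h2.
    have h3 : enorm g * enorm (h - hs k) <= e.
      move: hk; rewrite ltr_pdivlMr// => hk.
      have := enorm_ge0 g; have := enorm_ge0 (h - hs k); nra.
    move: h1; rewrite ler_norml => /andP[h1 _]; lra.
  (* After one factor [t] is cancelled, [CRSC * t <= C1 * T0w] contradicts the assumed lower bound
     on [t]. *)
  move=> /(le_trans hgrad); rewrite expr2 mulrCA -mulrA ler_pM2l// => hc.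
  move: t0t; rewrite mulrAC ltr_pdivrMr// mulrC; rewrite -/T0w; lra.
pose s i := dotv (A w i) x0.
pose X i := dotv (A w i) (hs l).
have sN0 i : s i != 0.
  apply/eqP => si0; have : \1_(S i) w <= f0 w :> R.
    by rewrite /f0 (bigD1 i)//= lerDl sumr_ge0.
  have -> : \1_(S i) w = 1 :> R by rewrite indicE mem_set.
  by move=> /le_trans/(_ nB0); rewrite ler10.
pose b i := dloss L (mu * s i) (y w i).
pose c i := dloss L (mu * s i) (ytil w i).
have qE i : q (U i w) = b i by rewrite /q scoreE /= (negbTE (sN0 i)).
have vE i : v (U i w) = b i * s i by [].
have gE : dotv g (hs l) = m%:R^-1 * \sum_i c i * X i.
  rewrite /g (dotv_grad_empirical_loss (A w) admL (ytY w)); congr (_ * _).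
  by apply: eq_bigr => i _; rewrite dotvZr.
pose nl := noise_level (y w) (ytil w).
have nl0 : 0 <= nl by exact: sqrtr_ge0.
have mR0 : (m%:R : R) != 0 by rewrite pnatr_eq0 -lt0n.
have nlE : (rm * nl) ^+ 2 = \sum_i `|ytil w i - y w i| ^+ 2.
  rewrite exprMn rm2 /nl /noise_level sqr_sqrtr; first by rewrite mulVKf.
  by rewrite mulr_ge0 ?invr_ge0// sumr_ge0// => i _; rewrite sqr_ge0.
(* Cauchy-Schwarz: the Lipschitz condition bounds the multiplier differences by [CL * rm * nl] in l2
   norm, and the event for [f3] bounds the other factor. *)
have noise : \sum_i (b i - c i) * X i <= CL * (rm * nl) * (D * t * rm / del).
  pose bc : 'rV[R]_m := \row_i (b i - c i).
  have -> : \sum_i (b i - c i) * X i = dotv bc (row_dots a (hs l) w).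
    by apply: eq_bigr => i _; rewrite !mxE.
  apply: (le_trans (ler_norm _)); apply: (le_trans (dotv_le _ _)).
  apply: ler_pM; rewrite ?enorm_ge0//; last first.
    by apply: le_trans (nB3 l); exact: (le_maxf (fun l => enorm (row_dots a (hs l) w)) (leqnn l)).
  have rhs0 : 0 <= CL * (rm * nl) by rewrite !mulr_ge0// ltW.
  rewrite -(ler_pXn2r (_ : 0 < 2)%N) ?nnegrE ?enorm_ge0//.
  rewrite sqr_enorm exprMn nlE big_distrr/= /dotv; apply: ler_sum => i _.
  rewrite !mxE -expr2 -exprMn -real_normK ?num_real//.
  rewrite ler_pXn2r ?nnegrE// ?mulr_ge0 ?(ltW CL0)// distrC; apply: lipL; [exact: ytY|exact: FY].
have multiplier : \sum_i - b i * dotv (A w i) (ortho x0 (hs l)) <= rm * sigma * wd / del.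
  apply: le_trans (nB1 l).
  pose G1 l := \sum_i - q (U i w) * dotv (A w i) (ortho x0 (hs l)).
  have -> : \sum_i - b i * dotv (A w i) (ortho x0 (hs l)) = G1 l.
    by apply: eq_bigr => i _; rewrite qE.
  exact: (le_maxf G1 (leqnn l)).
(* Markov's inequality for the square yields a factor [1 / sqrt del], enlarged to [1 / del] since
   [del < 1]. *)
have centered : `|\sum_i b i * s i| <= rm * eta / del.
  have rhs0 : 0 <= rm * eta / del by rewrite divr_ge0 ?(ltW del0)// mulr_ge0 ?(ltW rm0).
  rewrite -(ler_pXn2r (_ : 0 < 2)%N) ?nnegrE//.
  rewrite real_normK ?num_real//; apply: (le_trans nB2).
  rewrite expr_div_n exprMn rm2; apply: ler_wpM2l => //.
  by rewrite lef_pV2 ?posrE ?exprn_gt0// expr2 ler_piMl// ltW.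
have hx0 : `|dotv (hs l) x0| <= t.
  by apply: (le_trans (dotv_le _ _)); rewrite nx0 mulr1.
(* Write [c] as [b - (b - c)], and [hs l] as its part orthogonal to [x0] plus its part along
   [x0]. *)
have split_sum : - \sum_i c i * X i = \sum_i (b i - c i) * X i +
    (\sum_i - b i * dotv (A w i) (ortho x0 (hs l)) -
     dotv (hs l) x0 * \sum_i b i * s i).
  rewrite big_distrr/= -!sumrN -!big_split/=; apply: eq_bigr => i _.
  rewrite /ortho dotvBr dotvZr -/(s i) -/(X i); ring.
have cross : - (dotv (hs l) x0 * \sum_i b i * s i) <= t * (rm * eta / del).
  apply: (le_trans (ler_norm _)); rewrite normrN normrM.
  by apply: ler_pM.
rewrite gE -mulrN split_sum.
apply: (@le_trans _ _ (m%:R^-1 * (CL * (rm * nl) * (D * t * rm / del) +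
    (rm * sigma * wd / del + t * (rm * eta / del))))).
  by apply: ler_wpM2l; [rewrite invr_ge0|apply: lerD => //; exact: lerD].
rewrite /T0w /t0 sqd -/rm -/nl -rm2 /C1.
rewrite -subr_ge0.
(* What remains are the cross terms of [(1 + CL * D)] with the sum of ideal and adversarial errors:
   [CL * D] times the former and [1] times the latter. *)
have -> : t * ((1 + CL * D) / del) * ((sigma * (wd / t) + eta) / rm + nl) -
   (rm ^+ 2)^-1 * (CL * (rm * nl) * (D * t * rm / del) +
    (rm * sigma * wd / del + t * (rm * eta / del))) =
   (CL * D * ((sigma * wd + t * eta) / rm) + t * nl) / del.
  by field; rewrite !gt_eqF.
by rewrite divr_ge0 ?(ltW del0)// addr_ge0// !mulr_ge0 ?addr_ge0 ?mulr_ge0 ?invr_ge0// ltW.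
Qed.
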